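(* Let $(M,g,J)$ be a $2n$-dimensional connected almost Kähler manifold with $n\ge 4$. If $(M,g,J)$ has pointwise constant antiholomorphic sectional curvature, then $(M,g,J)$ is a complex space-form, i.e. a Kähler manifold with constant holomorphic sectional curvature.
   Context: An almost Hermitian manifold $(M,g,J)$ is a smooth manifold with a Riemannian metric $g$ and an almost complex structure $J$ ($J^2=-\mathrm{Id}$) such that $g(JX,JY)=g(X,Y)$. Its fundamental 2-form is $\omega(X,Y)=g(JX,Y)$, and $\nabla$ is the Levi-Civita connection of $g$. The manifold is almost Kähler if $(\nabla_V\omega)(X,Y)+(\nabla_X\omega)(Y,V)+(\nabla_Y\omega)(V,X)=0$ for all vector fields $V,X,Y$ (equivalently $d\omega=0$); it is Kähler if $\nabla J=0$. A 2-plane $\alpha\subset T_xM$ is antiholomorphic if it is orthogonal to $J\alpha$, and holomorphic if $J\alpha=\alpha$. $(M,g,J)$ has pointwise constant antiholomorphic sectional curvature $\nu$ if at every point $x\in M$ the Riemannian sectional curvature $K_x(\alpha)=\nu(x)$ is the same for all antiholomorphic 2-planes $\alpha\subset T_xM$ (a priori $\nu$ is a function on $M$). Holomorphic sectional curvature is the sectional curvature of holomorphic 2-planes; it is constant if it is independent of both the point and the holomorphic 2-plane. *)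

(* Defs.v *)
From mathcomp Require Import all_boot all_order all_algebra.
From mathcomp Require Import all_classical all_reals all_analysis.

Set Implicit Arguments.
Unset Strict Implicit.
Unset Printing Implicit Defensive.

Import Order.TTheory GRing.Theory Num.Theory.
Import numFieldNormedType.Exports.

Local Open Scope classical_set_scope.
Local Open Scope ring_scope.

(** Tensor fields on a manifold are given by their components in the charts,
    together with the transformation law under changes of charts.  Vectors are
    row vectors, so a linear endomorphism with matrix [A] is [v |-> v *m A] and
    a bilinear form with matrix [G] is [(u, v) |-> u *m G *m v^T]. *)

Section Smooth.
Context {R : realType} {m : nat}.

Definition partial (i : 'I_m) (f : 'rV[R]_m -> R) : 'rV[R]_m -> R :=
  fun p => 'D_(delta_mx 0 i : 'rV[R]_m) f p.

(** C^oo on [U] (meant for open [U]): the iterated partial derivatives of all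
    orders exist and are continuous at every point of [U]. *)
Definition smooth_on (U : set 'rV[R]_m) (f : 'rV[R]_m -> R) : Prop :=
  forall (s : seq 'I_m) (p : 'rV[R]_m), U p ->
    {for p, continuous (foldr partial f s)} /\
    forall i, derivable (foldr partial f s) p (delta_mx 0 i : 'rV[R]_m).

Definition mx_smooth_on (k l : nat) (U : set 'rV[R]_m)
    (F : 'rV[R]_m -> 'M[R]_(k, l)) : Prop :=
  forall i j, smooth_on U (fun p => F p i j).

End Smooth.

(** A chart is a homeomorphism of an open subset of [T] onto an open subset of
    R^m; the values of [cmap] and [cinv] outside these sets are irrelevant. *)
Record chart (R : realType) (m : nat) (T : topologicalType) := Chart {
  cdom : set T;
  cmap : T -> 'rV[R]_m;
  cinv : 'rV[R]_m -> T;
  cdom_open : open cdom;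
  cimg_open : open (cmap @` cdom);
  cmapK : forall x, cdom x -> cinv (cmap x) = x;
  cmap_cts : forall x, cdom x -> {for x, continuous cmap};
  cinv_cts : forall p, (cmap @` cdom) p -> {for p, continuous cinv} }.

Definition cimg (R : realType) (m : nat) (T : topologicalType)
  (a : chart R m T) : set 'rV[R]_m := cmap a @` cdom a.

Definition transition (R : realType) (m : nat) (T : topologicalType)
  (a b : chart R m T) : 'rV[R]_m -> 'rV[R]_m := fun p => cmap b (cinv a p).

Record smoothManifold (R : realType) (m : nat) := SmoothManifold {
  points :> topologicalType;
  points_hausdorff : hausdorff_space points;
  points_second_countable : @second_countable points;
  atlas : set (chart R m points);
  atlas_cover : forall x : points, exists2 a, atlas a & cdom a x;
  atlas_smooth : forall a b, atlas a -> atlas b ->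
    mx_smooth_on (cmap a @` (cdom a `&` cdom b)) (transition a b) }.

Definition bil {R : realType} {m : nat} (G : 'M[R]_m) (u v : 'rV[R]_m) : R :=
  (u *m G *m v^T) 0 0.

(** The differential of the transition map at [p] sends the components of a
    tangent vector in the chart [a] to its components in the chart [b]; it
    occurs below as the directional derivative [u |-> 'D_u (transition a b) p]. *)
Record almostHermitian (R : realType) (m : nat) (M : smoothManifold R m) :=
    AlmostHermitian {
  metric : chart R m M -> 'rV[R]_m -> 'M[R]_m;
  acs : chart R m M -> 'rV[R]_m -> 'M[R]_m;
  metric_smooth : forall a, atlas a -> mx_smooth_on (cimg a) (metric a);
  acs_smooth : forall a, atlas a -> mx_smooth_on (cimg a) (acs a);
  metric_transition : forall a b, atlas a -> atlas b ->
    forall x, cdom a x -> cdom b x -> forall u v : 'rV[R]_m,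
      bil (metric b (cmap b x)) ('D_u (transition a b) (cmap a x))
                                ('D_v (transition a b) (cmap a x))
      = bil (metric a (cmap a x)) u v;
  acs_transition : forall a b, atlas a -> atlas b ->
    forall x, cdom a x -> cdom b x -> forall u : 'rV[R]_m,
      ('D_u (transition a b) (cmap a x) : 'rV[R]_m) *m acs b (cmap b x)
      = 'D_(u *m acs a (cmap a x)) (transition a b) (cmap a x);
  metric_sym : forall a, atlas a -> forall p, cimg a p -> forall u v,
    bil (metric a p) u v = bil (metric a p) v u;
  metric_pos : forall a, atlas a -> forall p, cimg a p -> forall u,
    u != 0 -> 0 < bil (metric a p) u u;
  acs_sqr : forall a, atlas a -> forall p, cimg a p ->
    acs a p *m acs a p = - 1%:M;
  acs_isometry : forall a, atlas a -> forall p, cimg a p -> forall u v,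
    bil (metric a p) (u *m acs a p) (v *m acs a p) = bil (metric a p) u v }.

Section LocalGeometry.
Context {R : realType} {m : nat}.
Implicit Types (g J : 'rV[R]_m -> 'M[R]_m) (X Y Z V : 'rV[R]_m -> 'rV[R]_m).

(** [christoffel g k i j] is the symbol with upper index [k]. *)
Definition christoffel g (k i j : 'I_m) (p : 'rV[R]_m) : R :=
  2^-1 * \sum_(l < m) invmx (g p) k l *
    (partial i (fun q => g q j l) p + partial j (fun q => g q i l) p
     - partial l (fun q => g q i j) p).

(** The Levi-Civita covariant derivative of [X] along [V]. *)
Definition nabla g V X : 'rV[R]_m -> 'rV[R]_m := fun p =>
  'D_(V p) X p
  + \row_k \sum_(i < m) \sum_(j < m) christoffel g k i j p * V p 0 i * X p 0 j.

Definition lie X Y : 'rV[R]_m -> 'rV[R]_m := fun p =>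
  'D_(X p) Y p - 'D_(Y p) X p.

Definition curv g X Y Z : 'rV[R]_m -> 'rV[R]_m := fun p =>
  nabla g X (nabla g Y Z) p - nabla g Y (nabla g X Z) p
  - nabla g (lie X Y) Z p.

(** The curvature is a tensor, so the vectors [u] and [v] may be extended by
    vector fields with constant components. *)
Definition sectional g (p u v : 'rV[R]_m) : R :=
  bil (g p) (curv g (cst u) (cst v) (cst v) p) u
  / (bil (g p) u u * bil (g p) v v - bil (g p) u v ^+ 2).

Definition kform g J X Y : 'rV[R]_m -> R := fun p =>
  bil (g p) (X p *m J p) (Y p).

Definition nabla_kform g J V X Y : 'rV[R]_m -> R := fun p =>
  'D_(V p) (kform g J X Y) p
  - kform g J (nabla g V X) Y p - kform g J X (nabla g V Y) p.

Definition nabla_acs g J V X : 'rV[R]_m -> 'rV[R]_m := fun p =>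
  nabla g V (fun q => X q *m J q) p - nabla g V X p *m J p.

(** A 2-plane is the row space of a matrix [P : 'M_(2, m)] of rank 2;
    its sectional curvature does not depend on the chosen basis. *)
Definition plane_curv g (p : 'rV[R]_m) (P : 'M[R]_(2, m)) : R :=
  sectional g p (row 0 P) (row 1 P).

Definition antiholomorphic (G J : 'M[R]_m) (P : 'M[R]_(2, m)) : Prop :=
  forall u v : 'rV[R]_m, (u <= P)%MS -> (v <= P)%MS -> bil G u (v *m J) = 0.

Definition holomorphic (J : 'M[R]_m) (P : 'M[R]_(2, m)) : Prop :=
  (P *m J == P)%MS.

End LocalGeometry.

Section Global.
Context {R : realType} {m : nat} {M : smoothManifold R m}.
Variable H : almostHermitian M.

Definition almost_Kahler : Prop :=
  forall a, atlas a -> forall V X Y : 'rV[R]_m -> 'rV[R]_m,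
    mx_smooth_on (cimg a) V -> mx_smooth_on (cimg a) X ->
    mx_smooth_on (cimg a) Y -> forall p, cimg a p ->
    nabla_kform (metric H a) (acs H a) V X Y p
    + nabla_kform (metric H a) (acs H a) X Y V p
    + nabla_kform (metric H a) (acs H a) Y V X p = 0.

Definition Kahler : Prop :=
  forall a, atlas a -> forall V X : 'rV[R]_m -> 'rV[R]_m,
    mx_smooth_on (cimg a) V -> mx_smooth_on (cimg a) X ->
    forall p, cimg a p -> nabla_acs (metric H a) (acs H a) V X p = 0.

Definition pointwise_constant_antiholomorphic_curvature : Prop :=
  exists nu : M -> R, forall a, atlas a -> forall x : M, cdom a x ->
    forall P : 'M[R]_(2, m), \rank P = 2%N ->
      antiholomorphic (metric H a (cmap a x)) (acs H a (cmap a x)) P ->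
      plane_curv (metric H a) (cmap a x) P = nu x.

Definition constant_holomorphic_curvature : Prop :=
  exists c : R, forall a, atlas a -> forall x : M, cdom a x ->
    forall P : 'M[R]_(2, m), \rank P = 2%N ->
      holomorphic (acs H a (cmap a x)) P ->
      plane_curv (metric H a) (cmap a x) P = c.

Definition complex_space_form : Prop :=
  Kahler /\ constant_holomorphic_curvature.

End Global.

(* Main.v *)
From HB Require Import structures.
Require Import Defs.
From mathcomp Require Import all_boot all_order all_algebra.
From mathcomp Require Import all_classical all_reals all_analysis.
From mathcomp Require Import ring lra.
Set Implicit Arguments.
Unset Strict Implicit.
Unset Printing Implicit Defensive.
Import Order.TTheory GRing.Theory Num.Theory.
Local Open Scope ring_scope.

(** Write [A v] for the covariant derivative of [J] along [v],
    [phi v x y = <A v x, y>] for that of the fundamental form [om], and [R] for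
    the curvature.  The proof derives from the hypothesis enough algebraic
    identities at one point to force [A = 0] and [dnu = 0] there.

    - The expression [R x y y x - nu (|x|^2 |y|^2 - <x,y>^2)] vanishes whenever
      [om x y = 0], so it is divisible by [om]: it is [om x y * sigma x y] for a
      2-form [sigma] ([quotP], [quot_skew]).  A curvature tensor is determined
      by its sectional values, hence [R] is [nu] times the tensor of constant
      curvature one minus a sixth of a Kulkarni-Nomizu type product of [om] and
      [sigma] ([curv_quot]).

    - For [v], [x], [y] pairwise orthogonal for the hermitian form, the second
      Bianchi identity for this [R] expresses [dnu v] by [sigma] and [phi]
      ([bianchi_antihol]).  The derivatives of [sigma] do not enter, because
      they come with a factor [om] that vanishes on such vectors.

    - As [om] is closed, [phi] and the Nijenhuis tensor [N] carry the same
      information: [<N x y, z> = phi z x y].  Gray's identity, a consequence of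
      the Ricci identity for [om], expresses the scalar products of the values
      of [N] by the curvature ([gray_identity]).  Here it says that
      [<N x y, N z u>] is a product of the hermitian form with the symmetric
      form [tau] made of [nu] and the part of [sigma] invariant under [J].

    - From here on the argument is linear algebra in dimension at least 8.
      Rotating the vectors in the Bianchi relation by [J] shows that either
      [A = 0] or [sigma] is invariant under [J] ([anti_sigma_or_parallel]); in
      both cases [dnu = 0] ([dnu_eq0]).  In the second case, suppose that some
      [u] is not an eigenvector of [sigma] (as a complex endomorphism).  Then
      there is [z] orthogonal to [u] with [N z u = 0], and for orthogonal [x],
      [x'] in the complement of [u] and [z] the three vectors [N x u], [N x' u],
      [N x x'] are nonzero, pairwise orthogonal and contained in the complex
      plane spanned by [u] and [z], which is absurd ([all_eigen]).  If all
      vectors are eigenvectors and [N x y <> 0], then [tau] is positive on [x]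
      and [y].  A count of dimensions gives [z] and [z'], not both zero and
      orthogonal to [y] and to [x], [y] respectively, with
      [N z y + N z' x = 0]; but these two terms are orthogonal and they do not
      both vanish ([nijenhuis_eq0]).  Hence [A = 0].

    - Once [A = 0], Gray's identity makes [tau] vanish ([tau_eq0]), which says
      that the holomorphic sectional curvature is [4 * nu].  Finally [nu] is
      locally constant, hence constant since the manifold is connected.

    The function [nu] is given without any regularity; it is differentiable as
    a quotient of smooth functions ([nu_locally_smooth]).  In a chart all
    tensors are evaluated on vector fields with constant components.  These
    commute, so covariant derivatives are given by connection matrices and the
    identities above become identities between matrix fields. *)

(** * Linear algebra *)

Lemma linear_kernel (R : fieldType) (d k : nat) (L : 'rV[R]_d -> 'rV[R]_k) :
  linear L -> (k < d)%N -> exists2 v, v != 0 & L v = 0.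
Proof.
move=> linL kd; pose A : 'M[R]_(d, k) := lin1_mx L.
have : kermx A != 0.
  rewrite kermx_eq0 /row_free; apply: contraTneq kd => <-.
  by rewrite -leqNgt rank_leq_col.
case/rowV0Pn => v /sub_kermxP vA v0; exists v => //; rewrite -vA.
pose L' := GRing.isLinear.Build _ _ _ _ L linL.
pose Ll : {linear _ -> _} := HB.pack L L'.
by rewrite (mul_rV_lin1 Ll).
Qed.

Section ScalarTheory.
Context {R : realFieldType} {V : lmodType R} (f : V -> R).
Hypothesis sf : scalar f.
Lemma scalar_formD x y : f (x + y) = f x + f y.
Proof. by have := sf 1 x y; rewrite scale1r mul1r. Qed.
Lemma scalar_form0 : f 0 = 0.
Proof. by have := scalar_formD 0 0; rewrite addr0; lra. Qed.
Lemma scalar_formZ a x : f (a *: x) = a * f x.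
Proof. by have := sf a x 0; rewrite addr0 scalar_form0 addr0. Qed.
Lemma scalar_formN x : f (- x) = - f x.
Proof. by rewrite -scaleN1r scalar_formZ mulN1r. Qed.
End ScalarTheory.

Lemma scalar_expand (R : realFieldType) (m : nat) (f : 'rV[R]_m -> R) x : scalar f ->
  f x = \sum_i x 0 i * f (delta_mx 0 i).
Proof.
move=> sf; rewrite {1}[x]row_sum_delta; elim/big_rec2: _ => [|i a b _ <-].
  exact: scalar_form0.
by rewrite (scalar_formD sf) (scalar_formZ sf).
Qed.

(** * The curvature identities of an almost Kähler metric at one point *)

Section PointwiseAlgebra.
Context {R : realFieldType} {m : nat}.
Local Notation V := 'rV[R]_m.
Variables (ip : V -> V -> R) (J : V -> V).

Record hermitian_form : Prop := HermitianForm {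
  ip_scalar : forall z, scalar (ip^~ z);
  ip_sym : forall x y, ip x y = ip y x;
  ip_pos : forall x, x != 0 -> 0 < ip x x;
  J_linear : linear J;
  J_sqr : forall x, J (J x) = - x;
  J_isometry : forall x y, ip (J x) (J y) = ip x y }.

Hypothesis H : hermitian_form.
Implicit Types (x y z u v w : V) (a b : R).

Let ipC x y : ip x y = ip y x. Proof. exact: ip_sym. Qed.
Let ipDl x y z : ip (x + y) z = ip x z + ip y z.
Proof. exact: (scalar_formD (ip_scalar H z)). Qed.
Let ip0l z : ip 0 z = 0.
Proof. exact: (scalar_form0 (ip_scalar H z)). Qed.
Let ipZl a x z : ip (a *: x) z = a * ip x z.
Proof. exact: (scalar_formZ (ip_scalar H z)). Qed.
Let ipNl x z : ip (- x) z = - ip x z.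
Proof. exact: (scalar_formN (ip_scalar H z)). Qed.
Let ipDr x y z : ip z (x + y) = ip z x + ip z y.
Proof. by rewrite ipC ipDl !(ipC z). Qed.
Let ipZr a x z : ip z (a *: x) = a * ip z x.
Proof. by rewrite ipC ipZl !(ipC z). Qed.
Let ipNr x z : ip z (- x) = - ip z x.
Proof. by rewrite ipC ipNl !(ipC z). Qed.
Let ip0r z : ip z 0 = 0.
Proof. by rewrite ipC ip0l. Qed.

Let JD x y : J (x + y) = J x + J y.
Proof. by have := J_linear H 1 x y; rewrite !scale1r. Qed.
Let J0 : J 0 = 0.
Proof. by have /eqP := JD 0 0; rewrite addr0 addrC -subr_eq subrr => /eqP. Qed.
Let JZ a x : J (a *: x) = a *: J x.
Proof. by have := J_linear H a x 0; rewrite J0 !addr0. Qed.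
Let JN x : J (- x) = - J x.
Proof. by rewrite -!scaleN1r JZ. Qed.
Let JJ x : J (J x) = - x. Proof. exact: J_sqr. Qed.
Let ipJJ x y : ip (J x) (J y) = ip x y. Proof. exact: J_isometry. Qed.
Let ipJl x y : ip (J x) y = - ip x (J y).
Proof. by rewrite -(ipJJ x) JJ ipNr opprK. Qed.
Let ipxJx x : ip x (J x) = 0.
Proof. by have := ipJl x x; rewrite ipC; lra. Qed.
Let ip_eq0 x : ip x x = 0 -> x = 0.
Proof. by move=> h; apply/eqP/negPn/negP => /(ip_pos H); rewrite h ltxx. Qed.
Let ip_gt0 x : x != 0 -> 0 < ip x x. Proof. exact: ip_pos. Qed.

Let ipE := (ipDl, ipDr, ipNl, ipNr, ipZl, ipZr, ip0l, ip0r).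
Let JE := (JD, JN, JZ, JJ).

(** Orthogonality for the complex hermitian product of which [ip] is the real
    part. *)
Definition cperp x y := ip x y = 0 /\ ip x (J y) = 0.

Lemma cperpC x y : cperp x y -> cperp y x.
Proof. by case=> a b; split; rewrite ipC // ipJl b oppr0. Qed.
Lemma cperpJr x y : cperp x y -> cperp x (J y).
Proof. by case=> a b; split; rewrite ?JJ ?ipNr ?a ?oppr0. Qed.
Lemma cperpJl x y : cperp x y -> cperp (J x) y.
Proof. by move=> /cperpC/cperpJr/cperpC. Qed.
Lemma cperpDr x y z : cperp x y -> cperp x z -> cperp x (y + z).
Proof. by move=> [a b] [c d]; split; rewrite ?JD ipDr ?a ?b ?c ?d addr0. Qed.
Lemma cperpDl x y z : cperp x z -> cperp y z -> cperp (x + y) z.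
Proof. by move=> /cperpC a /cperpC b; apply/cperpC/cperpDr. Qed.
Lemma cperpZr a x y : cperp x y -> cperp x (a *: y).
Proof. by move=> [c d]; split; rewrite ?JZ ipZr ?c ?d mulr0. Qed.
Lemma cperpZl a x y : cperp x y -> cperp (a *: x) y.
Proof. by move=> /cperpC/(cperpZr a)/cperpC. Qed.
Lemma cperpNr x y : cperp x y -> cperp x (- y).
Proof. by rewrite -scaleN1r; exact: cperpZr. Qed.

(** Orthogonal projection along the complex line of [y]; it does not disturb
    orthogonality to vectors that are already orthogonal to [y]. *)
Lemma cperp_split y x : exists x' a b, [/\ x = x' + a *: y + b *: J y, cperp x' y &
  forall z, cperp x z -> cperp y z -> cperp x' z].
Proof.
have [->|y0] := eqVneq y 0.
  exists x, 0, 0; rewrite J0 !scaler0 !addr0; split => //.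
  by split; rewrite ?J0 ip0r.
have yy := ip_gt0 y0; have yyn : ip y y != 0 by rewrite gt_eqF.
exists (x - (ip x y / ip y y) *: y - (ip x (J y) / ip y y) *: J y),
  (ip x y / ip y y), (ip x (J y) / ip y y); split.
- by rewrite -addrA [X in _ = _ + X]addrC addrA !subrK.
- split; rewrite !ipE ?ipJl ?JE ?ipE ?ipJJ ?ipxJx; field; exact: yyn.
- move=> z xz yz; rewrite -!scaleNr; apply: cperpDl; first apply: cperpDl => //.
    exact: cperpZl.
  by apply: cperpZl; apply: cperpJl.
Qed.

Lemma ortho_vector (ws : seq V) : (size ws < m)%N ->
  exists2 v, v != 0 & forall w, w \in ws -> ip v w = 0.
Proof.
move=> sm; pose L v : 'rV[R]_(size ws) := \row_i ip v ws`_i.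
have [|v v0 Lv] := @linear_kernel _ _ _ L _ sm.
  by move=> a x y; apply/rowP => i; rewrite !mxE !ipE.
exists v => // w /(nthP 0)[i iw <-].
by move/rowP/(_ (Ordinal iw)): Lv; rewrite !mxE.
Qed.

Lemma cperp_vector (ws : seq V) : ((size ws).*2 < m)%N ->
  exists2 v, v != 0 & forall w, w \in ws -> cperp v w.
Proof.
move=> sm; have [|v v0 Hv] := @ortho_vector (ws ++ map J ws).
  by rewrite size_cat size_map addnn.
exists v => // w ww; split; apply: Hv; rewrite mem_cat ?ww //.
by rewrite map_f ?orbT.
Qed.

Variables (A : V -> V -> V) (sigma : V -> V -> R) (nu : R) (dnu : V -> R).
Local Notation phi v x y := (ip (A v x) y).

Definition nijenhuis x y := A y x - A x y.
Local Notation N := nijenhuis.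

(** The symmetric form by which Gray's identity describes the Nijenhuis tensor;
    on a complex space form, where the holomorphic curvature is [4 * nu], it is
    zero. *)
Definition tau x y := 6^-1 * (sigma x (J y) - sigma (J x) y) - nu * ip x y.

(** The Kulkarni-Nomizu product of [ip] and [tau], combined with its rotations by
    [J] so that, like [<N x y, N z u>], it changes sign when [J] is applied to
    both [x] and [y] or to both [z] and [u]. *)
Definition wedge_form x y z u :=
  ip x z * tau y u + tau x z * ip y u - ip x (J z) * tau y (J u) - tau x (J z) * ip y (J u)
  - (ip x u * tau y z + tau x u * ip y z - ip x (J u) * tau y (J z) - tau x (J u) * ip y (J z)).

(** The derivative of the fundamental form of an almost Kähler manifold is the
    real part of a complex trilinear form: in the last two arguments because
    [A v] anticommutes with [J], hence in the first one by the cyclic identity. *)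
Lemma phi_J_left : (forall v x y, phi v x y = - phi v y x) ->
  (forall v x, A v (J x) = - J (A v x)) ->
  (forall v x y, phi v x y + phi x y v + phi y v x = 0) ->
  forall v x y, phi (J v) x y = phi v (J x) y.
Proof.
move=> skew AJ cyc v x y.
have J3 w z t : phi w z (J t) = phi w (J z) t by rewrite AJ ipNl ipJl opprK.
have JJ2 w z t : phi w (J (J z)) t = - phi w z t by rewrite !AJ JN JJ !opprK ipNl.
have h1 := cyc (J v) x y; have h2 := cyc v (J x) y; have h3 := cyc v x (J y).
have h4 := cyc (J v) (J x) (J y).
move: h1 h2 h3 h4; rewrite !(J3, JJ2); lra.
Qed.

(** What the curvature identities say at one point, [A v] being the covariant
    derivative of the complex structure along [v], [nu] the antiholomorphic
    curvature and [dnu] its differential. *)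
Record pointwise_data : Prop := PointwiseData {
  A_linear_l : forall x, linear (A^~ x);
  A_linear_r : forall v, linear (A v);
  A_skew : forall v x y, phi v x y = - phi v y x;
  A_J : forall v x, A v (J x) = - J (A v x);
  A_cyclic : forall v x y, phi v x y + phi x y v + phi y v x = 0;
  sigma_scalar : forall y, scalar (sigma^~ y);
  sigma_skew : forall x y, sigma x y = - sigma y x;
  bianchi : forall v x y, cperp v x -> cperp v y -> cperp x y ->
    dnu v * (ip x x * ip y y) =
    - 2^-1 * (sigma x y * phi v x y + sigma v x * phi y x y - sigma v y * phi x x y);
  gray : forall x y z u, ip (N x y) (N z u) = wedge_form x y z u }.

Hypothesis D : pointwise_data.

Let ADl u v x : A (u + v) x = A u x + A v x.
Proof. by have := A_linear_l D x 1 u v; rewrite !scale1r. Qed.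
Let A0l x : A 0 x = 0.
Proof. by have /eqP := ADl 0 0 x; rewrite addr0 addrC -subr_eq subrr => /eqP. Qed.
Let AZl a v x : A (a *: v) x = a *: A v x.
Proof. by have := A_linear_l D x a v 0; rewrite A0l !addr0. Qed.
Let ANl v x : A (- v) x = - A v x. Proof. by rewrite -!scaleN1r AZl. Qed.
Let ADr v x y : A v (x + y) = A v x + A v y.
Proof. by have := A_linear_r D v 1 x y; rewrite !scale1r. Qed.
Let A0r v : A v 0 = 0.
Proof. by have /eqP := ADr v 0 0; rewrite addr0 addrC -subr_eq subrr => /eqP. Qed.
Let AZr a v x : A v (a *: x) = a *: A v x.
Proof. by have := A_linear_r D v a x 0; rewrite A0r !addr0. Qed.
Let ANr v x : A v (- x) = - A v x. Proof. by rewrite -!scaleN1r AZr. Qed.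
Let AE := (ADl, ADr, ANl, ANr, AZl, AZr).

Let sC x y : sigma x y = - sigma y x. Proof. exact: sigma_skew. Qed.
Let sDl x y z : sigma (x + y) z = sigma x z + sigma y z.
Proof. exact: (scalar_formD (sigma_scalar D z)). Qed.
Let s0l z : sigma 0 z = 0.
Proof. exact: (scalar_form0 (sigma_scalar D z)). Qed.
Let sZl a x z : sigma (a *: x) z = a * sigma x z.
Proof. exact: (scalar_formZ (sigma_scalar D z)). Qed.
Let sNl x z : sigma (- x) z = - sigma x z.
Proof. exact: (scalar_formN (sigma_scalar D z)). Qed.
Let sDr x y z : sigma z (x + y) = sigma z x + sigma z y.
Proof. by rewrite sC sDl !(sC z) opprD. Qed.
Let sZr a x z : sigma z (a *: x) = a * sigma z x.
Proof. by rewrite sC sZl !(sC z) mulrN. Qed.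
Let sNr x z : sigma z (- x) = - sigma z x.
Proof. by rewrite sC sNl !(sC z). Qed.
Let sE := (sDl, sDr, sNl, sNr, sZl, sZr).

Let phiC v x y : phi v x y = - phi v y x. Proof. exact: A_skew. Qed.
Let phi_cyc v x y : phi v x y + phi x y v + phi y v x = 0. Proof. exact: A_cyclic. Qed.
Let phiJ3 v x y : phi v x (J y) = phi v (J x) y.
Proof. by rewrite (A_J D) ipNl ipJl opprK. Qed.
Let phiJJ v x y : phi v (J (J x)) y = - phi v x y.
Proof. by rewrite JJ ANr ipNl. Qed.
Let phixx v x : phi v x x = 0. Proof. by have := phiC v x x; lra. Qed.
Let phixJx v x : phi v (J x) x = 0.
Proof. by have := phiC v (J x) x; rewrite phiJ3; lra. Qed.

Let phiJ1 v x y : phi (J v) x y = phi v (J x) y.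
Proof. by apply: phi_J_left; [exact: A_skew|exact: A_J|exact: A_cyclic]. Qed.
Let phiE := (phiJ1, phiJ3, phiJJ).

Lemma nijenhuisE x y z : ip (N x y) z = phi z x y.
Proof.
by rewrite /N ipDl ipNl; have := phi_cyc z x y; have := phiC y z x; lra.
Qed.

Let NC x y : N x y = - N y x. Proof. by rewrite /N opprB. Qed.

(** The hypothesis makes [phi] skew in its first and last arguments too; a form
    that is totally skew and cyclic is zero. *)
Lemma phi_eq0_of_diag : (forall x y, cperp x y -> phi y x y = 0) -> forall v x, A v x = 0.
Proof.
move=> hd.
have h1 x y : phi y x y = 0.
  have [x' [a [b [-> /hd px _]]]] := cperp_split y x.
  by rewrite !AE !ipE px phixx phixJx; ring.
have h2 x y z : phi y x z = - phi z x y.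
  by have := h1 x (y + z); rewrite !AE !ipE !h1; lra.
have h3 v x y : phi v x y = 0.
  have := phi_cyc v x y; have := h2 v x y; have := h2 y v x; have := h2 x y v.
  have := phiC v x y; have := phiC x y v; have := phiC y v x; lra.
by move=> v x; apply: ip_eq0.
Qed.

(** ** The part of sigma that anticommutes with J *)
Definition anti_sigma x y := sigma x y - sigma (J x) (J y).
Local Notation s2 := anti_sigma.

(* the component of [bianchi] of weight 2 in y and 0 in x under rotations by J *)
Let P v x y :=
  phi v x y * (sigma x y + sigma (J x) (J y)) + phi v (J x) y * (sigma (J x) y - sigma x (J y))
  + 2 * sigma v x * phi y x y + 2 * sigma v (J x) * phi y (J x) y.

Let P_eq0 v x y : cperp v x -> cperp v y -> cperp x y -> P v x y = 0.
Proof.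
move=> vx vy xy.
have e1 := bianchi D vx vy xy.
have e2 := bianchi D (cperpJr vx) vy (cperpJl xy).
have e3 := bianchi D vx (cperpJr vy) (cperpJr xy).
have e4 := bianchi D (cperpJr vx) (cperpJr vy) (cperpJl (cperpJr xy)).
move: e1 e2 e3 e4; rewrite !ipJJ !phiE /P => e1 e2 e3 e4.
lra.
Qed.

(** Applied to [v] and to [J v], the component [P] of the Bianchi relation gives
    a homogeneous linear system for [phi y x y] and [phi y (J x) y].  Its matrix
    is a similarity whose ratio vanishes only with [s2 v x]. *)
Lemma anti_sigma_phi v x y : cperp v x -> cperp v y -> cperp x y -> s2 v x * phi y x y = 0.
Proof.
move=> vx vy xy.
rewrite /s2; have e0 w : cperp w x -> cperp w y ->
   (sigma w x - sigma (J w) (J x)) * phi y (J x) y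
   - (sigma w (J x) - sigma (J w) (J (J x))) * phi y x y = 0.
  move=> wx wy.
  have e1 := P_eq0 wx wy xy; have e2 := P_eq0 wx (cperpJr wy) (cperpJr xy).
  have e3 := P_eq0 wx (cperpDr wy (cperpJr wy)) (cperpDr xy (cperpJr xy)).
  have e4 := P_eq0 (cperpJl wx) (cperpJl wy) xy.
  move: e1 e2 e3 e4; rewrite /P !(AE, ipE, sE, JE) !phiE => e1 e2 e3 e4.
  lra.
have := e0 v vx vy; have := e0 (J v) (cperpJl vx) (cperpJl vy).
rewrite !JE !sNl !sNr.
set a := sigma v x; set b := sigma (J v) (J x); set c := sigma (J v) x; set d := sigma v (J x).
set f := phi y (J x) y; set g := phi y x y => h1 h2.
have : ((a - b) ^+ 2 + (c + d) ^+ 2) * g = 0.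
  rewrite (_ : _ * g = (a - b) * ((a - b) * g) + (c + d) * ((c + d) * g)); last by ring.
  have -> : (a - b) * g = - ((c + d) * f) by lra.
  have -> : (c + d) * g = (a - b) * f by lra.
  by ring.
move=> /eqP; rewrite mulf_eq0 => /orP[|/eqP ->]; last by rewrite mulr0.
rewrite paddr_eq0 ?sqr_ge0// => /andP[]; rewrite sqrf_eq0 => /eqP -> _.
by rewrite mul0r.
Qed.

Let s2C x y : s2 x y = - s2 y x. Proof. by rewrite /s2 sC (sC (J x)); ring. Qed.
Let s2Dl x y z : s2 (x + y) z = s2 x z + s2 y z.
Proof. by rewrite /s2 JD !sDl; ring. Qed.
Let s2Zl a x z : s2 (a *: x) z = a * s2 x z.
Proof. by rewrite /s2 JZ !sZl; ring. Qed.
Let s2Dr x y z : s2 z (x + y) = s2 z x + s2 z y.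
Proof. by rewrite /s2 JD !sDr; ring. Qed.
Let s2Zr a x z : s2 z (a *: x) = a * s2 z x.
Proof. by rewrite /s2 JZ !sZr; ring. Qed.
Let s2J x y : s2 x (J y) = s2 (J x) y.
Proof. by rewrite /s2 !JJ !sNl !sNr; ring. Qed.
Let s2xx x : s2 x x = 0. Proof. by have := s2C x x; lra. Qed.
Let s2xJx x : s2 x (J x) = 0. Proof. by have := s2C x (J x); rewrite s2J; lra. Qed.
Let s2Jxx x : s2 (J x) x = 0. Proof. by rewrite s2C s2xJx oppr0. Qed.
Let s2E := (s2Dl, s2Dr, s2Zl, s2Zr).

(** If [phi y x y] is nonzero, then [phi y w y] is nonzero for almost all [w],
    and [anti_sigma_phi] can be applied to those. *)
Lemma anti_sigma_perp x y : cperp x y -> phi y x y != 0 ->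
  forall v w, cperp v y -> cperp w y -> s2 v w = 0.
Proof.
move=> xy nz.
have h v w : cperp w y -> cperp v w -> cperp v x -> cperp v y -> s2 v w = 0.
  move=> wy vw vx vy.
  have vx0 : s2 v x = 0.
    by have /eqP := anti_sigma_phi vx vy xy; rewrite mulf_eq0 (negPf nz) orbF => /eqP.
  have [w0|w0] := eqVneq (phi y w y) 0; last first.
    by have /eqP := anti_sigma_phi vw vy wy; rewrite mulf_eq0 (negPf w0) orbF => /eqP.
  have /eqP := anti_sigma_phi (cperpDr vw vx) vy (cperpDl wy xy).
  by rewrite ADr ipDl w0 add0r mulf_eq0 (negPf nz) orbF s2Dr vx0 addr0 => /eqP.
move=> v w vy wy.
have [v' [a [b [Ev v'x v'p]]]] := cperp_split x v.
have [w' [c [d [Ew w'x w'p]]]] := cperp_split x w.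
have v'y := v'p _ vy xy; have w'y := w'p _ wy xy.
have [w'' [e [f [Ew' w''v w''p]]]] := cperp_split v' w'.
have hx t : cperp t x -> cperp t y -> s2 t x = 0.
  by move=> tx ty; apply: h.
have hvw : s2 v' w' = 0.
  rewrite Ew' !s2E (h v' w'') ?s2xx ?s2xJx //; last exact: cperpC.
    by ring.
  exact: w''p.
rewrite Ev Ew !s2E hvw (hx v') // s2J (hx (J v')) //; try exact: cperpJl.
rewrite (s2C x w') (hx w') // -(s2J x w') (s2C x (J w')) (hx (J w')) //; try exact: cperpJl.
by rewrite !(s2xx, s2xJx, s2Jxx); ring.
Qed.

(** By [anti_sigma_perp] the form [s2] vanishes on the complement of [y].
    The same for a suitable [y + t *: z] kills the remaining values [s2 y w]. *)
Lemma anti_sigma_or_parallel : (8 <= m)%N ->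
  (forall x y, s2 x y = 0) \/ (forall v x, A v x = 0).
Proof.
move=> m8; have [[x [y [xy nz]]]|no] := pselect (exists x y, cperp x y /\ phi y x y != 0); last first.
  right; apply: phi_eq0_of_diag => x y xy; apply/eqP/negPn/negP => nz.
  by apply: no; exists x, y.
left; have y0 : y != 0 by apply: contraNneq nz => ->; rewrite A0l ip0l.
have hy := anti_sigma_perp xy nz.
have yw w : cperp w y -> s2 y w = 0.
  move=> wy; have [z z0 zp] := @cperp_vector [:: x; y; w] (leq_trans (isT : 7 <= 8)%N m8).
  have zx : cperp z x by apply: zp; rewrite !inE eqxx.
  have zy : cperp z y by apply: zp; rewrite !inE eqxx orbT.
  have zw : cperp z w by apply: zp; rewrite !inE eqxx !orbT.
  (* a quadratic polynomial in t with nonzero constant term *)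
  have [t [t0 nt]] : exists t, t != 0 /\ phi (y + t *: z) x (y + t *: z) != 0.
    have e t : phi (y + t *: z) x (y + t *: z) =
      phi y x y + t * (phi y x z + phi z x y) + t ^+ 2 * phi z x z.
      by rewrite !AE !ipE; ring.
    have [h1|h1] := eqVneq (phi (y + 1 *: z) x (y + 1 *: z)) 0; last by exists 1; rewrite oner_neq0.
    have [h2|h2] := eqVneq (phi (y + (-1) *: z) x (y + (-1) *: z)) 0; last first.
      by exists (-1); rewrite oppr_eq0 oner_neq0.
    exists 2; split; first by rewrite pnatr_eq0.
    move: h1 h2 nz; rewrite !e; set p := phi y x y => h1 h2 nz.
    by apply: contraNneq nz => h3; apply/eqP; lra.
  have hY := anti_sigma_perp (cperpDr xy (cperpZr t (cperpC zx))) nt.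
  have wY : cperp w (y + t *: z) by apply: cperpDr => //; apply/cperpZr/cperpC.
  pose u := (t * ip z z) *: y - ip y y *: z.
  have uY : cperp u (y + t *: z).
    case: zy => zy zJy; have yz : ip y z = 0 by rewrite ipC.
    have yJz : ip y (J z) = 0 by have := ipJl y z; rewrite ipC zJy; lra.
    by split; rewrite /u ?JE !ipE ?zy ?zJy ?yz ?yJz ?ipxJx; ring.
  have := hY u w uY wY; rewrite /u -scaleNr !s2E (hy z w) // mulr0 addr0 => /eqP.
  by rewrite !mulf_eq0 (negPf t0) (gt_eqF (ip_gt0 z0)) => /eqP.
move=> v w.
have [v' [a [b [-> v'y _]]]] := cperp_split y v.
have [w' [c [d [-> w'y _]]]] := cperp_split y w.
rewrite !s2E hy // (s2C v' y) (yw v') // s2J (s2C (J v') y) (yw (J v')) //; last exact: cperpJl.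
rewrite -(s2J y w') (yw (J w')); last exact: cperpJl.
by rewrite (yw w') // !(s2xx, s2xJx, s2Jxx); ring.
Qed.

(** If [sigma] is invariant under [J], the average of the right side of [bianchi]
    over the rotations of [x] and [y] by [J] is zero, whereas the left side is
    invariant under them. *)
Lemma dnu_eq0 : (8 <= m)%N -> forall v, dnu v = 0.
Proof.
move=> m8 v.
have [x x0 xp] := @cperp_vector [:: v] (leq_trans (isT : 3 <= 8)%N m8).
have [y y0 yp] := @cperp_vector [:: v; x] (leq_trans (isT : 5 <= 8)%N m8).
have vx : cperp v x by apply/cperpC/xp; rewrite inE.
have vy : cperp v y by apply/cperpC/yp; rewrite !inE eqxx.
have xy : cperp x y by apply/cperpC/yp; rewrite !inE eqxx orbT.
have nz : ip x x * ip y y != 0 by rewrite mulf_neq0 ?gt_eqF ?ip_gt0.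
apply/eqP; suff /eqP : dnu v * (ip x x * ip y y) = 0 by rewrite mulf_eq0 (negPf nz) orbF.
case: (anti_sigma_or_parallel m8) => [s0|A0]; last by rewrite (bianchi D vx vy xy) !A0 !ip0l; ring.
have sJJ z w : sigma (J z) (J w) = sigma z w by have := s0 z w; rewrite /s2; lra.
have sJ z w : sigma z (J w) = - sigma (J z) w by rewrite -(sJJ z) JJ sNr.
have e1 := bianchi D vx vy xy.
have e2 := bianchi D (cperpJr vx) vy (cperpJl xy).
have e3 := bianchi D vx (cperpJr vy) (cperpJr xy).
have e4 := bianchi D (cperpJr vx) (cperpJr vy) (cperpJl (cperpJr xy)).
move: e1 e2 e3 e4; rewrite !ipJJ !phiE !sJJ !sJ => e1 e2 e3 e4.
lra.
Qed.

(** ** The eigenvectors of sigma *)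
Section InvariantSigma.
Hypothesis s2_eq0 : forall x y, s2 x y = 0.

Let sJJ x y : sigma (J x) (J y) = sigma x y.
Proof. by have := s2_eq0 x y; rewrite /s2; lra. Qed.
Let sJr x y : sigma x (J y) = - sigma (J x) y.
Proof. by rewrite -(sJJ x) JJ sNr. Qed.
Let tauE x y : tau x y = - 3^-1 * sigma (J x) y - nu * ip x y.
Proof. by rewrite /tau sJr; field. Qed.
Let tauxJx x : tau x (J x) = 0.
Proof. by rewrite tauE ipxJx; have := sC (J x) (J x); lra. Qed.

(** [sigma] corresponds to an endomorphism commuting with [J]; these are the
    vectors that it does not multiply by a complex scalar. *)
Definition noneigen u := exists2 v, cperp u v & sigma u v != 0.
(** Orthogonality of [x] to the complex lines of [u] and of the image of [u]
    under the endomorphism that corresponds to [sigma]. *)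
Definition sigma_cperp u x := [/\ cperp x u, sigma u x = 0 & sigma (J u) x = 0].

Lemma rotation_system a b f g : a != 0 -> a * f + b * g = 0 -> a * g - b * f = 0 ->
  f = 0 /\ g = 0.
Proof.
move=> a0 e1 e2.
have n0 : a ^+ 2 + b ^+ 2 != 0.
  by rewrite paddr_eq0 ?sqr_ge0 // sqrf_eq0 (negPf a0).
split; apply/eqP; rewrite -(mulrI_eq0 _ (lregP n0)); apply/eqP.
  have -> : (a ^+ 2 + b ^+ 2) * f = a * (a * f + b * g) - b * (a * g - b * f) by ring.
  by rewrite e1 e2; ring.
have -> : (a ^+ 2 + b ^+ 2) * g = b * (a * f + b * g) + a * (a * g - b * f) by ring.
by rewrite e1 e2; ring.
Qed.

(** The component [P] of the Bianchi relation for [v] and [J v] compares the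
    values [phi v u x] and [phi x u x], the coefficients being exchanged. *)
Lemma phi_exchange u x v : cperp u x -> cperp u v -> cperp x v ->
  sigma u x * phi v u x + sigma (J u) x * phi v (J u) x
  = sigma u v * phi x u x + sigma (J u) v * phi x (J u) x
  /\ sigma u x * phi v (J u) x - sigma (J u) x * phi v u x
  = sigma u v * phi x (J u) x - sigma (J u) v * phi x u x.
Proof.
move=> ux uv xv.
have e1 := P_eq0 (cperpC uv) (cperpC xv) ux.
have e2 := P_eq0 (cperpJl (cperpC uv)) (cperpJl (cperpC xv)) ux.
have e3 : sigma (J v) u = sigma (J u) v by rewrite sC sJr opprK.
move: e1 e2; rewrite /P !(phiE, sJr, JJ, sNl, sNr, opprK) !e3 !(sC v u) => e1 e2.
split; lra.
Qed.

(** When [sigma u x] vanishes, [phi_exchange] gives [phi x u w = 0] for the [w]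
    with [sigma u w] nonzero.  Such vectors span, as [u] is not an eigenvector. *)
Lemma phi_sigma_cperp u x : noneigen u -> sigma_cperp u x -> forall z, phi x u z = 0.
Proof.
move=> [v uv suv] [/cperpC ux sux sJux].
have [v1 [a [b [Ev v1x v1p]]]] := cperp_split x v.
have uv1 : cperp u v1 by apply/cperpC/v1p; exact: cperpC.
have suv1 : sigma u v1 != 0.
  by move: suv; rewrite Ev !sE sux sJr sJux oppr0 !mulr0 !addr0.
have [e1 e2] := phi_exchange ux uv1 (cperpC v1x).
rewrite sux sJux !mul0r !addr0 subr0 in e1 e2.
have [f0 g0] := rotation_system suv1 (esym e1) (esym e2).
have hw w : cperp u w -> cperp x w -> sigma u w != 0 -> phi x u w = 0.
  move=> uw xw suw; have [e3 e4] := phi_exchange uw ux (cperpC xw).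
  rewrite sux sJux !mul0r addr0 subr0 in e3 e4.
  by have [] := rotation_system suw e3 e4.
have hw' w : cperp u w -> cperp x w -> phi x u w = 0.
  move=> uw xw; have [sw|] := eqVneq (sigma u w) 0; last exact: hw.
  have : phi x u (w + v1) = 0.
    by apply: hw; [exact: cperpDr|exact: cperpDr xw (cperpC v1x)|rewrite sDr sw add0r].
  by rewrite ipDr (hw v1) ?addr0 //; exact: cperpC.
move=> z.
have [z1 [c [d [-> z1u z1p]]]] := cperp_split u z.
have [z2 [e [f [Ez z2x z2p]]]] := cperp_split x z1.
rewrite Ez !ipDr !ipZr hw'; [|exact/cperpC/z2p/cperpC|exact: cperpC].
by rewrite !phiJ3 f0 g0 phixx phixJx; ring.
Qed.

Let gr_ux u x v : cperp u x -> cperp u v -> sigma_cperp u x ->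
  ip (N x u) (N x (J v)) = ip x x * tau u (J v).
Proof.
move=> ux uv [_ k1 k2].
rewrite (gray D) /wedge_form.
have [ux0 uJx0] := ux; have [uv0 uJv0] := uv; have [xu0 xJu0] := cperpC ux.
have t1 : tau u x = 0 by rewrite tauE k2 ux0; ring.
have t2 : tau u (J x) = 0 by rewrite tauE sJJ k1 uJx0; ring.
by rewrite t1 t2 ux0 uJx0 uJv0 ipxJx tauxJx !JE ipNr uv0; ring.
Qed.

(** Gray's identity gives [<N x u, N x (J v)> = |x|^2 tau u (J v)], and for a
    suitable [v] the last factor is a nonzero multiple of [sigma u v]. *)
Lemma sigma_cperp_eq0 u x : noneigen u -> sigma_cperp u x -> N x u = 0 -> x = 0.
Proof.
move=> [v uv suv] k nxu; have ux := cperpC (let: And3 c _ _ := k in c).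
have := gr_ux ux uv k; rewrite nxu ip0l tauE sJJ.
have [_ ->] := uv; rewrite mulr0 subr0 => /esym/eqP.
rewrite !mulf_eq0 (negPf suv) orbF oppr_eq0 invr_eq0 pnatr_eq0 orbF => /eqP.
exact: ip_eq0.
Qed.

Lemma nijenhuis_noneigen u x : noneigen u -> noneigen x -> sigma_cperp u x -> N x u = 0.
Proof.
move=> nu_ nx k; have [xu k1 k2] := k.
have k' : sigma_cperp x u.
  by split; rewrite ?(sC x) ?(sC _ u) ?k1 ?sJr ?k2 ?oppr0 //; exact: cperpC.
apply: ip_eq0; rewrite nijenhuisE.
have := phi_cyc (N x u) x u; rewrite (phi_sigma_cperp nu_ k) (phiC u) (phi_sigma_cperp nx k'); lra.
Qed.

Lemma sigma_cperp_eigen u x : noneigen u -> sigma_cperp u x -> x != 0 ->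
  forall v, cperp x v -> sigma x v = 0.
Proof.
move=> nu_ k x0 v xv; apply/eqP/negPn/negP => sxv.
have nx : noneigen x by exists v.
by have /eqP := sigma_cperp_eq0 nu_ k (nijenhuis_noneigen nu_ nx k); rewrite (negPf x0).
Qed.

(** Modulo vectors [w] with [sigma_cperp u w], for which [phi w z u] vanishes in
    any case, the space is spanned by [u], [J u], [v], [J v] with [sigma u v]
    nonzero.  Thus [N z u = 0] and the orthogonality of [z] and [u] amount to six
    linear conditions on [z]. *)
Lemma nijenhuis_kernel u : (7 <= m)%N -> noneigen u ->
  exists z, [/\ z != 0, cperp z u & N z u = 0].
Proof.
move=> m7 nu_; have [v uv suv] := nu_.
have [|z z0 zp] := @ortho_vector [:: u; J u; A u u; A (J u) u; A v u; A (J v) u] _ => //.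
have zu : cperp z u by split; apply: zp; rewrite !inE eqxx ?orbT.
have hA w : ip z (A w u) = 0 -> phi w z u = 0.
  by move=> h; rewrite phiC ipC h oppr0.
exists z; split => //; apply: ip_eq0; rewrite nijenhuisE.
have [w [a [b [-> wu _]]]] := cperp_split u (N z u).
pose s := sigma u v; pose t := sigma (J u) v; pose d := s ^+ 2 + t ^+ 2.
have d0 : d != 0 by rewrite paddr_eq0 ?sqr_ge0 // sqrf_eq0 (negPf suv).
pose p := sigma u w; pose q := sigma (J u) w.
(* the coefficients of [v] and [J v] that move [w] into [sigma_cperp u _] *)
pose g := (p * s + q * t) / d; pose h := (q * s - p * t) / d.
have k : sigma_cperp u (w - g *: v - h *: J v).
  split.
  - rewrite -!scaleNr; apply: cperpDl; first apply: cperpDl => //.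
      by apply/cperpZl/cperpC.
    by apply/cperpZl/cperpJl/cperpC.
  - rewrite !sE sJr -/p -/s -/t /g /h; move: d0; rewrite /d => d0; field; exact: d0.
  - rewrite !sE sJr JJ sNl -/q -/s -/t /g /h; move: d0; rewrite /d => d0; field; exact: d0.
have hu : phi u z u = 0 by rewrite hA // zp // !inE eqxx ?orbT.
have hJu : phi (J u) z u = 0 by rewrite hA // zp // !inE eqxx ?orbT.
have hv : phi v z u = 0 by rewrite hA // zp // !inE eqxx ?orbT.
have hJv : phi (J v) z u = 0 by rewrite hA // zp // !inE eqxx ?orbT.
have := phi_sigma_cperp nu_ k z; rewrite phiC !AE !ipE hu hJu hv hJv; lra.
Qed.

Let NJ x y : J (N x y) = - N (J x) y.
Proof.
apply/eqP; rewrite -subr_eq0 opprK; apply/eqP; apply: ip_eq0.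
set t := J _ + _; rewrite [in X in ip X t]/t ipDl ipJl !nijenhuisE.
by rewrite phiJ1; ring.
Qed.

Let norm_N x y : cperp x y -> ip (N x y) (N x y) = ip x x * tau y y + tau x x * ip y y.
Proof.
move=> [p q]; have [p' q'] := cperpC (conj p q).
by rewrite (gray D) /wedge_form !ipxJx !tauxJx p q p' q'; ring.
Qed.

(** Counting dimensions: more than [size ws] orthogonal vectors cannot all lie
    in the orthogonal complement of the orthogonal complement of [ws]. *)
Lemma ortho_combination (s ws : seq V) : (size ws < size s)%N ->
  pairwise (fun x y => ip x y == 0) s -> all (fun x => x != 0) s ->
  exists y, [/\ y != 0, forall w, w \in ws -> ip y w = 0 &
    forall y', (forall x, x \in s -> ip x y' = 0) -> ip y y' = 0].
Proof.
move=> ss ps ns; pose Y (c : 'rV[R]_(size s)) : V := \sum_(i < size s) c 0 i *: s`_i.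
have Yl a c d : Y (a *: c + d) = a *: Y c + Y d.
  by rewrite /Y scaler_sumr -big_split; apply: eq_bigr => i _; rewrite !mxE scalerDl scalerA.
have ipY c z : ip (Y c) z = \sum_(i < size s) c 0 i * ip s`_i z.
  rewrite /Y; elim/big_rec2: _ => [|i r t _ IH]; first exact: ip0l.
  by rewrite ipDl ipZl IH.
have [|c c0 Lc] := @linear_kernel _ _ _ (fun c => \row_(j < size ws) ip (Y c) ws`_j) _ ss.
  by move=> a c d; apply/rowP => j; rewrite !mxE Yl !ipE.
have orth (i j : 'I_(size s)) : i != j -> ip s`_i s`_j = 0.
  wlog ij : i j / (i < j)%N => [H1 ne|_].
    case: (ltngtP i j) => [l|l|/val_inj e]; first exact: H1.
      by rewrite ipC; apply: H1 => //; rewrite eq_sym.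
    by rewrite e eqxx in ne.
  move/(pairwiseP 0): (ps) => hp.
  by apply/eqP; exact: (hp i j (ltn_ord i) (ltn_ord j) ij).
have coef (i : 'I_(size s)) : ip (Y c) s`_i = c 0 i * ip s`_i s`_i.
  rewrite ipY (bigD1 i) //= big1 ?addr0 // => j ji.
  by rewrite orth ?mulr0.
exists (Y c); split.
- apply: contraNneq c0 => Y0; apply/eqP/rowP => i; rewrite mxE.
  have := coef i; rewrite Y0 ip0l => /esym/eqP; rewrite mulf_eq0 => /orP[/eqP//|/eqP/ip_eq0 si0].
  by move/(all_nthP 0): ns => /(_ i (ltn_ord i)); rewrite si0 eqxx.
- move=> w /(nthP 0)[j jw <-].
  by move/rowP/(_ (Ordinal jw)): Lc; rewrite !mxE.
- move=> y' h; rewrite ipY big1 // => i _.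
  by rewrite h ?mulr0 // mem_nth.
Qed.

(** If [u] is not an eigenvector, take [z] from [nijenhuis_kernel].  Every [x]
    orthogonal to [u] and [z] is an eigenvector with [tau x x] positive.  For two
    such vectors [x], [x'], orthogonal to each other, the values [N x u],
    [N x' u], [N x x'] span over the complex numbers a space of real dimension 6
    orthogonal to all these [x], that is, contained in the space of dimension 4
    spanned by [u], [J u], [z], [J z]. *)
Lemma all_eigen : (8 <= m)%N -> forall u, ~ noneigen u.
Proof.
move=> m8 u nu_; have [v uv suv] := nu_.
have u0 : u != 0 by apply: contraNneq suv => ->; rewrite s0l.
have [z [z0 zu Nz]] := nijenhuis_kernel (ltnW m8) nu_.
have [zu0 zJu0] := zu; have [uz0 uJz0] := cperpC zu.
(* [N z u = 0] turns Gray's identity for [z, u, y, u] and [z, u, y, z] into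
   linear conditions on [tau] *)
have tz y : cperp y u -> cperp y z -> tau z y = 0.
  move=> yu yz; have [uy0 uJy0] := cperpC yu; have [zy0 zJy0] := cperpC yz.
  have := gray D z u y u; rewrite Nz ip0l /wedge_form.
  rewrite zu0 zJu0 uy0 uJy0 zy0 zJy0 ipxJx tauxJx => e.
  by apply: (mulIf (lt0r_neq0 (ip_gt0 u0))); rewrite mul0r; lra.
have tu y : cperp y u -> cperp y z -> tau u y = 0.
  move=> yu yz; have [uy0 uJy0] := cperpC yu; have [zy0 zJy0] := cperpC yz.
  have := gray D z u y z; rewrite Nz ip0l /wedge_form.
  rewrite uz0 uJz0 uy0 uJy0 zy0 zJy0 ipxJx tauxJx => e.
  by apply: (mulIf (lt0r_neq0 (ip_gt0 z0))); rewrite mul0r; lra.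
have of_tau w : (forall y, cperp y u -> cperp y z -> tau w y = 0) ->
    (w = u) \/ (w = z) -> forall y, cperp y u -> cperp y z -> sigma_cperp w y.
  move=> h wuz y yu yz; have wy : cperp y w by case: wuz => ->.
  have [wy0 wJy0] := cperpC wy.
  have := h y yu yz; rewrite tauE wy0 mulr0 subr0.
  have := h (J y) (cperpJl yu) (cperpJl yz); rewrite tauE wJy0 mulr0 subr0 sJJ.
  by move=> e1 e2; split => //; lra.
have ku := of_tau u tu (or_introl erefl).
have kz := of_tau z tz (or_intror erefl).
have szu : exists2 w, w = z \/ w = J z & sigma u w != 0.
  have [suz|] := eqVneq (sigma u z) 0; last by exists z; [left|].
  exists (J z); first by right.
  apply: contraNneq suv => suJz.
  have [y [a [b [Ev yz yp]]]] := cperp_split z v.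
  have [_ suy _] := ku y (yp _ (cperpC uv) zu) yz.
  by apply/eqP; rewrite Ev !sE suy suz suJz; ring.
have nz_ : noneigen z.
  have [w [->|->] sw] := szu; first by exists u; rewrite // sC oppr_eq0.
  exists (J u); first exact: cperpJr.
  by rewrite (sC z) -sJr.
have eig x : cperp x u -> cperp x z -> x != 0 -> forall v', cperp x v' -> sigma x v' = 0.
  by move=> xu xz; apply: sigma_cperp_eigen nu_ (ku x xu xz).
have pos x : cperp x u -> cperp x z -> x != 0 -> 0 < tau x x.
  move=> xu xz x0.
  have n1 : N x u != 0 by apply: contraNneq x0 => /(sigma_cperp_eq0 nu_ (ku x xu xz)) ->.
  have n2 : N x z != 0 by apply: contraNneq x0 => /(sigma_cperp_eq0 nz_ (kz x xu xz)) ->.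
  have := ip_gt0 n1; rewrite norm_N // => p1.
  have := ip_gt0 n2; rewrite norm_N // => p2.
  have := norm_N zu; rewrite Nz ip0l => e.
  have gu := ip_gt0 u0; have gz := ip_gt0 z0; have gx := ip_gt0 x0.
  have := addr_gt0 (mulr_gt0 gz p1) (mulr_gt0 gu p2).
  have -> : ip z z * (ip x x * tau u u + tau x x * ip u u) +
       ip u u * (ip x x * tau z z + tau x x * ip z z) =
    ip x x * (ip z z * tau u u + tau z z * ip u u) + 2 * ip u u * ip z z * tau x x by ring.
  by rewrite -e mulr0 add0r pmulr_rgt0 // !mulr_gt0.
have [x x0 xp] := @cperp_vector [:: u; z] (leq_trans (isT : 5 <= 8)%N m8).
have [x' x'0 x'p] := @cperp_vector [:: u; z; x] (leq_trans (isT : 7 <= 8)%N m8).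
have xu : cperp x u by apply: xp; rewrite !inE eqxx.
have xz : cperp x z by apply: xp; rewrite !inE eqxx orbT.
have x'u : cperp x' u by apply: x'p; rewrite !inE eqxx.
have x'z : cperp x' z by apply: x'p; rewrite !inE eqxx orbT.
have x'x : cperp x' x by apply: x'p; rewrite !inE eqxx !orbT.
have xx' := cperpC x'x.
have n1 : N x u != 0 by apply: contraNneq x0 => /(sigma_cperp_eq0 nu_ (ku x xu xz)) ->.
have n2 : N x' u != 0 by apply: contraNneq x'0 => /(sigma_cperp_eq0 nu_ (ku x' x'u x'z)) ->.
have n3 : N x x' != 0.
  apply/eqP => n0; have := norm_N xx'; rewrite n0 ip0l => e.
  have := addr_gt0 (mulr_gt0 (ip_gt0 x0) (pos _ x'u x'z x'0)) (mulr_gt0 (pos _ xu xz x0) (ip_gt0 x'0)).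
  by rewrite -e ltxx.
have tau0 y w : cperp y u -> cperp y z -> y != 0 -> cperp y w -> tau y w = 0.
  move=> yu yz y0 yw; rewrite tauE (eig (J y)) //.
  - by have [-> _] := yw; ring.
  - exact: cperpJl.
  - exact: cperpJl.
  - by apply: contraNneq y0 => e; rewrite -oppr_eq0 -JJ e J0.
  - exact: cperpJl.
have orth1 y y' : cperp y u -> cperp y z -> y != 0 -> cperp y' u -> cperp y y' ->
    ip (N y u) (N y' u) = 0.
  move=> yu yz y0 y'u yy'; rewrite (gray D) /wedge_form.
  rewrite (tau0 y y') // (tau0 y (J y')) //; last exact: cperpJr.
  have [-> ->] := yy'; have [-> ->] := cperpC y'u; have [-> ->] := yu.
  by ring.
have orth2 y y' t : cperp y u -> cperp y z -> y != 0 -> cperp y' u -> cperp y' z -> cperp y y' ->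
   t = y \/ t = J y -> ip (N y u) (N t y') = 0.
  move=> yu yz y0 y'u y'z yy' ty; rewrite (gray D) /wedge_form.
  rewrite (tau0 y y') // (tau0 y (J y')) //; last exact: cperpJr.
  rewrite (tu y') // (tu (J y')) //; try exact: cperpJl.
  have [-> ->] := yy'; have [-> ->] := cperpC y'u.
  have [-> ->] : cperp u t by case: ty => ->; [exact: cperpC|exact/cperpJr/cperpC].
  by ring.
have span1 y w : cperp y u -> cperp y z -> cperp w u -> cperp w z -> ip (N w u) y = 0.
  by move=> yu yz wu wz; rewrite nijenhuisE phiC (phi_sigma_cperp nu_ (ku y yu yz)) oppr0.
(* as the vectors [t] are eigenvectors, [u] may be replaced by [u + t] in
   [phi_sigma_cperp] *)
have shift y t w : cperp y u -> cperp y z -> cperp t u -> cperp t z -> t != 0 ->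
   cperp y t -> phi y t w = 0.
  move=> yu yz tu_ tz_ t0 yt.
  have nut : noneigen (u + t).
    have [s' s'z ss'] := szu; exists s'.
      case: s'z => ->; first by apply: cperpDl => //; exact: cperpC.
      by apply/cperpJr/cperpDl => //; exact: cperpC.
    rewrite sDl (eig t) ?addr0 //.
    by case: s'z => ->; rewrite //; exact: cperpJr.
  have kut : sigma_cperp (u + t) y.
    have [_ k1 k2] := ku y yu yz; split.
    - exact: cperpDr.
    - by rewrite sDl k1 (eig t) ?addr0 //; exact: cperpC.
    - by rewrite JD sDl k2 -(opprK (sigma (J t) y)) -sJr (eig t) ?oppr0 ?addr0 //; exact/cperpJr/cperpC.
  by have := phi_sigma_cperp nut kut w; rewrite !AE !ipE (phi_sigma_cperp nu_ (ku y yu yz)) add0r.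
have span2 y : cperp y u -> cperp y z -> ip (N x x') y = 0.
  move=> yu yz; rewrite nijenhuisE.
  have [y1 [a [b [Ey y1x' y1p]]]] := cperp_split x' y.
  have h1 := shift y1 x' x (y1p _ yu x'u) (y1p _ yz x'z) x'u x'z x'0 y1x'.
  have h2 := shift x' x x' x'u x'z xu xz x0 x'x.
  have h3 := shift (J x') x x' (cperpJl x'u) (cperpJl x'z) xu xz x0 (cperpJl x'x).
  by rewrite Ey !AE !ipE h2 h3 phiC h1; ring.
have c12 : cperp (N x u) (N x' u).
  by split; rewrite ?NJ ?ipNr orth1 ?oppr0 //; [exact: cperpJl|exact: cperpJr].
have c13 : cperp (N x u) (N x x').
  split; first by apply: orth2 => //; left.
  by rewrite NJ ipNr orth2 ?oppr0 //; right.
have c23 : cperp (N x' u) (N x x').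
  rewrite (NC x x'); apply: cperpNr; split; first by apply: orth2 => //; left.
  by rewrite NJ ipNr orth2 ?oppr0 //; right.
have Jneq0 (n : V) : n != 0 -> J n != 0.
  by apply: contraNneq => e; rewrite -oppr_eq0 -JJ e J0.
have pw (a b c : V) : cperp a b -> cperp a c -> cperp b c ->
    pairwise (fun x y => ip x y == 0) [:: a; J a; b; J b; c; J c].
  move=> [h1 h2] [h3 h4] [h5 h6].
  by rewrite /= !ipJJ !ipxJx !ipJl h1 h2 h3 h4 h5 h6 !oppr0 !eqxx.
have [||y [y0 yw yp]] := @ortho_combination
  [:: N x u; J (N x u); N x' u; J (N x' u); N x x'; J (N x x')] [:: u; J u; z; J z] isT.
- exact: pw.
- by rewrite /= !Jneq0 // n1 n2 n3.
have yu : cperp y u by split; apply: yw; rewrite !inE eqxx ?orbT.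
have yz : cperp y z by split; apply: yw; rewrite !inE eqxx ?orbT.
have yJu := cperpJl yu; have yJz := cperpJl yz.
suff /ip_eq0/eqP : ip y y = 0 by rewrite (negPf y0).
apply: yp => n; rewrite !inE => /or4P[/eqP->|/eqP->|/eqP->|/or3P[/eqP->|/eqP->|/eqP->]];
  by rewrite ?ipJl ?span1 ?span2 ?oppr0.
Qed.

(** When every vector is an eigenvector, [tau] is a multiple of the metric,
    positive if [N] is not zero.  The map [(z, z') |-> N z y + N z' x] together
    with the six conditions of orthogonality goes from dimension [2 m] to
    dimension [m + 6], so it has a kernel; Gray's identity makes the two terms
    orthogonal and computes their lengths. *)
Lemma nijenhuis_eq0 : (8 <= m)%N -> forall x y, cperp x y -> N x y = 0.
Proof.
move=> m8 x y xy; apply/eqP/negPn/negP => Nxy.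
have eig u v : cperp u v -> sigma u v = 0.
  by move=> uv; apply/eqP/negPn/negP => suv; apply: (all_eigen m8 (u := u)); exists v.
have tau0 u v : cperp u v -> tau u v = 0.
  by move=> uv; rewrite tauE (eig (J u) v) ?(proj1 uv); [ring|exact: cperpJl].
have prop u v : cperp u v -> ip v v * tau u u = ip u u * tau v v.
  move=> uv; have [uv0 uJv0] := uv; have [vu0 vJu0] := cperpC uv.
  have pc : cperp (u + v) (ip v v *: u - ip u u *: v).
    by split; rewrite ?JE !ipE ?uv0 ?uJv0 ?vu0 ?vJu0 ?ipxJx; ring.
  have e1 := eig _ _ (cperpJl uv); have e2 := eig _ _ (cperpJl (cperpC uv)).
  by have := tau0 _ _ pc; rewrite !tauE !JE !sE !ipE uv0 vu0 e1 e2; lra.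
have x0 : x != 0 by apply: contraNneq Nxy => ->; rewrite /N A0r A0l subrr.
have y0 : y != 0 by apply: contraNneq Nxy => ->; rewrite /N A0r A0l subrr.
have gx := ip_gt0 x0; have gy := ip_gt0 y0.
have := ip_gt0 Nxy; rewrite norm_N // => pos.
have p := prop x y xy.
have tx : 0 < tau x x.
  rewrite -(pmulr_rgt0 _ gy); move: pos; rewrite -p [tau x x * _]mulrC -mulr2n.
  by rewrite pmulrn_lgt0.
have ty : 0 < tau y y by rewrite -(pmulr_rgt0 _ gx) -p pmulr_rgt0.
pose z (c : 'rV[R]_(m + m)) := lsubmx c; pose z' (c : 'rV[R]_(m + m)) := rsubmx c.
pose K c := [:: ip (z c) y; ip (z c) (J y); ip (z' c) y; ip (z' c) (J y); ip (z' c) x; ip (z' c) (J x)].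
have lz a c d : z (a *: c + d) = a *: z c + z d by apply/rowP => i; rewrite !mxE.
have lz' a c d : z' (a *: c + d) = a *: z' c + z' d by apply/rowP => i; rewrite !mxE.
have [||c c0 /rowP Lc] := @linear_kernel _ (m + m) (m + 6)
  (fun c => row_mx (N (z c) y + N (z' c) x) (\row_(i < 6) (K c)`_i)).
- move=> a c d; rewrite scale_row_mx add_row_mx; congr row_mx.
    rewrite /N lz lz' !AE; apply/rowP => i; rewrite !mxE; ring.
  apply/rowP => i; rewrite !mxE /K lz lz' !ipE.
  by case: i => [[|[|[|[|[|[|//]]]]]] ?].
- by rewrite ltn_add2l (leq_trans _ m8).
have NN : N (z c) y + N (z' c) x = 0.
  by apply/rowP => i; have := Lc (lshift 6 i); rewrite row_mxEl !mxE.
have Kc i : (i < 6)%N -> (K c)`_i = 0.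
  by move=> i6; have := Lc (rshift m (Ordinal i6)); rewrite row_mxEr !mxE.
have zy : cperp (z c) y by split; [exact: (Kc 0%N)|exact: (Kc 1%N)].
have z'y : cperp (z' c) y by split; [exact: (Kc 2%N)|exact: (Kc 3%N)].
have z'x : cperp (z' c) x by split; [exact: (Kc 4%N)|exact: (Kc 5%N)].
have orth : ip (N (z c) y) (N (z' c) x) = 0.
  rewrite (gray D) /wedge_form.
  rewrite (tau0 y (z' c)) ?(tau0 y (J (z' c))) ?(tau0 y x) ?(tau0 y (J x)) //;
    try (by [exact: cperpC|exact/cperpJr/cperpC]).
  have [-> ->] := cperpC xy; have [-> ->] := cperpC z'y.
  by ring.
have zero w t : cperp w t -> t != 0 -> 0 < tau t t -> ip (N w t) (N w t) = 0 -> w = 0.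
  move=> wt t0 tt; rewrite norm_N // [tau w w * _]mulrC (prop w t) // -mulr2n => /eqP.
  by rewrite mulrn_eq0 /= mulf_eq0 (gt_eqF tt) orbF => /eqP/ip_eq0.
have e1 : z c = 0.
  by apply: zero zy y0 ty _; move: (congr1 (ip (N (z c) y)) NN); rewrite ipDr orth addr0 ip0r.
have e2 : z' c = 0.
  apply: zero z'x x0 tx _; move: (congr1 (ip (N (z' c) x)) NN).
  by rewrite ipDr [ip _ (N (z c) y)]ipC orth add0r ip0r.
by move/eqP: c0; apply; rewrite -[c]hsubmxK -/(z c) -/(z' c) e1 e2 row_mx0.
Qed.

End InvariantSigma.

Theorem pointwise_parallel : (8 <= m)%N -> forall v x, A v x = 0.
Proof.
move=> m8; case: (anti_sigma_or_parallel m8) => // s0.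
apply: phi_eq0_of_diag => x y xy.
by rewrite -nijenhuisE (nijenhuis_eq0 s0 m8 xy) ip0l.
Qed.

(** Three pairwise orthogonal vectors [x], [u], [w]: Gray's identity with [N = 0]
    gives three homogeneous linear equations for the values of [tau] on them. *)
Lemma tau_eq0 : (8 <= m)%N -> forall x, tau x x = 0.
Proof.
move=> m8 x; have N0 y z : N y z = 0 by rewrite /N !pointwise_parallel // subrr.
have e y z : cperp y z -> ip y y * tau z z + tau y y * ip z z = 0.
  move=> [p q]; have [p' q'] := cperpC (conj p q).
  have := gray D y z y z; rewrite N0 ip0l /wedge_form !ipxJx p q p' q'; lra.
have [->|x0] := eqVneq x 0.
  by rewrite /tau J0 s0l ip0l; ring.
have [u u0 up] := @cperp_vector [:: x] (leq_trans (isT : 3 <= 8)%N m8).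
have [w w0 wp] := @cperp_vector [:: x; u] (leq_trans (isT : 5 <= 8)%N m8).
have e1 := e u x (up x (mem_head _ _)).
have wx : cperp w x by apply: wp; rewrite !inE eqxx.
have wu : cperp w u by apply: wp; rewrite !inE eqxx orbT.
have := e _ _ wx; have := e _ _ wu => e2 e3.
have : 2 * (ip u u * ip w w) * tau x x = 0.
  rewrite (_ : _ * tau x x = ip w w * (ip u u * tau x x + tau u u * ip x x)
    + ip u u * (ip w w * tau x x + tau w w * ip x x)
    - ip x x * (ip w w * tau u u + tau w w * ip u u)); last by ring.
  by rewrite e1 e2 e3; ring.
have nz : 2 * (ip u u * ip w w) != 0 by rewrite gt_eqF // !mulr_gt0 ?ip_gt0.
by move/eqP; rewrite mulf_eq0 (negPf nz) => /eqP.
Qed.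

End PointwiseAlgebra.

(** * Curvature-like forms divisible by a 2-form *)

Section CurvatureLike.
Context {R : realFieldType} {m : nat}.
Local Notation V := 'rV[R]_m.
Implicit Types (x y z u v w : V) (a b : R).

Record curvature_like (C : V -> V -> V -> V -> R) : Prop := CurvatureLike {
  curv_scalar : forall y z u, scalar (fun x => C x y z u);
  curv_scalar3 : forall x y u, scalar (fun z => C x y z u);
  curv_skew12 : forall x y z u, C x y z u = - C y x z u;
  curv_skew34 : forall x y z u, C x y z u = - C x y u z;
  curv_cyclic : forall x y z u, C x y z u + C y z x u + C z x y u = 0 }.

Section Theory.
Variable C : V -> V -> V -> V -> R.
Hypothesis H : curvature_like C.

Lemma curvC12 x y z u : C x y z u = - C y x z u. Proof. exact: curv_skew12. Qed.
Lemma curvC34 x y z u : C x y z u = - C x y u z. Proof. exact: curv_skew34. Qed.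

Lemma curv_pair x y z u : C x y z u = C z u x y.
Proof.
have := curv_cyclic H x y z u; have := curv_cyclic H y z u x.
have := curv_cyclic H z u x y; have := curv_cyclic H u x y z.
have := curvC12 x y z u; have := curvC34 x y z u; have := curvC34 y x z u.
have := curvC12 y z x u; have := curvC34 y z x u; have := curvC34 z y x u; have := curvC12 y z u x.
have := curvC12 z x y u; have := curvC34 z x y u; have := curvC34 x z y u; have := curvC12 z x u y.
have := curvC12 z u x y; have := curvC34 z u x y; have := curvC34 u z x y.
have := curvC12 u x y z; have := curvC34 u x y z; have := curvC34 x u y z; have := curvC12 u x z y.
have := curvC12 u y z x; have := curvC34 u y z x; have := curvC34 y u z x; have := curvC12 u y x z.
lra.
Qed.

Lemma curvD1 x x' y z u : C (x + x') y z u = C x y z u + C x' y z u.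
Proof. by have := scalar_formD (curv_scalar H y z u) x x'. Qed.
Lemma curvZ1 a x y z u : C (a *: x) y z u = a * C x y z u.
Proof. by have := scalar_formZ (curv_scalar H y z u) a x. Qed.
Lemma curvN1 x y z u : C (- x) y z u = - C x y z u.
Proof. by have := scalar_formN (curv_scalar H y z u) x. Qed.
Lemma curvD2 x x' y z u : C y (x + x') z u = C y x z u + C y x' z u.
Proof. by rewrite curvC12 curvD1 !(curvC12 y) opprD. Qed.
Lemma curvZ2 a x y z u : C y (a *: x) z u = a * C y x z u.
Proof. by rewrite curvC12 curvZ1 !(curvC12 y) mulrN. Qed.
Lemma curvN2 x y z u : C y (- x) z u = - C y x z u.
Proof. by rewrite curvC12 curvN1 !(curvC12 y). Qed.
Lemma curvD3 x x' y z u : C y z (x + x') u = C y z x u + C y z x' u.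
Proof. by have := scalar_formD (curv_scalar3 H y z u) x x'. Qed.
Lemma curvZ3 a x y z u : C y z (a *: x) u = a * C y z x u.
Proof. by have := scalar_formZ (curv_scalar3 H y z u) a x. Qed.
Lemma curvN3 x y z u : C y z (- x) u = - C y z x u.
Proof. by have := scalar_formN (curv_scalar3 H y z u) x. Qed.
Lemma curvD4 x x' y z u : C y z u (x + x') = C y z u x + C y z u x'.
Proof. by rewrite curvC34 curvD3 !(curvC34 y z u) opprD. Qed.
Lemma curvZ4 a x y z u : C y z u (a *: x) = a * C y z u x.
Proof. by rewrite curvC34 curvZ3 !(curvC34 y z u) mulrN. Qed.
Lemma curvN4 x y z u : C y z u (- x) = - C y z u x.
Proof. by rewrite curvC34 curvN3 !(curvC34 y z u). Qed.
Definition curvE := (curvD1, curvD2, curvD3, curvD4, curvN1, curvN2, curvN3, curvN4,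
  curvZ1, curvZ2, curvZ3, curvZ4).

(** Polarisation, first in the outer and then in the inner arguments, makes [C]
    totally skew in three arguments; the cyclic identity then gives [3 C = 0]. *)
Lemma curv_eq0 : (forall x y, C x y y x = 0) -> forall x y z u, C x y z u = 0.
Proof.
move=> h.
have h1 x y z : C x y y z = 0.
  have := h (x + z) y; rewrite !curvE !h; have := curv_pair x y y z.
  by rewrite (curvC12 y z) (curvC34 z y x); lra.
have h2 x y w z : C x y w z = - C x w y z.
  by have := h1 x (y + w) z; rewrite !curvE !h1; lra.
move=> x y z u; have := curv_cyclic H x y z u.
have := h2 x y z u; have := h2 y z x u; have := curvC12 x z y u; have := curvC12 y x z u.
have := curvC12 y z x u; have := h2 z x y u; have := h2 z y x u; lra.
Qed.

End Theory.
End CurvatureLike.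

Lemma curvature_like_sub (R : realFieldType) (m : nat) (K : 'rV[R]_m -> 'rV[R]_m -> 'rV[R]_m -> 'rV[R]_m -> R)
  (ip : 'rV[R]_m -> 'rV[R]_m -> R) nu :
  curvature_like K -> (forall z, scalar (ip^~ z)) -> (forall x y, ip x y = ip y x) ->
  curvature_like (fun x y z u => K x y z u - nu * (ip y z * ip x u - ip x z * ip y u)).
Proof.
move=> HK s1 sym; have s2 z : scalar (ip z).
  by move=> a x y; rewrite !(sym z) s1.
split=> [y z u a x x'|x y u a z z'|x y z u|x y z u|x y z u].
- by rewrite (curvD1 HK) (curvZ1 HK) !s1; ring.
- by rewrite (curvD3 HK) (curvZ3 HK) !s2; ring.
- by rewrite (curvC12 HK); ring.
- by rewrite (curvC34 HK); ring.
- have := curv_cyclic HK x y z u; rewrite (sym y x) (sym z x) (sym z y); lra.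
Qed.

Lemma nonroot (R : realFieldType) (p : {poly R}) : p != 0 -> exists s, ~~ root p s.
Proof.
move=> p0; apply/not_existsP => r.
have := max_poly_roots p0 (rs := [seq i%:R | i <- iota 0 (size p)]).
rewrite size_map size_iota ltnn => H; suff : false by [].
apply: H; first by apply/allP => x _; have /negP := r x; rewrite negbK.
rewrite map_inj_uniq ?iota_uniq // => i j /eqP; rewrite eqr_nat => /eqP //.
Qed.

Section Division.
Context {R : realFieldType} {m : nat}.
Local Notation V := 'rV[R]_m.
Variables (ip : V -> V -> R) (J : V -> V).
Hypothesis H : hermitian_form ip J.
Implicit Types (x y z u v w : V) (a b : R).

Local Notation om x y := (ip (J x) y).

Lemma om_skew x y : om x y = - om y x.
Proof. by rewrite -(J_isometry H) (J_sqr H) -scaleN1r (scalar_formZ (ip_scalar H _)) mulN1r (ip_sym H). Qed.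
Lemma om_scalar y : scalar (fun x => om x y).
Proof. by move=> a x z; rewrite (J_linear H) (ip_scalar H). Qed.

Lemma om_neq0 y : y != 0 -> om (J y) y != 0.
Proof.
move=> y0; rewrite (J_sqr H) (scalar_formN (ip_scalar H _)) oppr_eq0.
by rewrite gt_eqF // (ip_pos H).
Qed.

(** One hyperplane is removed at a time: if [om x y = 0], the points
    [x + s *: J y] avoid all the hyperplanes for all but finitely many [s], and
    two such values of [s] determine [g x]. *)
Lemma scalar_eq0_off (g : V -> R) (ys : seq V) : scalar g -> all (fun y => y != 0) ys ->
  (forall x, all (fun y => om x y != 0) ys -> g x = 0) -> forall x, g x = 0.
Proof.
move=> sg; elim: ys => [|y ys IH] /=; first by move=> _ h x; exact: h.
move=> /andP[y0 ys0] h; apply: IH => // x xys.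
have [xy|xy] := eqVneq (om x y) 0; last by apply: h; rewrite xy.
pose p := 'X * \prod_(z <- ys) ((om x z)%:P + (om (J y) z) *: 'X).
have p0 : p != 0.
  rewrite mulf_neq0 ?polyX_eq0 // prodf_seq_neq0; apply/allP => z zys /=.
  apply: contraTneq (allP xys _ zys) => /(congr1 (fun q : {poly R} => q.[0])).
  by rewrite !hornerE ?mulr0 ?addr0 => ->; rewrite eqxx.
have good s : ~~ root p s -> g x + s * g (J y) = 0.
  rewrite /p rootM negb_or rootX => /andP[s0 /negP ns].
  rewrite -(scalar_formZ sg) -(scalar_formD sg); apply: h; rewrite (scalar_formD (om_scalar y)) xy add0r.
  rewrite (scalar_formZ (om_scalar y)) mulf_neq0 ?om_neq0 //=.
  apply/allP => z zys; apply/eqP => e; apply: ns.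
  rewrite /root horner_prod prodf_seq_eq0; apply/hasP; exists z => //=.
  rewrite !hornerE -e (scalar_formD (om_scalar z)) (scalar_formZ (om_scalar z)).
  by apply/eqP; ring.
have [s1 r1] := nonroot p0.
have [s2] : exists s, ~~ root (p * ('X - s1%:P)) s.
  by apply: nonroot; rewrite mulf_neq0 // polyXsubC_eq0.
rewrite rootM negb_or root_XsubC => /andP[r2 s12].
have := good _ r1; have := good _ r2 => e2 e1.
have : (s2 - s1) * g (J y) = 0 by lra.
move/eqP; rewrite mulf_eq0 subr_eq0 (negPf s12) => /eqP e; move: e1.
by rewrite e mulr0 addr0.
Qed.

Variable C : V -> V -> V -> V -> R.
Hypothesis HC : curvature_like C.
Hypothesis C0 : forall x y, om x y = 0 -> C x y y x = 0.

(** The vector [x - t *: J y] is orthogonal to [J y] for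
    [t = - om x y / ip y y]; expanding the vanishing of [C] on it, every term that
    is left contains the factor [om x y]. *)
Definition quot x y :=
  - (2 * C x y y (J y) + om x y / ip y y * C (J y) y y (J y)) / ip y y.

Lemma quot_scalar y : scalar (fun x => quot x y).
Proof. by move=> a x z; rewrite /quot (curvD1 HC) (curvZ1 HC) (om_scalar y); ring. Qed.

Lemma quotP x y : C x y y x = om x y * quot x y.
Proof.
have [->|y0] := eqVneq y 0.
  by rewrite -(scale0r 0) (curvZ2 HC) /quot (curvZ2 HC) om_skew (scalar_formZ (om_scalar x)) !mul0r oppr0 mul0r.
have yy : ip y y != 0 by rewrite gt_eqF // (ip_pos H).
pose t := - om x y / ip y y.
have /C0 : om (x - t *: J y) y = 0.
  rewrite (scalar_formD (om_scalar y)) (scalar_formN (om_scalar y)) (scalar_formZ (om_scalar y)).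
  by rewrite (J_sqr H) (scalar_formN (ip_scalar H y)) /t; field.
rewrite !(curvE HC) (curv_pair HC (J y) y y x) (curvC12 HC y x) (curvC34 HC x y (J y)) opprK => e.
have -> : C x y y x = 2 * t * C x y y (J y) - t ^+ 2 * C (J y) y y (J y) by lra.
by rewrite /t /quot; field.
Qed.

Lemma quot_skew_off x y : om x y != 0 -> quot x y = - quot y x.
Proof.
move=> n0; apply: (mulfI n0); rewrite -quotP mulrN -mulNr -om_skew -quotP.
by rewrite (curv_pair HC) (curvC12 HC) (curvC34 HC) opprK.
Qed.

(** Where [om] is nonzero, skewness of [quot] reduces linearity in the second
    argument to linearity in the first one; the difference of the two sides is
    linear in [x], so that the excluded hyperplanes do not matter. *)
Lemma quot_linear_r x y z a : quot x (a *: y + z) = a * quot x y + quot x z.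
Proof.
pose g x := quot x (a *: y + z) - a * quot x y - quot x z.
have sg : scalar g by move=> b u v; rewrite /g !quot_scalar; ring.
suff : g x = 0 by rewrite /g; lra.
have q0 u v : v = 0 -> quot u v = - quot v u.
  move=> ->; rewrite (scalar_form0 (quot_scalar u)) /quot.
  by rewrite (scalar_form0 (ip_scalar H 0)) invr0 mulr0 oppr0.
apply: (scalar_eq0_off (ys := [seq v <- [:: a *: y + z; y; z] | v != 0])) => //.
  by rewrite all_filter; apply/allP => u _; apply/implyP.
move=> u; rewrite all_filter /= andbT => /and3P[h1 h2 h3].
have e v : (v != 0) ==> (om u v != 0) -> quot u v = - quot v u.
  by have [v0 _|v0 /= n] := eqVneq v 0; [exact: q0|exact: quot_skew_off].
by rewrite /g !e // quot_scalar; ring.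
Qed.

Lemma quot_skew x y : quot x y = - quot y x.
Proof.
have s2 u : scalar (quot u) by move=> a v w; exact: quot_linear_r.
have [->|y0] := eqVneq y 0; first by rewrite (scalar_form0 (s2 x)) (scalar_form0 (quot_scalar x)) oppr0.
suff : quot x y + quot y x = 0 by lra.
apply: (scalar_eq0_off (g := fun x => quot x y + quot y x) (ys := [:: y])) => //=.
- by move=> a u v; rewrite quot_scalar s2; ring.
- by rewrite y0.
- by move=> u; rewrite andbT => /quot_skew_off ->; ring.
Qed.

(** The Kulkarni-Nomizu type product of the 2-forms [om] and [s], up to sign and
    scale the curvature-like form with sectional values [om x y * s x y]. *)
Definition wedge_om (s : V -> V -> R) x y z u :=
  2 * om x y * s z u + 2 * s x y * om z u + om x z * s y u + s x z * om y u
  - om x u * s y z - s x u * om y z.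

(** Both sides are curvature-like and have the same sectional values. *)
Lemma curv_quot x y z u : C x y z u = - 6^-1 * wedge_om quot x y z u.
Proof.
have s2 v : scalar (quot v) by move=> a ? ?; exact: quot_linear_r.
pose D x y z u := C x y z u + 6^-1 * wedge_om quot x y z u.
have HD : curvature_like D.
  have o2 v : scalar (fun w => om v w) by move=> a ? ?; rewrite !(om_skew v) om_scalar; ring.
  split => [y' z' u'|x' y' u'|x' y' z' u'|x' y' z' u'|x' y' z' u'].
  - by move=> a v w; rewrite /D /wedge_om (curvD1 HC) (curvZ1 HC) !om_scalar !quot_scalar; ring.
  - by move=> a v w; rewrite /D /wedge_om (curvD3 HC) (curvZ3 HC) !om_scalar !quot_scalar !o2 !s2; ring.
  - by rewrite /D /wedge_om (curvC12 HC x') (om_skew x' y') (quot_skew x' y'); ring.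
  - by rewrite /D /wedge_om (curvC34 HC x') (om_skew z' u') (quot_skew z' u'); ring.
  - rewrite /D /wedge_om.
    have := curv_cyclic HC x' y' z' u'.
    rewrite (om_skew z' x') (quot_skew z' x') (om_skew y' x') (quot_skew y' x').
    by rewrite (om_skew z' y') (quot_skew z' y'); lra.
suff : D x y z u = 0 by rewrite /D; lra.
apply: (curv_eq0 HD) => {z u}{}x {}y.
rewrite /D /wedge_om quotP (om_skew y x) (quot_skew y x).
have oxx v : om v v = 0 by have := om_skew v v; lra.
have qxx v : quot v v = 0 by have := quot_skew v v; lra.
by rewrite !oxx !qxx; field.
Qed.

End Division.

(** * Gray's curvature identity *)

Section Gray.
Context {R : realFieldType} {m : nat}.
Local Notation V := 'rV[R]_m.
Variables (ip : V -> V -> R) (J : V -> V).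
Hypothesis H : hermitian_form ip J.
(** [Psi a b x y] stands for the second covariant derivative of the fundamental
    form and [K] for the curvature. *)
Variables (A : V -> V -> V) (K Psi : V -> V -> V -> V -> R) (sigma : V -> V -> R) (nu : R).
Implicit Types (x y z u v w : V) (a b : V).

Local Notation om x y := (ip (J x) y).

Hypothesis A_J : forall v x, A v (J x) = - J (A v x).
Hypothesis A_skew : forall v x y, ip (A v x) y = - ip (A v y) x.
Hypothesis A_cyclic : forall v x y, ip (A v x) y + ip (A x y) v + ip (A y v) x = 0.
Hypothesis Psi_skew : forall a b x y, Psi a b x y = - Psi a b y x.
Hypothesis Psi_cyclic : forall a x y z, Psi a x y z + Psi a y z x + Psi a z x y = 0.
Hypothesis PsiN : forall a b x y, Psi a (- b) x y = - Psi a b x y.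
Hypothesis Psi_ricci : forall a b x y,
  Psi a b x y - Psi b a x y = K a b (J x) y + K a b x (J y).
Hypothesis Psi_J : forall a b x y,
  Psi a b (J x) y - Psi a b x (J y) = ip (A a x) (A b y) + ip (A b x) (A a y).
Hypothesis sigma_scalar : forall y, scalar (sigma^~ y).
Hypothesis sigma_skew : forall x y, sigma x y = - sigma y x.
Hypothesis KE : forall x y z u,
  K x y z u = nu * (ip y z * ip x u - ip x z * ip y u) - 6^-1 * wedge_om ip J sigma x y z u.

Local Notation N := (nijenhuis A).

Let ipC x y : ip x y = ip y x. Proof. exact: ip_sym H x y. Qed.
Let ipDl x y z : ip (x + y) z = ip x z + ip y z. Proof. exact: scalar_formD (ip_scalar H z) x y. Qed.
Let ipNl x z : ip (- x) z = - ip x z. Proof. exact: scalar_formN (ip_scalar H z) x. Qed.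
Let ipDr x y z : ip z (x + y) = ip z x + ip z y. Proof. by rewrite ipC ipDl !(ipC z). Qed.
Let ipNr x z : ip z (- x) = - ip z x. Proof. by rewrite ipC ipNl !(ipC z). Qed.
Let JJ x : J (J x) = - x. Proof. exact: J_sqr H x. Qed.
Let ipJJ x y : ip (J x) (J y) = ip x y. Proof. exact: J_isometry H x y. Qed.
Let ipJl x y : ip (J x) y = - ip x (J y). Proof. by rewrite -(ipJJ x) JJ ipNr opprK. Qed.
Let A_Jl v x : A (J v) x = - J (A v x).
Proof.
have e t : ip (A (J v) x - A v (J x)) t = 0.
  by rewrite ipDl ipNl (phi_J_left H A_skew A_J A_cyclic) subrr.
by rewrite -A_J; apply/eqP; rewrite -subr_eq0; apply/negPn/negP => /(ip_pos H); rewrite e ltxx.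
Qed.
Let sN x y : sigma (- x) y = - sigma x y. Proof. exact: scalar_formN (sigma_scalar y) x. Qed.
Let sNr x y : sigma x (- y) = - sigma x y. Proof. by rewrite sigma_skew sN -sigma_skew. Qed.

(* four instances of the right side of [Psi_J], chosen so that all products of
   a value of [A] at [x, y] and one at [z, u] occur *)
Let W x y z u :=
  (ip (A y x) (A u z) + ip (A u x) (A y z)) - (ip (A y x) (A z u) + ip (A z x) (A y u))
  - (ip (A x y) (A u z) + ip (A u y) (A x z)) + (ip (A x y) (A z u) + ip (A z y) (A x u)).

Let JN x : J (- x) = - J x.
Proof.
have J0 : J 0 = 0.
  have := J_linear H 1 0 0; rewrite scaler0 addr0 scale1r => /eqP.
  by rewrite -subr_eq subrr => /eqP/esym.
by have := J_linear H (-1) x 0; rewrite !addr0 J0 addr0 !scaleN1r.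
Qed.

(* applying [J] to both [x] and [y] changes the sign of the products in
   [<N x y, N z u>] and fixes all the other terms of [W] *)
Let W_nijenhuis x y z u : 4 * ip (N x y) (N z u) =
  W x y z u - W (J x) (J y) z u - W x y (J z) (J u) + W (J x) (J y) (J z) (J u).
Proof.
rewrite /W /nijenhuis !(A_J, A_Jl, JJ, JN, ipNl, ipNr, ipDl, ipDr, opprK, ipJJ).
by ring.
Qed.

Let rho a b x y := K a b (J x) y + K a b x (J y).

(* the cyclic identity and commutations lead to second derivatives in the
   directions [x, y] evaluated on [z, u], or conversely; every commutation costs
   a curvature term [rho] *)
Let W_Psi x y z u : W x y z u =
  Psi x (J y) z u - Psi y (J x) z u + Psi z (J u) x y - Psi u (J z) x y
  - rho y u x (J z) + rho x u y (J z) + rho y z x (J u) - rho x z y (J u).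
Proof.
have := Psi_J y u x z; have := Psi_J y z x u; have := Psi_J x u y z; have := Psi_J x z y u.
have := Psi_cyclic y u (J x) z; have := Psi_cyclic x u (J y) z.
have := Psi_cyclic u x y (J z); have := Psi_cyclic z x y (J u).
have := Psi_skew y z u (J x); have := Psi_skew y (J x) z u.
have := Psi_skew x z u (J y); have := Psi_skew x (J y) z u.
have := Psi_skew u y (J z) x; have := Psi_skew u (J z) x y.
have := Psi_skew z y (J u) x; have := Psi_skew z (J u) x y.
have := Psi_ricci y u x (J z); have := Psi_ricci x u y (J z).
have := Psi_ricci y z x (J u); have := Psi_ricci x z y (J u).
rewrite -!/(rho _ _ _ _) /W; lra.
Qed.

(** Gray's identity.  In the alternating sum of [W] over the rotations by [J] the
    second derivatives of the fundamental form pair up into commutators, which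
    the Ricci identity turns into curvature.  The special form of the curvature
    then leaves only the contribution of [tau]. *)
Lemma gray_identity x y z u : ip (N x y) (N z u) = wedge_form ip J sigma nu x y z u.
Proof.
apply: (@mulfI _ 4); first by rewrite pnatr_eq0.
rewrite W_nijenhuis !W_Psi !JJ !PsiN.
have e1 := Psi_ricci x (J y) z u; have e2 := Psi_ricci y (J x) z u.
have e3 := Psi_ricci x (J y) (J z) (J u); have e4 := Psi_ricci y (J x) (J z) (J u).
have e5 := Psi_ricci z (J u) x y; have e6 := Psi_ricci u (J z) x y.
have e7 := Psi_ricci z (J u) (J x) (J y); have e8 := Psi_ricci u (J z) (J x) (J y).
pose f x y z u := rho x (J y) z u - rho y (J x) z u.
pose Q x y z u := - rho y u x (J z) + rho x u y (J z) + rho y z x (J u) - rho x z y (J u).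
transitivity (f x y z u - f x y (J z) (J u) + f z u x y - f z u (J x) (J y)
  + Q x y z u - Q (J x) (J y) z u - Q x y (J z) (J u) + Q (J x) (J y) (J z) (J u)).
  rewrite /f -!/(rho _ _ _ _) in e1 e2 e3 e4 e5 e6 e7 e8 *.
  rewrite /Q !JJ; lra.
move=> {e1 e2 e3 e4 e5 e6 e7 e8}.
rewrite /f /Q /rho !KE /wedge_om /wedge_form /tau.
rewrite !(JJ, JN, ipNl, ipNr, ipJl, sN, sNr, opprK).
have cJ a b : ip b (J a) = - ip a (J b) by rewrite ipC ipJl.
rewrite !(ipC u x, ipC u y, ipC u z, ipC z x, ipC z y, ipC y x).
rewrite !(cJ x u, cJ y u, cJ z u, cJ x z, cJ y z, cJ x y).
have sJ p q : (sigma q p = - sigma p q) * (sigma (J q) p = - sigma p (J q)) *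
  (sigma q (J p) = - sigma (J p) q) * (sigma (J q) (J p) = - sigma (J p) (J q)).
  by do !split; exact: sigma_skew.
rewrite !(sJ x u, sJ y u, sJ z u, sJ x z, sJ y z, sJ x y).
by field.
Qed.
End Gray.
(** * Directional derivatives *)

Import numFieldNormedType.Exports.
Local Open Scope classical_set_scope.

Section Directional.
Context {R : realType} {m : nat}.
Local Notation E := 'rV[R]_m.
Implicit Types (f g : E -> R) (p u v : E) (U : set E).

Lemma is_derive_line f p v (t : R) :
  derivable f (p + t *: v) v ->
  is_derive t 1 (fun s : R => f (p + s *: v)) ('D_v f (p + t *: v)).
Proof.
have Eq : (fun h : R => h^-1 *: (((fun s : R => f (p + s *: v)) \o shift t) (h *: 1) - f (p + t *: v)))
  = (fun h : R => h^-1 *: ((f \o shift (p + t *: v)) (h *: v) - f (p + t *: v))).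
  apply/funext => h /=; congr (_ *: (f _ - _)).
  by rewrite [h *: 1]mulr1 scalerDl addrCA.
by move=> d; split; rewrite /derivable /derive /= Eq.
Qed.

Lemma directional_MVT f p v :
  (forall t : R, 0 <= t <= 1 -> derivable f (p + t *: v) v) ->
  exists2 t : R, 0 <= t <= 1 & f (p + v) - f p = 'D_v f (p + t *: v).
Proof.
move=> d.
have [||t] := @MVT_segment R (fun s : R => f (p + s *: v))
   (fun t => 'D_v f (p + t *: v)) 0 1 ler01.
- move=> x; rewrite in_itv /= => /andP[x0 x1].
  by apply: is_derive_line; apply: d; rewrite !ltW.
- apply: derivable_within_continuous => x; rewrite in_itv /= => xI.
  by have := is_derive_line (d x xI) => -[].
- by rewrite in_itv /= => tI; move=> Ht; exists t => //; move: Ht; rewrite scale1r scale0r addr0 subr0 mulr1.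
Qed.

Lemma is_deriveZdir f p v (c : R) :
  derivable f p v -> is_derive p (c *: v) f (c * 'D_v f p).
Proof.
move=> d.
have := @is_derive_line f p v 0; rewrite scale0r addr0 => /(_ d) [d1 v1].
set phi := (fun s : R => f (p + s *: v)) in d1 v1.
have d2 : is_derive (0 : R) 1 (fun s : R => c * s) c.
  have [a b] : is_derive (0 : R) 1 (c \*: (@idfun R)) (c *: 1) by exact: is_deriveZ.
  by split; rewrite -?b //; rewrite [LHS]b [c%:A]mulr1.
have v2 : derive1 (phi \o (fun s : R => c * s)) 0 = c * 'D_v f p.
  have [d2a d2b] := d2.
  have d1' := eq_rect_r (fun x => derivable phi x 1) d1 (mulr0 c).
  by rewrite (derive1_comp d2a d1') !derive1E mulr0 v1 d2b mulrC.
have d3 : derivable (phi \o (fun s : R => c * s)) 0 1.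
  apply/derivable1_diffP; apply: differentiable_comp.
    by apply: (derivable1_diffP _ _).1; have [] := d2.
  by rewrite mulr0; apply: (derivable1_diffP _ _).1.
have Eq : (phi \o (fun s : R => c * s)) = (fun h : R => f (h *: (c *: v) + p)).
  by apply/funext => h; rewrite /phi /= addrC scalerA mulrC.
split; first by apply: (derivable1P f p (c *: v)).2; rewrite -Eq.
rewrite -v2 derive1E Eq /derive /=; set g1 := fun h => _; set g2 := fun h => _.
suff -> : g1 = g2 by [].
by apply/funext => h; rewrite /g1 /g2 addr0 [h%:A]mulr1 scale0r add0r.
Qed.

Lemma open_normP U p : open U -> U p ->
  exists2 e : R, 0 < e & forall q, `|q - p| < e -> U q.
Proof.
move=> oU Up; have /nbhs_ballP[e e0 He] : nbhs p U by exact: open_nbhs_nbhs.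
by exists e => // q qp; apply: He; rewrite -ball_normE /ball_ /= distrC.
Qed.

Lemma cts_normP f p : {for p, continuous f} <->
  forall e : R, 0 < e -> exists2 d : R, 0 < d &
    forall q, `|q - p| < d -> `|f q - f p| < e.
Proof.
split=> [cf e e0|H].
  have /(@cvgrPdist_lt _ _ _ (nbhs p) _) /(_ e e0) /nbhs_ballP[d d0 Hd] : f @ p --> f p by [].
  exists d => // q qp; rewrite distrC; apply: Hd.
  by rewrite -ball_normE /ball_ /= distrC.
apply/(@cvgrPdist_lt _ _ _ (nbhs p) _) => e e0; have [d d0 Hd] := H e e0.
apply/nbhs_ballP; exists d => // q /=.
by rewrite -ball_normE /ball_ /= distrC => /Hd; rewrite distrC.
Qed.

(** A continuous derivative in one of the two directions is enough: the
    increment along [u + v] is split at [p + h *: u], and the mean value theorem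
    turns the second part into a value of ['D_v f] near [p]. *)
Lemma is_deriveDdir U f p u v : open U -> U p ->
  (forall q, U q -> derivable f q v) -> derivable f p u ->
  {for p, continuous ('D_v f)} ->
  is_derive p (u + v) f ('D_u f p + 'D_v f p).
Proof.
move=> oU Up dv du /cts_normP cv.
suff H : (fun h : R => h^-1 *: ((f \o shift p) (h *: (u + v)) - f p)) @ 0^' --> 'D_u f p + 'D_v f p.
  split; first by apply/cvg_ex; eexists; exact: H.
  exact: cvg_lim H.
have /cvgrPdist_lt du' : (fun h : R => h^-1 *: ((f \o shift p) (h *: u) - f p)) @ 0^' --> 'D_u f p by [].
apply/cvgrPdist_lt => e e0; have e2 : 0 < e / 2 by rewrite divr_gt0.
have [d d0 Hd] := cv _ e2.
have [r r0 Hr] := open_normP oU Up.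
pose M := `|u| + `|v| + 1.
have M0 : 0 < M by rewrite ltr_wpDl ?addr_ge0.
near=> h.
have h0 : h != 0 by near: h; exact: nbhs_dnbhs_neq.
have hs : `|h| < Num.min d r / M.
  by near: h; apply: dnbhs0_lt; rewrite divr_gt0 // lt_min d0 r0.
have small (t : R) : 0 <= t <= 1 -> `|p + h *: u + t *: (h *: v) - p| < Num.min d r.
  move=> /andP[t0 t1]; rewrite addrC -addrA addKr.
  rewrite scalerA [t * h]mulrC -scalerA -scalerDr normrZ.
  apply: le_lt_trans (_ : `|h| * M < _); last by rewrite -ltr_pdivlMr.
  rewrite ler_wpM2l// (le_trans (ler_normD _ _))// /M normrZ ger0_norm//.
  have : t * `|v| <= `|v| by rewrite ler_piMl.
  lra.
have [t tI Ht] : exists2 t : R, 0 <= t <= 1 &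
    f (p + h *: u + h *: v) - f (p + h *: u) = 'D_(h *: v) f (p + h *: u + t *: (h *: v)).
  apply: directional_MVT => t tI; apply: (@ex_derive _ _ _ _ _ _ _ (is_deriveZdir h _)).
  by apply/dv/Hr; apply: lt_le_trans (small _ tI) _; rewrite ge_min lexx orbT.
have st := small _ tI.
have [_ HV] : is_derive (p + h *: u + t *: (h *: v)) (h *: v) f
   (h * 'D_v f (p + h *: u + t *: (h *: v))).
  by apply/is_deriveZdir/dv/Hr; apply: lt_le_trans st _; rewrite ge_min lexx orbT.
rewrite HV in Ht.
have -> : h^-1 *: ((f \o shift p) (h *: (u + v)) - f p) =
  'D_v f (p + h *: u + t *: (h *: v)) + h^-1 *: ((f \o shift p) (h *: u) - f p).
  rewrite -['D_v f _](mulKf h0) -Ht /GRing.scale /= -mulrDr; congr (_ * _).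
  rewrite -/(GRing.scale h (u + v)) -/(GRing.scale h u) -/(GRing.scale h v).
  rewrite scalerDr [h *: u + p]addrC [_ + p]addrC addrA.
  by ring.
have H1 : `|'D_v f (p + h *: u + t *: (h *: v)) - 'D_v f p| < e / 2.
  by apply: Hd; apply: lt_le_trans st _; rewrite ge_min lexx.
have H2 : `|'D_u f p - h^-1 *: ((f \o shift p) (h *: u) - f p)| < e / 2.
  by near: h; exact: du'.
rewrite (_ : _ - _ = ('D_u f p - h^-1 *: ((f \o shift p) (h *: u) - f p)) -
   ('D_v f (p + h *: u + t *: (h *: v)) - 'D_v f p)); last by ring.
by apply: le_lt_trans (ler_normB _ _) _; lra.
Unshelve. all: by end_near. Qed.

Lemma directional_MVT_scaled f p v (h : R) :
  (forall t : R, 0 <= t <= 1 -> derivable f (p + t *: (h *: v)) v) ->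
  exists2 t : R, 0 <= t <= 1 &
    f (p + h *: v) - f p = h * 'D_v f (p + t *: (h *: v)).
Proof.
move=> d; have [t tI Ht] : exists2 t : R, 0 <= t <= 1 &
    f (p + h *: v) - f p = 'D_(h *: v) f (p + t *: (h *: v)).
  by apply: directional_MVT => t tI; have [] := is_deriveZdir h (d t tI).
by exists t => //; rewrite Ht; have [_ ->] := is_deriveZdir h (d t tI).
Qed.

(** The second difference of [f] over a parallelogram, as a value of a mixed
    derivative inside it. *)
Lemma directional_MVT2 U f p u v (h : R) :
  (forall s t : R, 0 <= s <= 1 -> 0 <= t <= 1 ->
     U (p + s *: (h *: u) + t *: (h *: v))) ->
  (forall q, U q -> derivable f q u) ->
  (forall q, U q -> derivable ('D_u f) q v) ->
  exists s, exists2 t, 0 <= s <= 1 /\ 0 <= t <= 1 &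
   f (p + h *: u + h *: v) - f (p + h *: u) - f (p + h *: v) + f p
   = h * (h * 'D_v ('D_u f) (p + s *: (h *: u) + t *: (h *: v))).
Proof.
move=> sq du dvu.
pose F q := f (q + h *: v) - f q.
have sh (s : R) : 0 <= s <= 1 ->
    is_derive (p + s *: (h *: u)) u F
      ('D_u f (p + s *: (h *: u) + h *: v) - 'D_u f (p + s *: (h *: u))).
  move=> sI; apply: is_deriveB.
    have d : derivable f (p + s *: (h *: u) + h *: v) u.
      by apply: du; have := sq s 1 sI; rewrite scale1r; apply; rewrite ler01 lexx.
    have Eq : (fun k : R => k^-1 *: (((fun q => f (q + h *: v)) \o
          shift (p + s *: (h *: u))) (k *: u) - f (p + s *: (h *: u) + h *: v)))
      = (fun k : R => k^-1 *: ((f \o shift (p + s *: (h *: u) + h *: v)) (k *: u)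
          - f (p + s *: (h *: u) + h *: v))).
      by apply/funext => k; rewrite /= !addrA.
    by split; rewrite /derivable /derive Eq.
  apply: DeriveDef => //; apply: du.
  by have := sq s 0 sI; rewrite scale0r addr0; apply; rewrite ler01 lexx.
have [s sI Hs] : exists2 s : R, 0 <= s <= 1 &
    F (p + h *: u) - F p = h * 'D_u F (p + s *: (h *: u)).
  by apply: directional_MVT_scaled => s sI; have [] := sh s sI.
have [t tI Ht] := @directional_MVT_scaled ('D_u f) (p + s *: (h *: u)) v h
  (fun t tI => dvu _ (sq s t sI tI)).
exists s, t => //; rewrite -Ht.
move: Hs; have [_ ->] := sh s sI; rewrite /F => <-.
by rewrite opprB addrA addrAC.
Qed.

Lemma ltr_dist_half (X Y A B e : R) :
  `|X - A| < e / 2 -> `|Y - B| < e / 2 -> X = Y -> `|A - B| < e.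
Proof.
move=> XA YB XY; rewrite (_ : A - B = (Y - B) - (X - A)); last by rewrite XY; ring.
by apply: le_lt_trans (ler_normB _ _) _; lra.
Qed.

(** Symmetry of second derivatives: the second difference over a small
    parallelogram is, by two applications of the mean value theorem in either
    order, a value of each of the two mixed derivatives near [p]. *)
Lemma derive_swap U f p u v : open U -> U p ->
  (forall q, U q -> derivable f q u) -> (forall q, U q -> derivable f q v) ->
  (forall q, U q -> derivable ('D_u f) q v) ->
  (forall q, U q -> derivable ('D_v f) q u) ->
  {for p, continuous ('D_v ('D_u f))} -> {for p, continuous ('D_u ('D_v f))} ->
  'D_v ('D_u f) p = 'D_u ('D_v f) p.
Proof.
move=> oU Up du dv dvu duv /cts_normP c1 /cts_normP c2.
apply/eqP; rewrite -subr_eq0 -normr_eq0; apply/negP => /negP N.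
set e := `|_| in N; have e0 : 0 < e by rewrite lt_neqAle eq_sym N normr_ge0.
have e2 : 0 < e / 2 by rewrite divr_gt0.
have [d1 d10 H1] := c1 _ e2; have [d2 d20 H2] := c2 _ e2.
have [r r0 Hr] := open_normP oU Up.
pose M := `|u| + `|v| + 1.
have M0 : 0 < M by rewrite ltr_wpDl ?addr_ge0.
pose d := Num.min r (Num.min d1 d2).
have d0 : 0 < d by rewrite !lt_min r0 d10.
have [h h0 hM] : exists2 h : R, 0 < h & d = h * M.
  by exists (d / M); rewrite ?divr_gt0// divfK // gt_eqF.
have small (s t : R) : 0 <= s <= 1 -> 0 <= t <= 1 ->
   `|p + s *: (h *: u) + t *: (h *: v) - p| < d.
  move=> /andP[s0 s1] /andP[t0 t1]; rewrite addrC -addrA addKr.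
  rewrite scalerA [s * h]mulrC scalerA [t * h]mulrC -!scalerA -scalerDr normrZ.
  rewrite gtr0_norm // hM.
  rewrite ltr_pM2l// (le_lt_trans (ler_normD _ _))// /M !normrZ !ger0_norm//.
  have : t * `|v| <= `|v| by rewrite ler_piMl.
  have : s * `|u| <= `|u| by rewrite ler_piMl.
  lra.
have [|s1 [t1 [s1I t1I] E1]] := @directional_MVT2 U f p u v h _ du dvu.
  by move=> s t sI tI; apply: Hr; apply: lt_le_trans (small s t sI tI) _; rewrite ge_min lexx.
have [|s2 [t2 [s2I t2I] E2]] := @directional_MVT2 U f p v u h _ dv duv.
  move=> s t sI tI; apply: Hr; rewrite [p + _ + _]addrAC; apply: lt_le_trans (small t s tI sI) _.
  by rewrite ge_min lexx.
have key (X Y D1 D2 : R) : D1 = h * (h * X) -> D2 = h * (h * Y) -> D1 = D2 -> X = Y.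
  move=> -> ->; rewrite !mulrA; apply: mulfI.
  by rewrite mulf_neq0 // gt_eqF.
have E : 'D_v ('D_u f) (p + s1 *: (h *: u) + t1 *: (h *: v)) =
         'D_u ('D_v f) (p + s2 *: (h *: v) + t2 *: (h *: u)).
  apply: (key _ _ _ _ E1 E2); rewrite [p + h *: v + _]addrAC.
  by rewrite -!addrA; congr (_ + _); rewrite addrCA.
have G1 : `|'D_v ('D_u f) (p + s1 *: (h *: u) + t1 *: (h *: v)) - 'D_v ('D_u f) p| < e / 2.
  apply: H1; apply: lt_le_trans (small s1 t1 s1I t1I) _.
  by rewrite /d !ge_min lexx orbT.
have G2 : `|'D_u ('D_v f) (p + s2 *: (h *: v) + t2 *: (h *: u)) - 'D_u ('D_v f) p| < e / 2.
  apply: H2; rewrite [p + _ + _]addrAC; apply: lt_le_trans (small t2 s2 t2I s2I) _.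
  by rewrite /d !ge_min lexx !orbT.
by have := ltr_dist_half G1 G2 E; rewrite ltxx.
Qed.

End Directional.

(** * Smooth functions *)

Section SmoothFunctions.
Context {R : realType} {m : nat}.
Local Notation E := 'rV[R]_m.
Variable U : set E.
Hypothesis oU : open U.
Implicit Types (f g : E -> R) (p u v : E).

(** Closure under products and inverses is proved by induction on the order of
    differentiability, for which the sequences of partial derivatives in
    [smooth_on] are not suitable. *)
Fixpoint Ck (k : nat) f : Prop :=
  (forall p, U p -> {for p, continuous f}) /\
  if k is k'.+1 then
    (forall p i, U p -> derivable f p (delta_mx 0 i)) /\ forall i, Ck k' (partial i f)
  else True.

Lemma smooth_Ck f : smooth_on U f -> forall k, Ck k f.
Proof.
move=> sf k; elim: k f sf => [|k IH] f sf; (split; first by move=> p Up; have [] := sf [::] p Up).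
  by [].
split=> [p i Up|i]; first by have [_] := sf [::] p Up; apply.
by apply: IH => s p Up; have := sf (rcons s i) p Up; rewrite foldr_rcons.
Qed.

Lemma Ck_smooth f : (forall k, Ck k f) -> smooth_on U f.
Proof.
move=> cf s; have : Ck (size s).+1 f by [].
elim/last_ind: s f {cf} => [|s i IH] f; first by move=> [c [d _]] p Up; split; [exact: c|move=> i; exact: d].
rewrite size_rcons => -[_ [_ /(_ i) cf]] p Up.
by rewrite foldr_rcons; apply: IH cf _ Up.
Qed.

Lemma near_open (P : E -> Prop) p : U p -> (forall q, U q -> P q) -> \near p, P p.
Proof. by move=> Up H; apply: filterS (open_nbhs_nbhs (conj oU Up)) => q /H. Qed.

Lemma derive_eq_on f g p v : U p -> (forall q, U q -> f q = g q) -> 'D_v f p = 'D_v g p.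
Proof. by move=> Up H; apply: near_eq_derive; exact: near_open. Qed.

Lemma derivable_eq_on f g p v : U p -> (forall q, U q -> f q = g q) ->
  derivable f p v -> derivable g p v.
Proof. by move=> Up H; apply: near_eq_derivable; exact: near_open. Qed.

Lemma continuous_eq_on f g p : U p -> (forall q, U q -> f q = g q) ->
  {for p, continuous f} -> {for p, continuous g}.
Proof.
move=> Up H cf; rewrite /prop_for /continuous_at -H//.
apply: cvg_trans cf; apply: (@near_eq_cvg _ _ (nbhs p)); exact: near_open.
Qed.

Lemma Ck_eq k f g : (forall q, U q -> f q = g q) -> Ck k f -> Ck k g.
Proof.
elim: k f g => [|k IH] f g H [cf df]; (split; first by move=> p Up; apply: continuous_eq_on (cf p Up)).
  by [].
case: df => df pf; split=> [p i Up|i]; first by apply: derivable_eq_on (df p i Up).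
by apply: IH (pf i) => q Uq; apply: derive_eq_on.
Qed.

Lemma Ck_cst k (c : R) : Ck k (cst c).
Proof.
elim: k c => [|k IH] c; (split; first by move=> p _; exact: cst_continuous) => //.
split=> [p i Up|i]; first exact: derivable_cst.
by apply: Ck_eq (IH 0) => q Uq; rewrite /partial derive_cst.
Qed.

Lemma CkS k f : Ck k.+1 f -> Ck k f.
Proof.
elim: k f => [|k IH] f [cf [df pf]]; split=> //.
by split=> // i; apply: IH.
Qed.

Lemma CkD k f g : Ck k f -> Ck k g -> Ck k (f \+ g).
Proof.
elim: k f g => [|k IH] f g [cf df] [cg dg];
  (split; first by move=> p Up; apply: continuousD; [exact: cf|exact: cg]) => //.
case: df dg => df pf [dg pg]; split=> [p i Up|i]; first by apply: derivableD; [exact: df|exact: dg].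
apply: Ck_eq (IH _ _ (pf i) (pg i)) => q Uq.
by rewrite /partial deriveD //; [exact: df|exact: dg].
Qed.

Lemma CkM k f g : Ck k f -> Ck k g -> Ck k (f \* g).
Proof.
elim: k f g => [|k IH] f g Hf Hg; have [cf df] := Hf; have [cg dg] := Hg;
  (split; first by move=> p Up; apply: continuousM; [exact: cf|exact: cg]) => //.
case: df dg => df pf [dg pg]; split=> [p i Up|i]; first by apply: derivableM; [exact: df|exact: dg].
apply: Ck_eq (CkD (IH _ _ (CkS Hf) (pg i)) (IH _ _ (CkS Hg) (pf i))) => q Uq.
by rewrite /partial deriveM //; [exact: df|exact: dg].
Qed.

Lemma CkV k f : (forall p, U p -> f p != 0) -> Ck k f -> Ck k (fun p => (f p)^-1).
Proof.
move=> f0; elim: k f f0 => [|k IH] f f0 Hf; have [cf df] := Hf;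
  (split; first by move=> p Up; apply: continuousV; [exact: f0|exact: cf]) => //.
case: df => df pf; split=> [p i Up|i]; first by apply: derivableV; [exact: f0|exact: df].
have V := IH _ f0 (CkS Hf).
apply: Ck_eq (CkM (CkM (Ck_cst k (-1)) (CkM V V)) (pf i)) => q Uq /=.
rewrite /partial deriveV; [|exact: f0|exact: df].
by rewrite /GRing.scale /= mulN1r expr2 invfM.
Qed.

Lemma smooth_eq f g : (forall q, U q -> f q = g q) -> smooth_on U f -> smooth_on U g.
Proof. by move=> H sf; apply: Ck_smooth => k; apply: Ck_eq H _; exact: smooth_Ck. Qed.

Lemma smooth_cst (c : R) : smooth_on U (fun=> c).
Proof. by apply: Ck_smooth => k; exact: Ck_cst. Qed.

Lemma smoothD f g : smooth_on U f -> smooth_on U g -> smooth_on U (fun p => f p + g p).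
Proof. by move=> sf sg; apply: Ck_smooth => k; apply: CkD; exact: smooth_Ck. Qed.

Lemma smoothM f g : smooth_on U f -> smooth_on U g -> smooth_on U (fun p => f p * g p).
Proof. by move=> sf sg; apply: Ck_smooth => k; apply: CkM; exact: smooth_Ck. Qed.

Lemma smoothN f : smooth_on U f -> smooth_on U (fun p => - f p).
Proof. by move=> sf; apply: smooth_eq (smoothM (smooth_cst (-1)) sf) => q _; rewrite mulN1r. Qed.

Lemma smoothB f g : smooth_on U f -> smooth_on U g -> smooth_on U (fun p => f p - g p).
Proof. by move=> sf sg; apply: smoothD sf (smoothN sg). Qed.

Lemma smoothV f : (forall p, U p -> f p != 0) -> smooth_on U f ->
  smooth_on U (fun p => (f p)^-1).
Proof. by move=> f0 sf; apply: Ck_smooth => k; apply: CkV => //; exact: smooth_Ck. Qed.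

Lemma smooth_sum (I : Type) (s : seq I) (P : pred I) (F : I -> E -> R) :
  (forall i, smooth_on U (F i)) -> smooth_on U (fun p => \sum_(i <- s | P i) F i p).
Proof.
move=> sF; elim: s => [|i s IH].
  by apply: smooth_eq (smooth_cst 0) => q _; rewrite big_nil.
case Pi : (P i); [apply: smooth_eq (smoothD (sF i) IH)|apply: smooth_eq IH] => q _;
  by rewrite big_cons Pi.
Qed.

Lemma smooth_prod (I : Type) (s : seq I) (P : pred I) (F : I -> E -> R) :
  (forall i, smooth_on U (F i)) -> smooth_on U (fun p => \prod_(i <- s | P i) F i p).
Proof.
move=> sF; elim: s => [|i s IH].
  by apply: smooth_eq (smooth_cst 1) => q _; rewrite big_nil.
case Pi : (P i); [apply: smooth_eq (smoothM (sF i) IH)|apply: smooth_eq IH] => q _;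
  by rewrite big_cons Pi.
Qed.

Lemma smooth_partial f i : smooth_on U f -> smooth_on U (partial i f).
Proof. by move=> sf; apply: Ck_smooth => k; have [_ [_]] := smooth_Ck sf k.+1; apply. Qed.

Lemma smooth_continuous f p : smooth_on U f -> U p -> {for p, continuous f}.
Proof. by move=> sf Up; have [] := sf [::] p Up. Qed.

(** Adding one coordinate direction at a time, with [is_deriveDdir]. *)
Lemma smooth_is_derive f p v : smooth_on U f -> U p ->
  is_derive p v f (\sum_i v 0 i * partial i f p).
Proof.
move=> sf; rewrite [v in is_derive _ v]row_sum_delta.
elim: (index_enum _) p => [|i s IH] p Up.
  by rewrite !big_nil; exact: is_derive0.
rewrite !big_cons.
have dp q j : U q -> derivable f q (delta_mx 0 j) by move=> Uq; have [_] := sf [::] q Uq; apply.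
have [di Di] := is_deriveZdir (v 0 i) (dp p i Up).
have [_ Ds] := IH p Up.
have ds q : U q -> derivable f q (\sum_(j <- s) v 0 j *: delta_mx 0 j).
  by move=> Uq; have [] := IH q Uq.
have cs : {for p, continuous ('D_(\sum_(j <- s) v 0 j *: delta_mx 0 j) f)}.
  apply: (continuous_eq_on (f := fun q => \sum_(j <- s) v 0 j * partial j f q)) => //.
    by move=> q Uq; have [_ ->] := IH q Uq.
  apply: smooth_continuous Up; apply: smooth_sum => j; apply: smoothM; first exact: smooth_cst.
  exact: smooth_partial.
have := is_deriveDdir oU Up ds di cs.
by rewrite Ds Di.
Qed.

Lemma smooth_derivable f p v : smooth_on U f -> U p -> derivable f p v.
Proof. by move=> sf Up; have [] := smooth_is_derive v sf Up. Qed.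

Lemma smooth_deriveE f p v : smooth_on U f -> U p ->
  'D_v f p = \sum_i v 0 i * partial i f p.
Proof. by move=> sf Up; have [] := smooth_is_derive v sf Up. Qed.

Lemma smooth_derive f v : smooth_on U f -> smooth_on U ('D_v f).
Proof.
move=> sf; apply: (smooth_eq (f := fun q => \sum_i v 0 i * partial i f q)).
  by move=> q Uq; rewrite smooth_deriveE.
apply: smooth_sum => j; apply: smoothM; first exact: smooth_cst.
exact: smooth_partial.
Qed.

Lemma smooth_derive_swap f p u v : smooth_on U f -> U p ->
  'D_u ('D_v f) p = 'D_v ('D_u f) p.
Proof.
move=> sf Up.
have sd w := smooth_derive w sf; have sdd w w' := smooth_derive w' (sd w).
apply: (derive_swap oU Up).
- by move=> q Uq; exact: smooth_derivable sf Uq.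
- by move=> q Uq; exact: smooth_derivable sf Uq.
- by move=> q Uq; exact: smooth_derivable (sd v) Uq.
- by move=> q Uq; exact: smooth_derivable (sd u) Uq.
- exact: smooth_continuous (sdd v u) Up.
- exact: smooth_continuous (sdd u v) Up.
Qed.

Lemma smooth_deriveM f g v p : smooth_on U f -> smooth_on U g -> U p ->
  'D_v (fun q => f q * g q) p = 'D_v f p * g p + f p * 'D_v g p.
Proof.
move=> sf sg Up.
have e := @deriveM R E f g p v (smooth_derivable sf Up) (smooth_derivable sg Up).
by apply: (etrans e); rewrite /GRing.scale /= addrC; congr (_ + _); exact: mulrC.
Qed.

Lemma smooth_deriveD f g v p : smooth_on U f -> smooth_on U g -> U p ->
  'D_v (fun q => f q + g q) p = 'D_v f p + 'D_v g p.
Proof.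
move=> sf sg Up.
exact: (@deriveD R E _ f g p v (smooth_derivable sf Up) (smooth_derivable sg Up)).
Qed.

End SmoothFunctions.

(** The mean value theorem along segments. *)
Lemma derivative0_ball (R : realType) (m : nat) (f : 'rV[R]_m -> R) (p : 'rV[R]_m) (e : R) :
  (forall q v, `|q - p| < e -> is_derive q v f 0) ->
  forall q, `|q - p| < e -> f q = f p.
Proof.
move=> d0 q qp.
have seg (t : R) : 0 <= t <= 1 -> `|p + t *: (q - p) - p| < e.
  move=> /andP[t0 t1]; rewrite addrC addKr normrZ ger0_norm//.
  by apply: le_lt_trans qp; rewrite ler_piMl.
have [t tI] := directional_MVT (fun t tI => @ex_derive _ _ _ _ _ _ _ (d0 _ (q - p) (seg t tI))).
have [_ ->] := d0 _ (q - p) (seg t tI).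
by rewrite [p + _]addrC subrK => /eqP; rewrite subr_eq0 => /eqP.
Qed.

(** * Smooth matrix fields *)

Section MatrixFields.
Context {R : realType} {m : nat}.
Local Notation E := 'rV[R]_m.
Variable U : set E.
Hypothesis oU : open U.
Implicit Types (p u v : E).

(** Directional derivatives of matrix fields; the definition is locked because
    unification would otherwise unfold limits. *)
Fact dmx_key : unit. Proof. exact: tt. Qed.
Definition dmx k l v (F : E -> 'M[R]_(k, l)) : E -> 'M[R]_(k, l) :=
  fun p => locked_with dmx_key (@derive R E 'M[R]_(k, l)) F p v.
Lemma dmxE k l v (F : E -> 'M[R]_(k, l)) p : dmx v F p = 'D_v F p.
Proof. by rewrite /dmx unlock. Qed.

Section Sized.
Context {k l : nat}.
Implicit Types F G : E -> 'M[R]_(k, l).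

Lemma mxs_derivable F p v : mx_smooth_on U F -> U p -> derivable F p v.
Proof.
move=> sF Up; apply: (derivable_mxP F p v).2 => i j.
exact: (smooth_derivable oU (sF i j) Up).
Qed.

Lemma mxs_deriveE F p v i j : mx_smooth_on U F -> U p ->
  dmx v F p i j = 'D_v (fun q => F q i j) p.
Proof. by move=> sF Up; rewrite dmxE derive_mx ?mxE //; exact: mxs_derivable. Qed.

Lemma mxs_derive F v : mx_smooth_on U F -> mx_smooth_on U (dmx v F).
Proof.
move=> sF i j; apply: (smooth_eq oU) (smooth_derive oU v (sF i j)) => q Uq.
by rewrite mxs_deriveE.
Qed.

Lemma mxs_cst (c : 'M[R]_(k, l)) : mx_smooth_on U (fun=> c).
Proof. by move=> i j; exact: smooth_cst. Qed.

Lemma mxsD F G : mx_smooth_on U F -> mx_smooth_on U G -> mx_smooth_on U (fun q => F q + G q).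
Proof.
move=> sF sG i j; apply: (smooth_eq oU) (smoothD oU (sF i j) (sG i j)) => q _.
by rewrite mxE.
Qed.

Lemma mxsN F : mx_smooth_on U F -> mx_smooth_on U (fun q => - F q).
Proof.
by move=> sF i j; apply: (smooth_eq oU) (smoothN oU (sF i j)) => q _; rewrite mxE.
Qed.

Lemma mxsB F G : mx_smooth_on U F -> mx_smooth_on U G -> mx_smooth_on U (fun q => F q - G q).
Proof. by move=> sF sG; exact: (mxsD sF (mxsN sG)). Qed.

Lemma mxs_tr F : mx_smooth_on U F -> mx_smooth_on U (fun q => (F q)^T).
Proof. by move=> sF i j; apply: (smooth_eq oU) (sF j i) => q _; rewrite mxE. Qed.

Lemma mxs_derive_eq F G p v : U p -> (forall q, U q -> F q = G q) -> dmx v F p = dmx v G p.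
Proof. move=> Up FG; rewrite !dmxE; exact: (near_eq_derive v (near_open oU Up FG)). Qed.

Lemma mxs_deriveD F G p v : mx_smooth_on U F -> mx_smooth_on U G -> U p ->
  dmx v (fun q => F q + G q) p = dmx v F p + dmx v G p.
Proof. move=> sF sG Up; rewrite !dmxE; exact: (deriveD (mxs_derivable sF Up) (mxs_derivable sG Up)). Qed.

Lemma mxs_deriveB F G p v : mx_smooth_on U F -> mx_smooth_on U G -> U p ->
  dmx v (fun q => F q - G q) p = dmx v F p - dmx v G p.
Proof. move=> sF sG Up; rewrite !dmxE; exact: (deriveB (mxs_derivable sF Up) (mxs_derivable sG Up)). Qed.

Lemma mxs_derive_swap F p u v : mx_smooth_on U F -> U p ->
  dmx u (dmx v F) p = dmx v (dmx u F) p.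
Proof.
move=> sF Up; apply/matrixP => i j.
have e1 := mxs_deriveE u i j (mxs_derive v sF) Up.
have e2 := mxs_deriveE v i j (mxs_derive u sF) Up.
have e3 w q : U q -> dmx w F q i j = 'D_w (fun q => F q i j) q by exact: mxs_deriveE.
have e4 w w' : 'D_w (fun q => dmx w' F q i j) p = 'D_w ('D_w' (fun q => F q i j)) p.
  exact: (derive_eq_on oU w Up (e3 w')).
have e5 := smooth_derive_swap oU u v (sF i j) Up.
exact: (etrans e1 (etrans (e4 u v) (etrans e5 (esym (etrans e2 (e4 v u)))))).
Qed.

Lemma mxs_derive_linear F p : mx_smooth_on U F -> U p -> linear (fun v => dmx v F p).
Proof.
move=> sF Up a u v; apply/matrixP => i j.
have e w : dmx w F p i j = \sum_h w 0 h * partial h (fun q => F q i j) p.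
  exact: etrans (mxs_deriveE w i j sF Up) (smooth_deriveE oU w (sF i j) Up).
rewrite [RHS]mxE [X in _ = X + _]mxE.
apply: (etrans (e (a *: u + v))).
apply: (etrans _ (esym (congr2 (fun s t => a * s + t) (e u) (e v)))).
rewrite mulr_sumr -big_split.
by apply: eq_bigr => h _ /=; rewrite !mxE; ring.
Qed.

End Sized.

Lemma mxs_mul k l n (F : E -> 'M[R]_(k, l)) (G : E -> 'M[R]_(l, n)) :
  mx_smooth_on U F -> mx_smooth_on U G -> mx_smooth_on U (fun q => F q *m G q).
Proof.
move=> sF sG i j; apply: (smooth_eq oU (f := fun q => \sum_h F q i h * G q h j)).
  by move=> q _; rewrite mxE.
by apply: (smooth_sum oU) => h; apply: (smoothM oU).
Qed.

Lemma mxs_deriveM k l n (F : E -> 'M[R]_(k, l)) (G : E -> 'M[R]_(l, n)) p v :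
  mx_smooth_on U F -> mx_smooth_on U G -> U p ->
  dmx v (fun q => F q *m G q) p = dmx v F p *m G p + F p *m dmx v G p.
Proof.
move=> sF sG Up; apply/matrixP => i j; rewrite mxs_deriveE //; last exact: mxs_mul.
rewrite !mxE -big_split /=.
transitivity ('D_v (\sum_(h < l) (fun q => F q i h * G q h j)) p).
  by apply: (derive_eq_on oU) => // q _; rewrite mxE fct_sumE.
rewrite derive_sum; last by move=> h; apply: (smooth_derivable oU) => //; exact: smoothM.
apply: eq_bigr => h _; rewrite !mxs_deriveE //.
rewrite deriveM; [|exact: (smooth_derivable oU)|exact: (smooth_derivable oU)].
by rewrite /GRing.scale /= addrC; congr (_ + _); rewrite mulrC.
Qed.

Lemma mxs_derive_cst k l (c : 'M[R]_(k, l)) p v : dmx v (fun=> c) p = 0.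
Proof. rewrite dmxE; exact: derive_cst. Qed.

Lemma mxs_derive_tr k l (F : E -> 'M[R]_(k, l)) p v : mx_smooth_on U F -> U p ->
  dmx v (fun q => (F q)^T) p = (dmx v F p)^T.
Proof.
move=> sF Up; apply/matrixP => i j; rewrite mxE !mxs_deriveE //; last exact: mxs_tr.
by apply: (derive_eq_on oU) => // q _; rewrite mxE.
Qed.

Lemma mxs_det k (F : E -> 'M[R]_k) : mx_smooth_on U F -> smooth_on U (fun q => \det (F q)).
Proof.
move=> sF; rewrite /determinant; apply: (smooth_sum oU) => s.
apply: (smoothM oU); first exact: smooth_cst.
by apply: (smooth_prod oU) => i; exact: sF.
Qed.

Lemma mxs_inv k (F : E -> 'M[R]_k) : (forall q, U q -> F q \in unitmx) ->
  mx_smooth_on U F -> mx_smooth_on U (fun q => invmx (F q)).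
Proof.
move=> uF sF i j; apply: (smooth_eq oU (f := fun q => (\det (F q))^-1 * cofactor (F q) j i)).
  by move=> q Uq; rewrite /invmx uF // !mxE.
apply: (smoothM oU).
  apply: (smoothV oU); last exact: mxs_det.
  by move=> q /uF; rewrite unitmxE unitfE.
apply: (smoothM oU); first exact: smooth_cst.
by apply: mxs_det => a b; apply: (smooth_eq oU) (sF (lift j a) (lift i b)) => q _; rewrite !mxE.
Qed.

End MatrixFields.

(** * The Levi-Civita connection in a chart *)

Section Bil.
Context {R : realType} {m : nat}.
Implicit Types (G A : 'M[R]_m) (u v x y : 'rV[R]_m).

Lemma bilE G x y : bil G x y = (x *m G *m y^T) 0 0. Proof. by []. Qed.
Lemma bilDl G x y v : bil G (x + y) v = bil G x v + bil G y v.
Proof. by rewrite /bil !mulmxDl mxE. Qed.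
Lemma bilZl G a x v : bil G (a *: x) v = a * bil G x v.
Proof. by rewrite /bil -!scalemxAl mxE. Qed.
Lemma bilDr G x y v : bil G v (x + y) = bil G v x + bil G v y.
Proof. by rewrite /bil linearD mulmxDr mxE. Qed.
Lemma bilZr G a x v : bil G v (a *: x) = a * bil G v x.
Proof. by rewrite /bil linearZ -!scalemxAr mxE. Qed.
Lemma bilNl G x v : bil G (- x) v = - bil G x v.
Proof. by rewrite -scaleN1r bilZl mulN1r. Qed.
Lemma bilNr G x v : bil G v (- x) = - bil G v x.
Proof. by rewrite -scaleN1r bilZr mulN1r. Qed.
Lemma bil_scalar G v : scalar (fun x => bil G x v).
Proof. by move=> a x y; rewrite bilDl bilZl. Qed.
Lemma bilDm G A x y : bil (G + A) x y = bil G x y + bil A x y.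
Proof. by rewrite /bil mulmxDr mulmxDl mxE. Qed.
Lemma bilZm a G x y : bil (a *: G) x y = a * bil G x y.
Proof. by rewrite /bil -scalemxAr -scalemxAl mxE. Qed.
Lemma bilMl A G x y : bil (A *m G) x y = bil G (x *m A) y.
Proof. by rewrite /bil !mulmxA. Qed.
Lemma bilMr A G x y : bil (G *m A^T) x y = bil G x (y *m A).
Proof. by rewrite /bil trmx_mul !mulmxA. Qed.
Lemma bil_delta G i j : bil G (delta_mx 0 i) (delta_mx 0 j) = G i j.
Proof. by rewrite /bil -rowE trmx_delta -colE !mxE. Qed.
Lemma bil_inj_mx G A : (forall x y, bil G x y = bil A x y) -> G = A.
Proof. by move=> h; apply/matrixP => i j; rewrite -!bil_delta h. Qed.
Lemma bil_tr G x y : bil G^T x y = bil G y x.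
Proof.
have e : x *m G^T *m y^T = (y *m G *m x^T)^T by rewrite !trmx_mul trmxK mulmxA.
by rewrite /bil e mxE.
Qed.
Lemma bil_sum G x y : bil G x y = \sum_l bil G x (delta_mx 0 l) * y 0 l.
Proof.
rewrite {1}[y]row_sum_delta; elim/big_rec2: _ => [|l a b _ <-].
  by have := bilZr G 0 0 x; rewrite scale0r mul0r.
by rewrite bilDr bilZr mulrC.
Qed.
End Bil.

Section Connection.
Context {R : realType} {m : nat}.
Local Notation E := 'rV[R]_m.
Variable U : set E.
Hypothesis oU : open U.
Variable g : E -> 'M[R]_m.
Hypothesis sg : mx_smooth_on U g.
Hypothesis gsym : forall p, U p -> forall u v, bil (g p) u v = bil (g p) v u.
Hypothesis gpos : forall p, U p -> forall u, u != 0 -> 0 < bil (g p) u u.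
Implicit Types (p q u v w x y z : E).

(** The matrix of the Levi-Civita connection in the direction [v], acting on row
    vectors. *)
Definition conn v p : 'M[R]_m := \matrix_(j, k) \sum_i christoffel g k i j p * v 0 i.

Lemma nablaE v (X : E -> E) p : nabla g (cst v) X p = dmx v X p + X p *m conn v p.
Proof.
rewrite /nabla /cst dmxE; congr (_ + _); apply/rowP => k; rewrite !mxE exchange_big /=.
apply: eq_bigr => j _; rewrite !mxE mulr_sumr.
by apply: eq_bigr => i _; ring.
Qed.

Lemma metric_tr p : U p -> (g p)^T = g p.
Proof. by move=> Up; apply/matrixP => i j; rewrite mxE -!bil_delta gsym. Qed.

Lemma metric_unitmx p : U p -> g p \in unitmx.
Proof.
move=> Up; rewrite -row_free_unit -kermx_eq0; apply/eqP/eqP; rewrite -[_ == _]negbK.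
apply/negP => /rowV0Pn[v /sub_kermxP vg v0].
by have := gpos Up v0; rewrite bilE vg mul0mx mxE ltxx.
Qed.

Lemma bil_inj p x y : U p -> (forall z, bil (g p) x z = bil (g p) y z) -> x = y.
Proof.
move=> Up h; apply/eqP; rewrite -subr_eq0; apply/negPn/negP => /(gpos Up).
by rewrite bilDl bilNl h subrr ltxx.
Qed.

Lemma smooth_christoffel k i j : smooth_on U (christoffel g k i j).
Proof.
apply: (smoothM oU); first exact: smooth_cst.
apply: (smooth_sum oU) => l; apply: (smoothM oU).
  by apply: (mxs_inv oU) => // p; exact: metric_unitmx.
by apply: (smoothB oU); [apply: (smoothD oU)|]; exact: smooth_partial.
Qed.

Lemma smooth_conn v : mx_smooth_on U (conn v).
Proof.
move=> j k; apply: (smooth_eq oU (f := fun p => \sum_i christoffel g k i j p * v 0 i)).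
  by move=> q _; rewrite mxE.
apply: (smooth_sum oU) => i; apply: (smoothM oU); first exact: smooth_christoffel.
exact: smooth_cst.
Qed.

(** The Christoffel symbols are Koszul's formula for coordinate vector fields;
    here it is in invariant form, for fields with constant components.  Symmetry
    of the connection and compatibility with the metric are read off from it. *)
Lemma koszul p v x y : U p -> bil (g p) (x *m conn v p) y =
  2^-1 * (bil (dmx v g p) x y + bil (dmx x g p) v y - bil (dmx y g p) v x).
Proof.
move=> Up.
pose K : E := \row_l (bil (dmx v g p) x (delta_mx 0 l) + bil (dmx x g p) v (delta_mx 0 l)
   - bil (dmx (delta_mx 0 l) g p) v x).
have dg w i j : (dmx w g p) i j = \sum_h w 0 h * partial h (fun q => g q i j) p.
  exact: etrans (mxs_deriveE oU w i j sg Up) (smooth_deriveE oU w (sg i j) Up).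
pose a i j l := partial i (fun q => g q j l) p + partial j (fun q => g q i l) p
   - partial l (fun q => g q i j) p.
have bE (w b : E) (l : 'I_m) : bil (dmx w g p) b (delta_mx 0 l) =
    \sum_j \sum_i b 0 j * (w 0 i * partial i (fun q => g q j l) p).
  rewrite bilE trmx_delta -colE !mxE.
  by apply: eq_bigr => j _; rewrite dg mulr_sumr.
have KE l : K 0 l = \sum_j \sum_i (v 0 i * x 0 j) * a i j l.
  rewrite mxE !bE [X in _ + X - _]exchange_big -big_split.
  have -> : bil (dmx (delta_mx 0 l) g p) v x =
      \sum_j \sum_i (v 0 i * x 0 j) * partial l (fun q => g q i j) p.
    rewrite bil_sum; apply: eq_bigr => j _; rewrite bilE trmx_delta -colE !mxE mulr_suml.
    apply: eq_bigr => i _; rewrite (mxs_deriveE oU _ i j sg Up) -/(partial _ _ _).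
    by rewrite mulrAC.
  rewrite -sumrB; apply: eq_bigr => j _; rewrite -big_split -sumrB /=.
  by apply: eq_bigr => i _; rewrite /a; ring.
have invC k l : invmx (g p) l k = invmx (g p) k l.
  by rewrite -{1}(metric_tr Up) -trmx_inv mxE.
have connE : x *m conn v p = 2^-1 *: (K *m invmx (g p)).
  apply/rowP => k; rewrite !mxE.
  under [in RHS]eq_bigr do rewrite KE.
  transitivity (\sum_j \sum_i \sum_l 2^-1 * ((v 0 i * x 0 j) * a i j l * invmx (g p) k l)).
    apply: eq_bigr => j _; rewrite mxE mulr_sumr; apply: eq_bigr => i _.
    rewrite /christoffel !mulr_sumr mulr_suml mulr_sumr; apply: eq_bigr => l _.
    by rewrite /a; ring.
  rewrite mulr_sumr; under [RHS]eq_bigr do rewrite mulr_suml mulr_sumr.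
  rewrite [RHS]exchange_big; apply: eq_bigr => j _ /=.
  under [RHS]eq_bigr do rewrite mulr_suml mulr_sumr.
  rewrite [RHS]exchange_big; apply: eq_bigr => i _ /=.
  by apply: eq_bigr => l _; rewrite invC.
rewrite connE bilZl; congr (_ * _).
have -> : bil (g p) (K *m invmx (g p)) y = \sum_l K 0 l * y 0 l.
  rewrite bilE mulmxKV; last exact: metric_unitmx.
  by rewrite mxE; apply: eq_bigr => l _; rewrite [y^T l 0]mxE.
have -> : dmx y g p = \sum_l y 0 l *: dmx (delta_mx 0 l) g p.
  apply/matrixP => i j; rewrite dg summxE; apply: eq_bigr => l _.
  by rewrite mxE (mxs_deriveE oU _ i j sg Up).
have -> : bil (\sum_l y 0 l *: dmx (delta_mx 0 l) g p) v x =
    \sum_l bil (dmx (delta_mx 0 l) g p) v x * y 0 l.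
  elim/big_rec2: _ => [|l b c _ <-]; first by rewrite bilE mulmx0 mul0mx mxE.
  by rewrite bilDm bilZm mulrC.
have key (A B : 'M[R]_m) (C : 'I_m -> 'M[R]_m) :
    \sum_l (bil A x (delta_mx 0 l) + bil B v (delta_mx 0 l) - bil (C l) v x) * y 0 l
    = bil A x y + bil B v y - \sum_l bil (C l) v x * y 0 l.
  rewrite (bil_sum _ x y) (bil_sum _ v y) -big_split -sumrB.
  by apply: eq_bigr => l _ /=; ring.
apply: etrans (key (dmx v g p) (dmx x g p) (fun l => dmx (delta_mx 0 l) g p)).
by apply: eq_bigr => l _; rewrite [K 0 l]mxE.
Qed.

Lemma derive_g_sym p v x y : U p -> bil (dmx v g p) x y = bil (dmx v g p) y x.
Proof.
move=> Up; have h := etrans (esym (mxs_derive_tr oU v sg Up)) (mxs_derive_eq oU v Up metric_tr).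
exact: (etrans (esym (congr1 (fun G => bil G x y) h)) (bil_tr _ x y)).
Qed.

Lemma torsion_free p v x : U p -> x *m conn v p = v *m conn x p.
Proof.
move=> Up; apply: (bil_inj Up) => y; rewrite (koszul v x y Up) (koszul x v y Up) (derive_g_sym y v x Up).
by rewrite [X in _ = _ * (X - _)]addrC.
Qed.

Lemma derive_g p v : U p -> dmx v g p = conn v p *m g p + g p *m (conn v p)^T.
Proof.
move=> Up; apply: bil_inj_mx => x y; rewrite bilDm bilMl bilMr.
rewrite (gsym Up x) (koszul v x y Up) (koszul v y x Up).
rewrite (derive_g_sym v y x Up) (derive_g_sym y v x Up) (derive_g_sym x v y Up).
move: (bil (dmx v g p) x y) (bil (dmx x g p) y v) (bil (dmx y g p) x v) => a b c.
by field.
Qed.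

(** ** Covariant derivatives of fields of endomorphisms *)
(* unlike [mxE], these do not expand matrix products into sums *)
Lemma mxaddE k l (A B : 'M[R]_(k, l)) i j : (A + B) i j = A i j + B i j.
Proof. by rewrite mxE. Qed.
Lemma mxoppE k l (A : 'M[R]_(k, l)) i j : (- A) i j = - A i j.
Proof. by rewrite mxE. Qed.

Local Notation mulE := (mulmxDl, mulmxDr, mulmxN, mulNmx, mulmxA, opprD, opprK).
Local Ltac mxring := rewrite ?mulE; apply/matrixP => ? ?; rewrite ?(mxaddE, mxoppE); ring.

Definition cov v (F : E -> 'M[R]_m) : E -> 'M[R]_m :=
  fun q => dmx v F q + (F q *m conn v q - conn v q *m F q).

(** The curvature operator of [u] and [v].  Matrices act on row vectors, so the
    quadratic terms are in the opposite of the usual order. *)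
Definition Om u v : E -> 'M[R]_m := fun q =>
  (dmx u (conn v) q - dmx v (conn u) q) + (conn v q *m conn u q - conn u q *m conn v q).

Let sc := smooth_conn.

Lemma smooth_cov v F : mx_smooth_on U F -> mx_smooth_on U (cov v F).
Proof.
move=> sF; apply: (mxsD oU); first exact: mxs_derive.
exact: (mxsB oU (mxs_mul oU sF (sc v)) (mxs_mul oU (sc v) sF)).
Qed.

Lemma smooth_Om u v : mx_smooth_on U (Om u v).
Proof.
apply: (mxsD oU); first exact: (mxsB oU (mxs_derive oU u (sc v)) (mxs_derive oU v (sc u))).
exact: (mxsB oU (mxs_mul oU (sc v) (sc u)) (mxs_mul oU (sc u) (sc v))).
Qed.

Lemma cov_eq v F G p : U p -> (forall q, U q -> F q = G q) -> cov v F p = cov v G p.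
Proof. by move=> Up FG; rewrite /cov (FG p Up) (mxs_derive_eq oU v Up FG). Qed.

Lemma covM v F G p : mx_smooth_on U F -> mx_smooth_on U G -> U p ->
  cov v (fun q => F q *m G q) p = cov v F p *m G p + F p *m cov v G p.
Proof.
move=> sF sG Up; rewrite /cov (mxs_deriveM oU v sF sG Up).
move: (dmx v F p) (dmx v G p) (F p) (G p) (conn v p) => A B C D K.
mxring.
Qed.

Lemma covD v F G p : mx_smooth_on U F -> mx_smooth_on U G -> U p ->
  cov v (fun q => F q + G q) p = cov v F p + cov v G p.
Proof.
move=> sF sG Up; rewrite /cov (mxs_deriveD oU v sF sG Up).
move: (dmx v F p) (dmx v G p) (F p) (G p) (conn v p) => A B C D K.
mxring.
Qed.

Lemma cov_scalar v a p : cov v (fun=> a%:M) p = 0.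
Proof. by rewrite /cov mxs_derive_cst scalar_mxC subrr addr0. Qed.

(** The Ricci identity: second derivatives of [F] commute, and there is no
    bracket term for constant fields. *)
Lemma ricci u v F p : mx_smooth_on U F -> U p ->
  cov u (cov v F) p - cov v (cov u F) p = F p *m Om u v p - Om u v p *m F p.
Proof.
move=> sF Up.
have s1 a := mxs_mul oU sF (sc a).
have s2 a := mxs_mul oU (sc a) sF.
have e a b : dmx a (cov b F) p = dmx a (dmx b F) p +
   ((dmx a F p *m conn b p + F p *m dmx a (conn b) p)
   - (dmx a (conn b) p *m F p + conn b p *m dmx a F p)).
  rewrite (mxs_deriveD oU a (mxs_derive oU b sF) (mxsB oU (s1 b) (s2 b)) Up).
  rewrite (mxs_deriveB oU a (s1 b) (s2 b) Up).
  by rewrite (mxs_deriveM oU a sF (sc b) Up) (mxs_deriveM oU a (sc b) sF Up).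
rewrite [cov u _ p]/cov [cov v (cov u F) p]/cov !e (mxs_derive_swap oU u v sF Up) /cov /Om.
move: (dmx v (dmx u F) p) (dmx u F p) (dmx v F p) (F p) (conn u p) (conn v p)
  (dmx u (conn v) p) (dmx v (conn u) p) => A B C D K L M N.
mxring.
Qed.

Lemma Om_skew u v p : Om v u p = - Om u v p.
Proof. by rewrite /Om opprD !opprB. Qed.

(** The second Bianchi identity: constant fields commute, so it is the Jacobi
    identity for the three covariant derivatives. *)
Lemma cov_Om_cyclic u v w p : U p ->
  cov w (Om u v) p + cov u (Om v w) p + cov v (Om w u) p = 0.
Proof.
move=> Up.
have sd a b := mxs_derive oU a (sc b).
have sm a b := mxs_mul oU (sc a) (sc b).
have e a b c : dmx c (Om a b) p = (dmx c (dmx a (conn b)) p - dmx c (dmx b (conn a)) p) +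
  ((dmx c (conn b) p *m conn a p + conn b p *m dmx c (conn a) p)
   - (dmx c (conn a) p *m conn b p + conn a p *m dmx c (conn b) p)).
  rewrite (mxs_deriveD oU c (mxsB oU (sd a b) (sd b a)) (mxsB oU (sm b a) (sm a b)) Up).
  rewrite (mxs_deriveB oU c (sd a b) (sd b a) Up) (mxs_deriveB oU c (sm b a) (sm a b) Up).
  by rewrite (mxs_deriveM oU c (sc a) (sc b) Up) (mxs_deriveM oU c (sc b) (sc a) Up).
rewrite /cov !e (mxs_derive_swap oU w u (sc v) Up) (mxs_derive_swap oU w v (sc u) Up).
rewrite (mxs_derive_swap oU u v (sc w) Up) /Om.
move: (dmx u (dmx w (conn v)) p) (dmx v (dmx w (conn u)) p) (dmx v (dmx u (conn w)) p) => A B C.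
move: (dmx u (conn v) p) (dmx v (conn u) p) (dmx u (conn w) p) (dmx w (conn u) p)
  (dmx v (conn w) p) (dmx w (conn v) p) (conn u p) (conn v p) (conn w p) => D E F G H I K L M.
rewrite ?mulE; apply/matrixP => ? ?; rewrite ?(mxaddE, mxoppE) [RHS]mxE.
ring.
Qed.

(** Second derivatives of the metric commute. *)
Lemma Om_metric u v p : U p -> Om u v p *m g p + g p *m (Om u v p)^T = 0.
Proof.
move=> Up.
have e a b : dmx a (dmx b g) p = dmx a (conn b) p *m g p + conn b p *m dmx a g p
   + (dmx a g p *m (conn b p)^T + g p *m (dmx a (conn b) p)^T).
  have s1 := mxs_mul oU (sc b) sg.
  have s2 := mxs_tr oU (sc b).
  have s3 := mxs_mul oU sg s2.
  rewrite (mxs_derive_eq oU a Up (fun q Uq => derive_g b Uq)).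
  rewrite (mxs_deriveD oU a s1 s3 Up) (mxs_deriveM oU a (sc b) sg Up).
  by rewrite (mxs_deriveM oU a sg s2 Up) (mxs_derive_tr oU a (sc b) Up).
have := mxs_derive_swap oU u v sg Up; rewrite !e !derive_g // /Om => /eqP.
rewrite -subr_eq0 => /eqP h; rewrite -[RHS]h.
have trD (A B : 'M[R]_m) : (A + B)^T = A^T + B^T by exact: linearD.
have trN (A : 'M[R]_m) : (- A)^T = - A^T by exact: linearN.
rewrite !(trD, trN, trmx_mul).
move: (dmx u (conn v) p) (dmx v (conn u) p) (conn u p) (conn v p) (g p) => A B C D K.
move: (A^T) (B^T) (C^T) (D^T) => A' B' C' D'.
mxring.
Qed.

(** The first Bianchi identity, from the symmetry of the connection. *)
Lemma Om_cyclic x u v p : U p -> x *m Om u v p + u *m Om v x p + v *m Om x u p = 0.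
Proof.
move=> Up.
have e a b c : a *m dmx b (conn c) p = c *m dmx b (conn a) p.
  have h t s : dmx b (fun q => t *m conn s q) p = t *m dmx b (conn s) p.
    by rewrite (mxs_deriveM oU b (mxs_cst oU t) (sc s) Up) mxs_derive_cst mul0mx add0r.
  by rewrite -!h; apply: (mxs_derive_eq oU b Up) => q; exact: torsion_free.
rewrite /Om !mulmxDr !mulmxN !mulmxA (e x u v) (e x v u) (e u x v).
rewrite (torsion_free v x Up) (torsion_free u x Up) (torsion_free u v Up).
apply/rowP => k; rewrite ?(mxaddE, mxoppE) [RHS]mxE; ring.
Qed.

Lemma conn_linear_l a u v p : conn (a *: u + v) p = a *: conn u p + conn v p.
Proof.
apply/matrixP => j k; rewrite !mxE mulr_sumr -big_split.
by apply: eq_bigr => i _; rewrite !mxE /=; ring.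
Qed.

Lemma derive_conn_linear a u v w p : U p ->
  dmx w (conn (a *: u + v)) p = a *: dmx w (conn u) p + dmx w (conn v) p.
Proof.
move=> Up; rewrite (mxs_derive_eq oU w Up (fun q _ => conn_linear_l a u v q)).
have e : forall q, U q -> a *: conn u q + conn v q = a%:M *m conn u q + conn v q.
  by move=> q _; rewrite mul_scalar_mx.
have s1 := mxs_mul oU (mxs_cst oU a%:M) (sc u).
rewrite (mxs_derive_eq oU w Up e) (mxs_deriveD oU w s1 (sc v) Up).
rewrite (mxs_deriveM oU w (mxs_cst oU a%:M) (sc u) Up) mxs_derive_cst mul0mx add0r.
by rewrite mul_scalar_mx.
Qed.

Lemma Om_linear a u v w p : U p -> Om (a *: u + v) w p = a *: Om u w p + Om v w p.
Proof.
move=> Up; rewrite /Om derive_conn_linear // (mxs_derive_linear oU (sc w) Up) conn_linear_l.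
rewrite mulmxDl mulmxDr -scalemxAl -scalemxAr !scalerDr !scalerN.
apply/matrixP => i j; rewrite ?(mxaddE, mxoppE); ring.
Qed.

Lemma cov_linear a u v F p : mx_smooth_on U F -> U p ->
  cov (a *: u + v) F p = a *: cov u F p + cov v F p.
Proof.
move=> sF Up; rewrite /cov (mxs_derive_linear oU sF Up) conn_linear_l.
rewrite mulmxDl mulmxDr -scalemxAl -scalemxAr !scalerDr !scalerN.
apply/matrixP => i j; rewrite ?(mxaddE, mxoppE); ring.
Qed.

Definition Riem p x y z u := bil (g p) (z *m Om x y p) u.

Lemma Riem_curvature_like p : U p -> curvature_like (Riem p).
Proof.
move=> Up; split.
- move=> y z u a x x'; rewrite /Riem Om_linear // mulmxDr -scalemxAr.
  by rewrite bilDl bilZl.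
- move=> x y u a z z'; rewrite /Riem mulmxDl -scalemxAl.
  by rewrite bilDl bilZl.
- by move=> x y z u; rewrite /Riem Om_skew mulmxN bilNl.
- move=> x y z u; apply/eqP; rewrite -subr_eq0 opprK /Riem; apply/eqP.
  rewrite (gsym Up (u *m _)) -bilMl -bilMr -bilDm Om_metric //.
  by rewrite bilE mulmx0 mul0mx mxE.
- move=> x y z u; rewrite /Riem -!bilDl addrAC [X in bil _ X _](_ : _ = 0).
    by rewrite bilE !mul0mx mxE.
  by rewrite -(Om_cyclic z x y Up) addrAC.
Qed.

Lemma curvE_const u v (X : E -> E) p : mx_smooth_on U X -> U p ->
  curv g (cst u) (cst v) X p = X p *m Om u v p.
Proof.
move=> sX Up.
have s1 a := mxs_mul oU sX (sc a).
have fE a : nabla g (cst a) X = (fun q => dmx a X q + X q *m conn a q).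
  by apply/funext => q; rewrite nablaE.
have e a b : nabla g (cst a) (nabla g (cst b) X) p = dmx a (dmx b X) p +
  (dmx a X p *m conn b p + X p *m dmx a (conn b) p) + (dmx b X p + X p *m conn b p) *m conn a p.
  rewrite fE nablaE (mxs_deriveD oU a (mxs_derive oU b sX) (s1 b) Up).
  by rewrite (mxs_deriveM oU a sX (sc b) Up).
have l0 : nabla g (lie (cst u) (cst v)) X p = 0.
  have -> : nabla g (lie (cst u) (cst v)) X p = nabla g (cst (lie (cst u) (cst v) p)) X p by [].
  rewrite nablaE dmxE /lie !derive_cst subrr derive0 add0r.
  have := conn_linear_l (-1) 0 0 p; rewrite scaler0 addr0 scaleN1r addNr => ->.
  exact: mulmx0.
rewrite /curv l0 subr0 !e (mxs_derive_swap oU u v sX Up) /Om.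
move: (dmx v (dmx u X) p) (dmx u X p) (dmx v X p) (X p) (conn u p) (conn v p)
  (dmx u (conn v) p) (dmx v (conn u) p) => A B C D K L M N.
rewrite ?mulE; apply/rowP => k; rewrite ?(mxaddE, mxoppE); ring.
Qed.

Lemma smooth_bil F x y : mx_smooth_on U F -> smooth_on U (fun q => bil (F q) x y).
Proof.
by move=> sF; exact: (mxs_mul oU (mxs_mul oU (mxs_cst oU x) sF) (mxs_cst oU y^T)).
Qed.

Lemma derive_bil F x y v p : mx_smooth_on U F -> U p ->
  'D_v (fun q => bil (F q) x y) p = bil (dmx v F p) x y.
Proof.
move=> sF Up; have s1 := mxs_mul oU (mxs_cst oU x) sF.
have e := mxs_deriveM oU v s1 (mxs_cst oU y^T) Up.
rewrite -(mxs_deriveE oU v 0 0 (mxs_mul oU s1 (mxs_cst oU y^T)) Up) e.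
rewrite (mxs_deriveM oU v (mxs_cst oU x) sF Up) !mxs_derive_cst.
by rewrite mul0mx add0r mulmx0 addr0.
Qed.

Lemma derive_bil_end F x y v p : mx_smooth_on U F -> U p ->
  'D_v (fun q => bil (g q) (x *m F q) y) p = bil (g p) (x *m cov v F p) y
   + bil (g p) (x *m conn v p *m F p) y + bil (g p) (x *m F p) (y *m conn v p).
Proof.
move=> sF Up.
have -> : (fun q => bil (g q) (x *m F q) y) = (fun q => bil (F q *m g q) x y).
  by apply/funext => q; rewrite bilMl.
rewrite (derive_bil x y v (mxs_mul oU sF sg) Up) (mxs_deriveM oU v sF sg Up) (derive_g v Up).
rewrite mulmxDr !mulmxA !bilDm bilMr !bilMl /cov.
rewrite !mulmxDr mulmxN !mulmxA !bilDl bilNl.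
move: (bil _ _ _) (bil _ _ _) (bil _ _ _) (bil _ _ _) => a b c d.
by ring.
Qed.

Section AlmostComplex.
Variable J : E -> 'M[R]_m.
Hypothesis sJ : mx_smooth_on U J.
Hypothesis J_sq : forall p, U p -> J p *m J p = - 1%:M.
Hypothesis J_iso : forall p, U p -> forall u v,
  bil (g p) (u *m J p) (v *m J p) = bil (g p) u v.

Lemma hermitian_at p : U p -> hermitian_form (bil (g p)) (mulmx^~ (J p)).
Proof.
move=> Up; split.
- exact: bil_scalar.
- exact: gsym.
- exact: gpos.
- by move=> a x y; rewrite mulmxDl scalemxAl.
- by move=> x; rewrite -mulmxA J_sq // mulmxN mulmx1.
- exact: J_iso.
Qed.

Lemma bilJ p x y : U p -> bil (g p) (x *m J p) y = - bil (g p) x (y *m J p).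
Proof.
by move=> Up; rewrite -(J_iso Up (x *m J p) y) -mulmxA J_sq // mulmxN mulmx1 bilNl.
Qed.

(** The covariant derivative of the constant field [J *m J]. *)
Lemma cov_J_anticomm v p : U p -> cov v J p *m J p = - (J p *m cov v J p).
Proof.
move=> Up; apply/eqP; rewrite -addr_eq0 -(covM v sJ sJ Up).
rewrite (cov_eq v (G := fun=> (-1)%:M) Up); first by rewrite cov_scalar.
by move=> q Uq; rewrite J_sq // rmorphN.
Qed.

Lemma nabla_acsE V X p : mx_smooth_on U X -> U p ->
  nabla_acs g J V X p = X p *m cov (V p) J p.
Proof.
move=> sX Up; rewrite /nabla_acs.
have e Y : nabla g V Y p = nabla g (cst (V p)) Y p by [].
rewrite !e !nablaE (mxs_deriveM oU (V p) sX sJ Up) /cov.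
move: (dmx (V p) X p) (dmx (V p) J p) (X p) (J p) (conn (V p) p) => A B C D K.
rewrite ?mulE; apply/rowP => k; rewrite ?(mxaddE, mxoppE); ring.
Qed.

Lemma nabla_kformE v x y p : U p ->
  nabla_kform g J (cst v) (cst x) (cst y) p = bil (g p) (x *m cov v J p) y.
Proof.
move=> Up; rewrite /nabla_kform.
have e z : nabla g (cst v) (cst z) p = z *m conn v p.
  by rewrite nablaE mxs_derive_cst add0r.
rewrite /kform !e (derive_bil_end x y v sJ Up).
by move: (bil _ _ _) (bil _ _ _) (bil _ _ _) => a b c; ring.
Qed.

Lemma phi_skew v x y p : U p ->
  bil (g p) (x *m cov v J p) y = - bil (g p) (y *m cov v J p) x.
Proof.
move=> Up; have h q : U q -> bil (g q) (x *m J q) y = -1 * bil (g q) (y *m J q) x.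
  by move=> Uq; rewrite bilJ // (gsym Uq x) mulN1r.
have s z w : smooth_on U (fun q => bil (g q) (z *m J q) w).
  apply: (smooth_eq oU) (smooth_bil z w (mxs_mul oU sJ sg)) => q _.
  by rewrite bilMl.
have := derive_eq_on oU v Up h.
rewrite (derive_bil_end x y v sJ Up).
have -> : 'D_v (fun q => -1 * bil (g q) (y *m J q) x) p = -1 * 'D_v (fun q => bil (g q) (y *m J q) x) p.
  by apply: deriveZ; exact: (smooth_derivable oU (s y x) Up).
rewrite (derive_bil_end y x v sJ Up) (bilJ _ _ Up) (gsym Up (x *m conn v p)).
rewrite (bilJ x _ Up) (gsym Up x (y *m conn v p *m J p)).
move: (bil _ _ _) (bil _ _ _) (bil _ _ _) (bil _ _ _) => a b c d; lra.
Qed.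

End AlmostComplex.

End Connection.

(** * The curvature identities in a chart *)

Section Local.
Context {R : realType} {m : nat}.
Local Notation E := 'rV[R]_m.
Variable U : set E.
Hypothesis oU : open U.
Variables g J : E -> 'M[R]_m.
Hypothesis sg : mx_smooth_on U g.
Hypothesis gsym : forall p, U p -> forall u v, bil (g p) u v = bil (g p) v u.
Hypothesis gpos : forall p, U p -> forall u, u != 0 -> 0 < bil (g p) u u.
Hypothesis sJ : mx_smooth_on U J.
Hypothesis J_sq : forall p, U p -> J p *m J p = - 1%:M.
Hypothesis J_iso : forall p, U p -> forall u v,
  bil (g p) (u *m J p) (v *m J p) = bil (g p) u v.
Hypothesis kform_closed : forall p, U p -> forall v x y,
  bil (g p) (x *m cov g v J p) y + bil (g p) (y *m cov g x J p) v
  + bil (g p) (v *m cov g y J p) x = 0.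
Variable nu : E -> R.
Hypothesis snu : smooth_on U nu.
Hypothesis antihol : forall p, U p -> forall x y, bil (g p) (x *m J p) y = 0 ->
  Riem g p x y y x = nu p * (bil (g p) x x * bil (g p) y y - bil (g p) x y ^+ 2).
Implicit Types (p q u v w x y z : E).

Local Notation ip p := (bil (g p)).
Local Notation Jp p := (mulmx^~ (J p)).
Local Notation A p := (fun v x => x *m cov g v J p).
Local Notation phi p v x y := (bil (g p) (x *m cov g v J p) y).

(** The difference between the curvature and the curvature that would be [nu] on
    all planes. *)
Definition defect p x y z u :=
  Riem g p x y z u - nu p * (ip p y z * ip p x u - ip p x z * ip p y u).
Definition sig p := quot (ip p) (Jp p) (defect p).

Let H p (Up : U p) := hermitian_at gsym gpos J_sq J_iso Up.

Lemma defect_curvature_like p : U p -> curvature_like (defect p).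
Proof.
move=> Up; apply: curvature_like_sub.
- exact: (Riem_curvature_like oU sg gsym gpos Up).
- exact: bil_scalar.
- exact: gsym.
Qed.

Lemma defect_eq0 p x y : U p -> bil (g p) (x *m J p) y = 0 -> defect p x y y x = 0.
Proof.
move=> Up o; rewrite /defect antihol // (gsym Up y x) expr2.
by move: (bil _ _ _) (bil _ _ _) (bil _ _ _) => a b c; ring.
Qed.

Lemma RiemE p x y z u : U p ->
  Riem g p x y z u = nu p * (ip p y z * ip p x u - ip p x z * ip p y u)
   - 6^-1 * wedge_om (ip p) (Jp p) (sig p) x y z u.
Proof.
move=> Up; have := curv_quot (H Up) (defect_curvature_like Up) (fun x y => @defect_eq0 p x y Up) x y z u.
rewrite -/(sig p) {1}/defect; move: (wedge_om _ _ _ _ _ _ _) (Riem _ _ _ _ _ _) => a b; lra.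
Qed.

Lemma sig_scalar p y : U p -> scalar (sig p ^~ y).
Proof. by move=> Up; exact: (quot_scalar (H Up) (defect_curvature_like Up)). Qed.

Lemma sig_skew p x y : U p -> sig p x y = - sig p y x.
Proof.
move=> Up.
exact: (quot_skew (H Up) (defect_curvature_like Up) (fun x y => @defect_eq0 p x y Up)).
Qed.

Lemma smooth_ip x y : smooth_on U (fun q => ip q x y).
Proof. exact: smooth_bil. Qed.

Lemma smooth_Riem x y z u : smooth_on U (fun q => Riem g q x y z u).
Proof.
apply: (smooth_eq oU (f := fun q => bil (Om g x y q *m g q) z u)).
  by move=> q _; rewrite /Riem bilMl.
exact: (smooth_bil oU z u (mxs_mul oU (smooth_Om oU sg gpos x y) sg)).
Qed.

Lemma smooth_om x y : smooth_on U (fun q => ip q (x *m J q) y).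
Proof.
apply: (smooth_eq oU (f := fun q => bil (J q *m g q) x y)).
  by move=> q _; rewrite bilMl.
exact: (smooth_bil oU x y (mxs_mul oU sJ sg)).
Qed.

Lemma smooth_ipJ x y : smooth_on U (fun q => ip q x (y *m J q)).
Proof.
apply: (smooth_eq oU (f := fun q => bil (g q *m (J q)^T) x y)).
  by move=> q _; rewrite bilMr.
exact: (smooth_bil oU x y (mxs_mul oU sg (mxs_tr oU sJ))).
Qed.

Lemma smooth_RiemJ4 x y z u : smooth_on U (fun q => Riem g q x y z (u *m J q)).
Proof.
apply: (smooth_eq oU (f := fun q => bil (Om g x y q *m g q *m (J q)^T) z u)).
  by move=> q _; rewrite /Riem bilMr bilMl.
exact: (smooth_bil oU z u (mxs_mul oU (mxs_mul oU (smooth_Om oU sg gpos x y) sg) (mxs_tr oU sJ))).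
Qed.

Lemma smooth_RiemJ14 x y z u : smooth_on U (fun q => Riem g q (x *m J q) y z (u *m J q)).
Proof.
apply: (smooth_eq oU (f := fun q => \sum_i (x *m J q) 0 i * Riem g q (delta_mx 0 i) y z (u *m J q))).
  move=> q Uq; apply: esym.
  exact: (scalar_expand _ (curv_scalar (Riem_curvature_like oU sg gsym gpos Uq) y z (u *m J q))).
apply: (smooth_sum oU) => i.
exact: (smoothM oU (mxs_mul oU (mxs_cst oU x) sJ 0 i) (smooth_RiemJ4 (delta_mx 0 i) y z u)).
Qed.

(** [sig] is a quotient with denominators [ip y y], hence smooth with [nu]. *)
Lemma smooth_sig x y : smooth_on U (fun q => sig q x y).
Proof.
have [->|y0] := eqVneq y 0.
  apply: (smooth_eq oU) (smooth_cst oU 0) => q Uq.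
  by rewrite /sig /quot (scalar_form0 (bil_scalar (g q) 0)) invr0 mulr0.
have n0 q : U q -> ip q y y != 0 by move=> Uq; rewrite gt_eqF // gpos.
have sV := smoothV oU n0 (smooth_ip y y).
have s1 : smooth_on U (fun q => defect q x y y (y *m J q)).
  apply: (smoothB oU (smooth_RiemJ4 x y y y)); apply: (smoothM oU snu).
  apply: (smoothB oU (smoothM oU (smooth_ip y y) (smooth_ipJ x y))).
  exact: (smoothM oU (smooth_ip x y) (smooth_ipJ y y)).
have s2 : smooth_on U (fun q => defect q (y *m J q) y y (y *m J q)).
  apply: (smooth_eq oU (f := fun q => Riem g q (y *m J q) y y (y *m J q) -
     nu q * (ip q y y * ip q y y - ip q (y *m J q) y * ip q y (y *m J q)))).
    by move=> q Uq; rewrite /defect J_iso.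
  apply: (smoothB oU (smooth_RiemJ14 y y y y)); apply: (smoothM oU snu).
  apply: (smoothB oU (smoothM oU (smooth_ip y y) (smooth_ip y y))).
  exact: (smoothM oU (smooth_om y y) (smooth_ipJ y y)).
apply: (smoothM oU _ sV); apply: (smoothN oU).
apply: (smoothD oU (smoothM oU (smooth_cst oU 2) s1)).
exact: (smoothM oU (smoothM oU (smooth_om x y) sV) s2).
Qed.

(** ** The second Bianchi identity along antiholomorphic planes *)
Definition nabla_Riem v p x y z u := 'D_v (fun q => Riem g q x y z u) p
  - Riem g p (x *m conn g v p) y z u - Riem g p x (y *m conn g v p) z u
  - Riem g p x y (z *m conn g v p) u - Riem g p x y z (u *m conn g v p).

Lemma nabla_RiemE v p x y z u : U p -> nabla_Riem v p x y z u =
  ip p (z *m cov g v (Om g x y) p) u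
  - Riem g p (x *m conn g v p) y z u - Riem g p x (y *m conn g v p) z u.
Proof.
move=> Up; rewrite /nabla_Riem /Riem.
rewrite (derive_bil_end oU sg gsym gpos z u v (smooth_Om oU sg gpos x y) Up).
by move: (bil _ _ _) (bil _ _ _) (bil _ _ _) (bil _ _ _) (bil _ _ _) => a b c d e; ring.
Qed.

(** The two correction terms of [nabla_RiemE] cancel in the cyclic sum by the
    symmetry of the connection. *)
Lemma nabla_Riem_cyclic v p x y z u : U p ->
  nabla_Riem v p x y z u + nabla_Riem x p y v z u + nabla_Riem y p v x z u = 0.
Proof.
move=> Up; rewrite !nabla_RiemE //.
have HR := Riem_curvature_like oU sg gsym gpos Up.
have T := torsion_free oU sg gsym gpos _ _ Up.
rewrite (T v x) (T v y) (T x y).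
rewrite (curvC12 HR y) (curvC12 HR x (v *m _)) (curvC12 HR v).
have : ip p (z *m cov g v (Om g x y) p) u + ip p (z *m cov g x (Om g y v) p) u
   + ip p (z *m cov g y (Om g v x) p) u = 0.
  rewrite -!bilDl -!mulmxDr (cov_Om_cyclic oU sg gpos x y v Up) mulmx0.
  exact: (scalar_form0 (bil_scalar (g p) u)).
move: (cov g v (Om g x y) p) (cov g x (Om g y v) p) (cov g y (Om g v x) p) => M1 M2 M3.
move: (Riem g p (v *m _) y z u) (Riem g p (v *m _) x z u) (Riem g p (x *m _) v z u) => a b c.
lra.
Qed.

Lemma derive_om v p x y : U p -> 'D_v (fun q => ip q (x *m J q) y) p =
  phi p v x y + ip p (x *m conn g v p *m J p) y + ip p (x *m J p) (y *m conn g v p).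
Proof. by move=> Up; exact: (derive_bil_end oU sg gsym gpos x y v sJ Up). Qed.

Lemma derive_ip v p x y : U p -> 'D_v (fun q => ip q x y) p =
  ip p (x *m conn g v p) y + ip p x (y *m conn g v p).
Proof.
move=> Up; rewrite (derive_bil oU x y v sg Up) (derive_g oU sg gsym gpos v Up).
by rewrite bilDm bilMl bilMr.
Qed.

Lemma Riem_polar p x y z : U p -> Riem g p x y y z =
  nu p * (ip p y y * ip p x z - ip p x y * ip p y z)
  + 2^-1 * (ip p (x *m J p) y * sig p z y + ip p (z *m J p) y * sig p x y).
Proof.
move=> Up; rewrite (RiemE _ _ _ _ Up) /wedge_om.
rewrite (sig_skew y z Up) (om_skew (H Up) y z).
have := sig_skew y y Up; have := om_skew (H Up) y y.
move: (bil _ (y *m J p) y) (sig p y y) => a b a0 b0.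
have -> : a = 0 by lra.
have -> : b = 0 by lra.
by field.
Qed.

(** The derivatives of [sig] are multiplied by [om x y] or [om z y], which
    vanish at [p]. *)
Lemma derive_antihol v p x y z : U p ->
  ip p (x *m J p) y = 0 -> ip p (z *m J p) y = 0 ->
  'D_v (fun q => Riem g q x y y z) p =
    'D_v nu p * (ip p y y * ip p x z - ip p x y * ip p y z)
    + nu p * 'D_v (fun q => ip q y y * ip q x z - ip q x y * ip q y z) p
    + 2^-1 * ('D_v (fun q => ip q (x *m J q) y) p * sig p z y
              + 'D_v (fun q => ip q (z *m J q) y) p * sig p x y).
Proof.
move=> Up o1 o2.
rewrite (derive_eq_on oU v Up (fun q Uq => Riem_polar x y z Uq)).
have sp := smoothB oU (smoothM oU (smooth_ip y y) (smooth_ip x z))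
  (smoothM oU (smooth_ip x y) (smooth_ip y z)).
have s1 := smoothM oU (smooth_om x y) (smooth_sig z y).
have s2 := smoothM oU (smooth_om z y) (smooth_sig x y).
have c2 := smooth_cst oU (2^-1 : R).
rewrite (smooth_deriveD oU v (smoothM oU snu sp) (smoothM oU c2 (smoothD oU s1 s2)) Up).
rewrite (smooth_deriveM oU v snu sp Up) (smooth_deriveM oU v c2 (smoothD oU s1 s2) Up).
rewrite (smooth_deriveD oU v s1 s2 Up).
rewrite (smooth_deriveM oU v (smooth_om x y) (smooth_sig z y) Up).
rewrite (smooth_deriveM oU v (smooth_om z y) (smooth_sig x y) Up).
rewrite derive_cst mul0r add0r o1 o2 !mul0r !addr0.
by [].
Qed.

(** The polarisation of [Riem_polar] in [y], needed because [y] itself is not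
    parallel. *)
Lemma Riem_polar2 p x y z w : U p -> Riem g p x w y z + Riem g p x y w z =
  nu p * (2 * ip p y w * ip p x z - ip p x w * ip p y z - ip p x y * ip p w z)
  + 2^-1 * (ip p (x *m J p) w * sig p z y + ip p (x *m J p) y * sig p z w
     + ip p (z *m J p) w * sig p x y + ip p (z *m J p) y * sig p x w).
Proof.
move=> Up; rewrite !(RiemE _ _ _ _ Up) /wedge_om.
rewrite (sig_skew y z Up) (sig_skew w z Up) (sig_skew w y Up).
rewrite (om_skew (H Up) y z) (om_skew (H Up) w z) (om_skew (H Up) w y).
rewrite (gsym Up w y).
by field.
Qed.

Lemma nabla_Riem_antihol v p x y z : U p ->
  ip p (x *m J p) y = 0 -> ip p (z *m J p) y = 0 ->
  nabla_Riem v p x y y z = 'D_v nu p * (ip p y y * ip p x z - ip p x y * ip p y z)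
    + 2^-1 * (phi p v x y * sig p z y + phi p v z y * sig p x y).
Proof.
move=> Up o1 o2; rewrite /nabla_Riem (derive_antihol v Up o1 o2).
rewrite (derive_om v x y Up) (derive_om v z y Up).
have sp := smoothM oU (smooth_ip y y) (smooth_ip x z).
have sq := smoothM oU (smooth_ip x y) (smooth_ip y z).
have -> : 'D_v (fun q => ip q y y * ip q x z - ip q x y * ip q y z) p =
   'D_v (fun q => ip q y y * ip q x z) p - 'D_v (fun q => ip q x y * ip q y z) p.
  exact: (@deriveB R E _ _ _ p v (smooth_derivable oU sp Up) (smooth_derivable oU sq Up)).
rewrite (smooth_deriveM oU v (smooth_ip y y) (smooth_ip x z) Up).
rewrite (smooth_deriveM oU v (smooth_ip x y) (smooth_ip y z) Up).
rewrite !(derive_ip v _ _ Up).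
have := Riem_polar2 x y z (y *m conn g v p) Up.
have := Riem_polar (x *m conn g v p) y z Up.
have := Riem_polar x y (z *m conn g v p) Up.
move: ('D_v nu p) => dn.
rewrite o1 o2 (gsym Up (y *m conn g v p) y).
move: (Riem g p (x *m _) y y z) (Riem g p x (y *m _) y z) (Riem g p x y (y *m _) z)
  (Riem g p x y y (z *m _)) => R1 R2 R3 R4 E4 E1 E23.
rewrite E4 E1; move: E23; move: (sig p _ _) (sig p _ _) (sig p _ _) (sig p _ _) => *.
lra.
Qed.

Lemma nabla_Riem_skew12 v p x y z u : U p ->
  nabla_Riem v p y x z u = - nabla_Riem v p x y z u.
Proof.
move=> Up; have HR q Uq := Riem_curvature_like oU sg gsym gpos (p := q) Uq.
have h q : U q -> Riem g q y x z u = -1 * Riem g q x y z u.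
  by move=> Uq; rewrite (curvC12 (HR q Uq)) mulN1r.
rewrite /nabla_Riem (derive_eq_on oU v Up h).
rewrite (smooth_deriveM oU v (smooth_cst oU (-1)) (smooth_Riem x y z u) Up) derive_cst.
rewrite (curvC12 (HR p Up) y x) (curvC12 (HR p Up) (y *m _) x) (curvC12 (HR p Up) y (x *m _)).
rewrite (curvC12 (HR p Up) y x).
by ring.
Qed.

Lemma nabla_Riem_skew34 v p x y z u : U p ->
  nabla_Riem v p x y u z = - nabla_Riem v p x y z u.
Proof.
move=> Up; have HR q Uq := Riem_curvature_like oU sg gsym gpos (p := q) Uq.
have h q : U q -> Riem g q x y u z = -1 * Riem g q x y z u.
  by move=> Uq; rewrite (curvC34 (HR q Uq)) mulN1r.
rewrite /nabla_Riem (derive_eq_on oU v Up h).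
rewrite (smooth_deriveM oU v (smooth_cst oU (-1)) (smooth_Riem x y z u) Up) derive_cst.
rewrite (curvC34 (HR p Up) _ y u) (curvC34 (HR p Up) x _ u) (curvC34 (HR p Up) x y (u *m _)).
rewrite (curvC34 (HR p Up) x y u).
by ring.
Qed.

Local Notation cperp p := (cperp (bil (g p)) (mulmx^~ (J p))).

(** All six pairs of [v], [x], [y] satisfy the hypothesis of
    [nabla_Riem_antihol], so the cyclic sum contains no derivative of [sig]; the
    closedness of the fundamental form removes [phi y v x]. *)
Lemma bianchi_antihol p v x y : U p -> cperp p v x -> cperp p v y -> cperp p x y ->
  'D_v nu p * (ip p x x * ip p y y) =
  - 2^-1 * (sig p x y * phi p v x y + sig p v x * phi p y x y - sig p v y * phi p x x y).
Proof.
move=> Up [vx vJx] [vy vJy] [xy xJy].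
have om0 a b : ip p a (b *m J p) = 0 -> ip p (a *m J p) b = 0.
  by move=> h; rewrite (bilJ J_sq J_iso _ _ Up) h oppr0.
have om0' a b : ip p a (b *m J p) = 0 -> ip p (b *m J p) a = 0.
  by move=> h; rewrite (gsym Up).
have := nabla_Riem_cyclic v x y y x Up.
rewrite (nabla_Riem_skew12 x v y y x Up) (nabla_Riem_skew34 y v x x y Up).
rewrite (nabla_Riem_antihol v Up (om0 _ _ xJy) (om0 _ _ xJy)).
rewrite (nabla_Riem_antihol x Up (om0 _ _ vJy) (om0 _ _ xJy)).
rewrite (nabla_Riem_antihol y Up (om0 _ _ vJx) (om0' _ _ xJy)).
rewrite vx vy xy (sig_skew y x Up) (phi_skew oU sg gsym gpos sJ J_sq J_iso y y x Up).
rewrite (phi_skew oU sg gsym gpos sJ J_sq J_iso x v y Up).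
have := kform_closed Up v x y.
move: (phi p v x y) (phi p x y v) (phi p y v x) (phi p y x y) (phi p x x y) => f1 f2 f3 f4 f5.
move: (sig p x y) (sig p v x) (sig p v y) ('D_v nu p) ('D_x nu p) ('D_y nu p) => s1 s2 s3 d1 d2 d3.
move: (bil _ x x) (bil _ y y) => a b e.
have -> : f3 = - f1 - f2 by lra.
lra.
Qed.

(** ** The second covariant derivative of the fundamental form *)
Let cJ b := cov g b J.
Let scJ b : mx_smooth_on U (cJ b).
Proof. exact: (smooth_cov oU sg gpos b sJ). Qed.

(** The last term is there because the constant field [b] is not parallel. *)
Definition Psi p a b x y :=
  ip p (x *m cov g a (cJ b) p) y - phi p (b *m conn g a p) x y.

Lemma derive_phi a b x y p : U p -> 'D_a (fun q => phi q b x y) p = Psi p a b x y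
  + phi p (b *m conn g a p) x y + phi p b (x *m conn g a p) y + phi p b x (y *m conn g a p).
Proof.
move=> Up; rewrite (derive_bil_end oU sg gsym gpos x y a (scJ b) Up) /Psi.
by move: (bil _ _ _) (bil _ _ _) (bil _ _ _) (bil _ _ _) => *; ring.
Qed.

Lemma smooth_phi b x y : smooth_on U (fun q => phi q b x y).
Proof.
apply: (smooth_eq oU (f := fun q => bil (cJ b q *m g q) x y)).
  by move=> q _; rewrite bilMl.
exact: (smooth_bil oU x y (mxs_mul oU (scJ b) sg)).
Qed.

Let pskew := phi_skew oU sg gsym gpos sJ J_sq J_iso.

Lemma Psi_skew p a b x y : U p -> Psi p a b x y = - Psi p a b y x.
Proof.
move=> Up.
have h q : U q -> phi q b x y = -1 * phi q b y x.
  by move=> Uq; rewrite (pskew b x y Uq) mulN1r.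
have := derive_eq_on oU a Up h.
rewrite (smooth_deriveM oU a (smooth_cst oU (-1)) (smooth_phi b y x) Up) derive_cst.
rewrite (derive_phi a b x y Up) (derive_phi a b y x Up).
rewrite (pskew _ x y Up) (pskew b (x *m _) y Up) (pskew b x (y *m _) Up).
move: (Psi _ _ _ _ _) (Psi _ _ _ _ _) (bil _ _ _) (bil _ _ _) (bil _ _ _) => c d e f k.
lra.
Qed.

Lemma Psi_cyclic p a x y z : U p ->
  Psi p a x y z + Psi p a y z x + Psi p a z x y = 0.
Proof.
move=> Up.
have h q : U q -> phi q x y z + (phi q y z x + phi q z x y) = 0.
  by move=> Uq; rewrite addrA; exact: kform_closed.
have := derive_eq_on oU a Up h; rewrite derive_cst.
rewrite (smooth_deriveD oU a (smooth_phi x y z) (smoothD oU (smooth_phi y z x) (smooth_phi z x y)) Up).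
rewrite (smooth_deriveD oU a (smooth_phi y z x) (smooth_phi z x y) Up) !(derive_phi a _ _ _ Up).
have := kform_closed Up (x *m conn g a p) y z; have := kform_closed Up x (y *m conn g a p) z.
have := kform_closed Up x y (z *m conn g a p).
move: (Psi _ _ _ _ _) (Psi _ _ _ _ _) (Psi _ _ _ _ _) => c d e.
lra.
Qed.

Let cov_oppr b q : U q -> cov g (- b) J q = - cov g b J q.
Proof.
move=> Uq; have c0 : cov g 0 J q = 0.
  by have := cov_linear oU g (-1) 0 0 sJ Uq; rewrite scaler0 addr0 scaleN1r addNr.
by have := cov_linear oU g (-1) b 0 sJ Uq; rewrite c0 !addr0 !scaleN1r.
Qed.

Lemma Psi_oppr p a b x y : U p -> Psi p a (- b) x y = - Psi p a b x y.
Proof.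
move=> Up.
have n q : U q -> cJ (- b) q = (-1)%:M *m cJ b q.
  by move=> Uq; rewrite mul_scalar_mx scaleN1r; exact: cov_oppr.
rewrite /Psi (cov_eq oU g a Up n).
rewrite (covM oU g a (mxs_cst oU (-1)%:M) (scJ b) Up) cov_scalar mul0mx add0r.
rewrite mul_scalar_mx scaleN1r mulmxN bilNl mulNmx cov_oppr //.
by rewrite mulmxN bilNl opprB opprK addrC.
Qed.

Lemma Psi_ricci p a b x y : U p ->
  Psi p a b x y - Psi p b a x y = Riem g p a b (x *m J p) y + Riem g p a b x (y *m J p).
Proof.
move=> Up; rewrite /Psi (torsion_free oU sg gsym gpos a b Up) /Riem.
rewrite /cJ; have := ricci oU sg gpos a b sJ Up.
move: (cov g a (cov g b J) p) (cov g b (cov g a J) p) (Om g a b p) => M1 M2 M3.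
move/(congr1 (fun M => ip p (x *m M) y)).
rewrite !mulmxDr !mulmxN !bilDl !bilNl !mulmxA (bilJ J_sq J_iso (x *m M3) y Up).
lra.
Qed.

Lemma A_anti p v x : U p -> x *m J p *m cov g v J p = - (x *m cov g v J p *m J p).
Proof.
by move=> Up; rewrite -[in RHS]mulmxA (cov_J_anticomm oU g sJ J_sq v Up) mulmxN opprK mulmxA.
Qed.

Lemma phi_J p v x y : U p -> phi p v (x *m J p) y = phi p v x (y *m J p).
Proof. by move=> Up; rewrite A_anti // bilNl (bilJ J_sq J_iso _ _ Up) opprK. Qed.

(** The covariant derivative of [A v J + J A v = 0]. *)
Lemma Psi_J p a b x y : U p -> Psi p a b (x *m J p) y - Psi p a b x (y *m J p) =
  ip p (x *m cov g a J p) (y *m cov g b J p) + ip p (x *m cov g b J p) (y *m cov g a J p).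
Proof.
move=> Up; rewrite /Psi (phi_J _ _ _ Up).
have z q : U q -> cJ b q *m J q + J q *m cJ b q = 0%:M.
  by move=> Uq; rewrite (cov_J_anticomm oU g sJ J_sq b Uq) addNr raddf0.
have := cov_eq oU g a Up z; rewrite cov_scalar.
rewrite (covD oU g a (mxs_mul oU (scJ b) sJ) (mxs_mul oU sJ (scJ b)) Up).
rewrite (covM oU g a (scJ b) sJ Up) (covM oU g a sJ (scJ b) Up) /cJ.
have ka w t := pskew a w t Up; have kb w t := pskew b w t Up.
move: (cov g a (cov g b J) p) (cov g a J p) (cov g b J p) ka kb => M Fa Fb ka kb.
move/(congr1 (fun M => ip p (x *m M) y)); rewrite mulmx0 (scalar_form0 (bil_scalar (g p) y)).
rewrite !mulmxDr !bilDl !mulmxA (bilJ J_sq J_iso (x *m M) y Up).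
rewrite (ka (x *m Fb)) (kb (x *m Fa)) (gsym Up (y *m Fa)) (gsym Up (y *m Fb)).
lra.
Qed.

Lemma pointwise_data_at p : U p ->
  pointwise_data (ip p) (Jp p) (A p) (sig p) (nu p) (fun v => 'D_v nu p).
Proof.
move=> Up; split.
- by move=> x a u v; rewrite (cov_linear oU g a u v sJ Up) mulmxDr scalemxAr.
- by move=> v a x y; rewrite mulmxDl scalemxAl.
- by move=> v x y; exact: pskew.
- by move=> v x; exact: A_anti.
- by move=> v x y; exact: kform_closed.
- by move=> y; exact: sig_scalar.
- by move=> x y; exact: sig_skew.
- by move=> v x y; exact: bianchi_antihol.
- move=> x y z u; apply: (gray_identity (H Up) (K := Riem g p) (Psi := Psi p)).
  + by move=> v w; exact: A_anti.
  + by move=> v w t; exact: pskew.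
  + by move=> v w t; exact: kform_closed.
  + by move=> a b v w; exact: Psi_skew.
  + by move=> a b v w; exact: Psi_cyclic.
  + by move=> a b v w; exact: Psi_oppr.
  + by move=> a b v w; exact: Psi_ricci.
  + by move=> a b v w; exact: Psi_J.
  + by move=> t; exact: sig_scalar.
  + by move=> v w; exact: sig_skew.
  + by move=> *; exact: RiemE.
Qed.

Hypothesis m8 : (8 <= m)%N.

Lemma cov_J_eq0 p v : U p -> cov g v J p = 0.
Proof.
move=> Up; apply/row_matrixP => i; rewrite row0 rowE.
exact: (pointwise_parallel (H Up) (pointwise_data_at Up) m8 v).
Qed.

Lemma derive_nu_eq0 p v : U p -> 'D_v nu p = 0.
Proof. by move=> Up; exact: (dnu_eq0 (H Up) (pointwise_data_at Up) m8 v). Qed.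

(** This is [tau x x = 0], by the expression of the curvature in terms of [sig]. *)
Lemma Riem_holomorphic p x : U p ->
  Riem g p x (x *m J p) (x *m J p) x = 4 * nu p * ip p x x ^+ 2.
Proof.
move=> Up; rewrite Riem_polar // !J_iso //.
have := tau_eq0 (H Up) (pointwise_data_at Up) m8 x; rewrite /tau.
rewrite (sig_skew (x *m J p) x Up).
have xJx : ip p x (x *m J p) = 0.
  by have := bilJ J_sq J_iso x x Up; rewrite (gsym Up (x *m J p)); lra.
rewrite (gsym Up (x *m J p) x) xJx.
move: (sig p _ _) (ip p x x) (nu p) => s a n e.
have -> : s = 3 * (n * a) by lra.
by field.
Qed.

End Local.

(** * Rigidity without regularity of the sectional curvature function *)

Lemma open_neq0 (R : realType) (m : nat) (U : set 'rV[R]_m) (f : 'rV[R]_m -> R) :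
  open U -> smooth_on U f -> open (U `&` [set q | f q != 0]).
Proof.
move=> oU sf; rewrite openE => q [Uq /= fq].
have f0 : 0 < `|f q| by rewrite normr_gt0.
have [d d0 Hd] := (cts_normP f q).1 (smooth_continuous sf Uq) _ f0.
have [e e0 He] := open_normP oU Uq.
apply/nbhs_ballP; exists (Num.min d e); first by rewrite /= lt_min d0.
move=> q'; rewrite -ball_normE /ball_ /= distrC lt_min => /andP[qd qe].
split; first exact: He.
by apply: contraTneq (Hd _ qd) => ->; rewrite sub0r normrN ltxx.
Qed.

Section LocalTheorem.
Context {R : realType} {m : nat}.
Local Notation E := 'rV[R]_m.
Variable U : set E.
Hypothesis oU : open U.
Variables g J : E -> 'M[R]_m.
Hypothesis sg : mx_smooth_on U g.
Hypothesis gsym : forall p, U p -> forall u v, bil (g p) u v = bil (g p) v u.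
Hypothesis gpos : forall p, U p -> forall u, u != 0 -> 0 < bil (g p) u u.
Hypothesis sJ : mx_smooth_on U J.
Hypothesis J_sq : forall p, U p -> J p *m J p = - 1%:M.
Hypothesis J_iso : forall p, U p -> forall u v,
  bil (g p) (u *m J p) (v *m J p) = bil (g p) u v.
Hypothesis kform_closed : forall p, U p -> forall v x y,
  bil (g p) (x *m cov g v J p) y + bil (g p) (y *m cov g x J p) v
  + bil (g p) (v *m cov g y J p) x = 0.
Variable nu : E -> R.
Hypothesis antihol : forall p, U p -> forall x y, bil (g p) (x *m J p) y = 0 ->
  Riem g p x y y x = nu p * (bil (g p) x x * bil (g p) y y - bil (g p) x y ^+ 2).
Hypothesis m8 : (8 <= m)%N.

(** Fix [y] and start with [x] spanning an antiholomorphic plane with [y] at [p].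
    At nearby points [X q] is a combination of [x] and [y *m J p] for which the
    plane is still antiholomorphic.  Its coefficients are smooth, so [nu] is a
    quotient of smooth functions. *)
Lemma nu_locally_smooth p : U p ->
  exists W : set E, [/\ open W, W p, W `<=` U & smooth_on W nu].
Proof.
move=> Up; have Hp := hermitian_at gsym gpos J_sq J_iso Up.
have [y y0 _] := cperp_vector Hp (ws := [::]) (leq_trans (isT : 1 <= 8)%N m8).
have [x x0 xp] := cperp_vector Hp (ws := [:: y]) (leq_trans (isT : 3 <= 8)%N m8).
have [xy xJy] := xp y (mem_head _ _).
pose z := y *m J p.
pose a q := bil (g q) (z *m J q) y; pose b q := bil (g q) (x *m J q) y.
pose X q := a q *: x - b q *: z.
have sa : smooth_on U a by exact: (smooth_om oU sg sJ z y).
have sb : smooth_on U b by exact: (smooth_om oU sg sJ x y).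
have sip u v : smooth_on U (fun q => bil (g q) u v) := smooth_ip oU sg u v.
have sR u v w t : smooth_on U (fun q => Riem g q u v w t).
  exact: (smooth_Riem oU sg gpos u v w t).
pose den q := bil (g q) (X q) (X q) * bil (g q) y y - bil (g q) (X q) y ^+ 2.
pose num q := Riem g q (X q) y y (X q).
have sM := smoothM oU; have sB := smoothB oU.
have sden : smooth_on U den.
  apply: (smooth_eq oU (f := fun q =>
    (a q * a q * bil (g q) x x - a q * b q * bil (g q) x z
     - (b q * a q * bil (g q) z x - b q * b q * bil (g q) z z)) * bil (g q) y y
    - (a q * bil (g q) x y - b q * bil (g q) z y) * (a q * bil (g q) x y - b q * bil (g q) z y))).
    move=> q _; rewrite /den /X !(bilDl, bilDr, bilNl, bilNr, bilZl, bilZr).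
    by move: (a q) (b q) (bil _ _ _) => *; ring.
  have saa := sM _ _ sa sa; have sab := sM _ _ sa sb; have sba := sM _ _ sb sa; have sbb := sM _ _ sb sb.
  have sXy := sB _ _ (sM _ _ sa (sip x y)) (sM _ _ sb (sip z y)).
  apply: (sB _ _ _ (sM _ _ sXy sXy)); apply: (sM _ _ _ (sip y y)).
  exact: (sB _ _ (sB _ _ (sM _ _ saa (sip x x)) (sM _ _ sab (sip x z)))
    (sB _ _ (sM _ _ sba (sip z x)) (sM _ _ sbb (sip z z)))).
have snum : smooth_on U num.
  apply: (smooth_eq oU (f := fun q =>
    a q * a q * Riem g q x y y x - a q * b q * Riem g q x y y z
     - (b q * a q * Riem g q z y y x - b q * b q * Riem g q z y y z))).
    move=> q Uq; have HR := Riem_curvature_like oU sg gsym gpos Uq.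
    rewrite /num /X !(curvE HR).
    by move: (a q) (b q) (Riem _ _ _ _ _ _) => *; ring.
  have saa := sM _ _ sa sa; have sab := sM _ _ sa sb; have sba := sM _ _ sb sa; have sbb := sM _ _ sb sb.
  exact: (sB _ _ (sB _ _ (sM _ _ saa (sR x y y x)) (sM _ _ sab (sR x y y z)))
    (sB _ _ (sM _ _ sba (sR z y y x)) (sM _ _ sbb (sR z y y z)))).
have ap : a p = - bil (g p) y y by rewrite /a /z -mulmxA (J_sq Up) mulmxN mulmx1 bilNl.
have bp : b p = 0 by rewrite /b (bilJ J_sq J_iso _ _ Up) xJy oppr0.
have denp : den p != 0.
  rewrite /den /X bp scale0r subr0 !(bilZl, bilZr) xy mulr0 expr0n subr0 ap.
  by rewrite !mulf_neq0 ?oppr_eq0 ?gt_eqF ?gpos.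
exists (U `&` [set q | den q != 0]); split; [exact: open_neq0|by []|by move=> q []|].
have oW := open_neq0 oU sden.
have sub (f : E -> R) : smooth_on U f -> smooth_on (U `&` [set q | den q != 0]) f.
  by move=> sf s q [Uq _]; exact: sf.
have n0 q : (U `&` [set q | den q != 0]) q -> den q != 0 by case.
apply: (smooth_eq oW) (smoothM oW (sub _ snum) (smoothV oW n0 (sub _ sden))) => q [Uq dq].
rewrite /num (antihol Uq).
  by rewrite mulfK.
rewrite /X mulmxDl mulNmx -!scalemxAl bilDl bilNl !bilZl -/(a q) -/(b q).
by rewrite mulrC subrr.
Qed.

(** The three conclusions hold when [nu] is smooth, and being local they can be
    checked on the neighbourhoods given by [nu_locally_smooth]. *)
Theorem local_rigidity p : U p ->
  [/\ forall v, cov g v J p = 0, forall v, is_derive p v nu 0 &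
      forall x, Riem g p x (x *m J p) (x *m J p) x = 4 * nu p * bil (g p) x x ^+ 2].
Proof.
move=> Up; have [W [oW Wp WU snu]] := nu_locally_smooth Up.
have sub (F : E -> 'M[R]_m) : mx_smooth_on U F -> mx_smooth_on W F.
  by move=> sF i j s q /WU; exact: sF.
have s1 := sub _ sg; have s2 := sub _ sJ.
have h1 q (Wq : W q) := gsym (WU _ Wq); have h2 q (Wq : W q) := gpos (WU _ Wq).
have h3 q (Wq : W q) := J_sq (WU _ Wq); have h4 q (Wq : W q) := J_iso (WU _ Wq).
have h5 q (Wq : W q) := kform_closed (WU _ Wq); have h6 q (Wq : W q) := antihol (WU _ Wq).
split.
- by move=> v; exact: (cov_J_eq0 oW s1 h1 h2 s2 h3 h4 h5 snu h6 m8 v Wp).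
- move=> v; split; first exact: (smooth_derivable oW snu Wp).
  exact: (derive_nu_eq0 oW s1 h1 h2 s2 h3 h4 h5 snu h6 m8 v Wp).
- by move=> x; exact: (Riem_holomorphic oW s1 h1 h2 s2 h3 h4 h5 snu h6 m8 x Wp).
Qed.

End LocalTheorem.

(** * Planes, charts and connectedness *)

Section Planes.
Context {R : realType} {m : nat}.
Local Notation E := 'rV[R]_m.
Variable G : 'M[R]_m.
Hypothesis Gsym : forall u v : E, bil G u v = bil G v u.
Hypothesis Gpos : forall u : E, u != 0 -> 0 < bil G u u.
Implicit Types (u v : E) (P : 'M[R]_(2, m)).

Definition gram u v := bil G u u * bil G v v - bil G u v ^+ 2.

Lemma mul_row2 (c : 'rV[R]_2) P : c *m P = c 0 0 *: row 0 P + c 0 1 *: row 1 P.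
Proof.
apply/rowP => j; rewrite !mxE big_ord_recl big_ord1 (_ : lift ord0 ord0 = 1) //.
exact: val_inj.
Qed.

(** The equality case of the Cauchy-Schwarz inequality. *)
Lemma gram_eq0 u v : u != 0 -> gram u v = 0 -> v = (bil G u v / bil G u u) *: u.
Proof.
move=> u0 h; have uu := Gpos u0.
apply/eqP; rewrite -subr_eq0; apply/negPn/negP => /Gpos.
set w := v - _; have -> : bil G w w = gram u v / bil G u u.
  rewrite /w -scaleNr !(bilDl, bilDr, bilZl, bilZr) (Gsym v u) /gram.
  by field; rewrite gt_eqF.
by rewrite h mul0r ltxx.
Qed.

Lemma rank2_of_gram P : gram (row 0 P) (row 1 P) != 0 -> \rank P = 2%N.
Proof.
move=> g0; apply/eqP; rewrite -[_ == _]/(row_free P) -kermx_eq0.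
apply/negPn/negP => /rowV0Pn[c /sub_kermxP]; rewrite mul_row2 => e /eqP; apply.
have e1 := congr1 (fun w => bil G w (row 0 P)) e.
have e2 := congr1 (fun w => bil G w (row 1 P)) e.
rewrite /= !(bilDl, bilZl) (scalar_form0 (bil_scalar G _)) in e1.
rewrite /= !(bilDl, bilZl) (scalar_form0 (bil_scalar G _)) in e2.
move: g0 e1 e2; rewrite /gram (Gsym (row 1 P) (row 0 P)).
move: (bil G (row 0 P) (row 0 P)) (bil G (row 0 P) (row 1 P)) (bil G (row 1 P) (row 1 P)) => a b d g0 e1 e2.
have c0 : (a * d - b ^+ 2) * c 0 0 = 0.
  transitivity (d * (c 0 0 * a + c 0 1 * b) - b * (c 0 0 * b + c 0 1 * d)); first by ring.
  by rewrite e1 e2 !mulr0 subr0.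
have c1 : (a * d - b ^+ 2) * c 0 1 = 0.
  transitivity (a * (c 0 0 * b + c 0 1 * d) - b * (c 0 0 * a + c 0 1 * b)); first by ring.
  by rewrite e1 e2 !mulr0 subr0.
apply/rowP => i; rewrite mxE; case: i => [[|[|//]]] i.
  by move/eqP: c0; rewrite mulf_eq0 (negPf g0) => /eqP; rewrite (_ : Ordinal i = 0) //; exact: val_inj.
by move/eqP: c1; rewrite mulf_eq0 (negPf g0) => /eqP; rewrite (_ : Ordinal i = 1) //; exact: val_inj.
Qed.

Lemma gram_of_rank2 P : \rank P = 2%N -> row 0 P != 0 /\ gram (row 0 P) (row 1 P) != 0.
Proof.
move=> /eqP; rewrite -[_ == _]/(row_free P) => /row_freeP[B PB].
have inj (c : 'rV[R]_2) : c *m P = 0 -> c = 0.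
  by move=> h; rewrite -[c]mulmx1 -PB mulmxA h mul0mx.
have u0 : row 0 P != 0.
  apply/eqP => h; have := inj (delta_mx 0 0); rewrite -rowE h => /(_ erefl)/rowP/(_ 0).
  by rewrite !mxE /= => /eqP; rewrite oner_eq0.
split=> //; apply/eqP => /(gram_eq0 u0) h.
set k := _ / _ in h.
have := inj (delta_mx 0 1 - k *: delta_mx 0 0).
rewrite mulmxDl mulNmx -scalemxAl -!rowE -h subrr => /(_ erefl)/rowP/(_ 1).
by rewrite !mxE /= mulr0 subr0 => /eqP; rewrite oner_eq0.
Qed.

End Planes.

Section Chart.
Context {R : realType} {n : nat} {M : smoothManifold R (2 * n)}.
Variable H : almostHermitian M.
Hypothesis hn : (4 <= n)%N.
Hypothesis AK : almost_Kahler H.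
Local Notation E := 'rV[R]_(2 * n).
Variable nu : M -> R.
Hypothesis Hnu : forall a, atlas a -> forall x : M, cdom a x ->
    forall P : 'M[R]_(2, 2 * n), \rank P = 2%N ->
      antiholomorphic (metric H a (cmap a x)) (acs H a (cmap a x)) P ->
      plane_curv (metric H a) (cmap a x) P = nu x.
Variable a : chart R (2 * n) M.
Hypothesis aA : atlas a.

Local Notation g := (metric H a).
Local Notation J := (acs H a).
Local Notation U := (cimg a).

Let oU : open U. Proof. exact: cimg_open. Qed.
Let sg : mx_smooth_on U g. Proof. exact: metric_smooth. Qed.
Let sJ : mx_smooth_on U J. Proof. exact: acs_smooth. Qed.
Let gsym p : U p -> forall u v, bil (g p) u v = bil (g p) v u.
Proof. by move=> Up; exact: (Defs.metric_sym H aA Up). Qed.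
Let gpos p : U p -> forall u, u != 0 -> 0 < bil (g p) u u.
Proof. by move=> Up; exact: (Defs.metric_pos H aA Up). Qed.
Let Jsq p : U p -> J p *m J p = - 1%:M.
Proof. by move=> Up; exact: (acs_sqr H aA Up). Qed.
Let Jiso p : U p -> forall u v, bil (g p) (u *m J p) (v *m J p) = bil (g p) u v.
Proof. by move=> Up; exact: (acs_isometry H aA Up). Qed.

Let kform_closed p : U p -> forall v x y,
  bil (g p) (x *m cov g v J p) y + bil (g p) (y *m cov g x J p) v
  + bil (g p) (v *m cov g y J p) x = 0.
Proof.
move=> Up v x y.
have sc (c : E) : mx_smooth_on U (cst c) := mxs_cst oU c.
have := AK aA (sc v) (sc x) (sc y) Up.
by rewrite !(nabla_kformE oU sg gsym gpos sJ _ _ _ Up).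
Qed.

Lemma sectionalE p u v : U p ->
  sectional g p u v = Riem g p u v v u / gram (g p) u v.
Proof.
move=> Up; rewrite /sectional /Riem.
by rewrite (curvE_const oU sg gpos u v (mxs_cst oU v) Up).
Qed.

(** The hypothesis concerns planes; for linearly dependent [x] and [y] both sides
    are zero. *)
Lemma Riem_antiholomorphic p : U p -> forall x y, bil (g p) (x *m J p) y = 0 ->
  Riem g p x y y x
  = nu (cinv a p) * (bil (g p) x x * bil (g p) y y - bil (g p) x y ^+ 2).
Proof.
move=> Up x y xy; have HR := Riem_curvature_like oU sg gsym gpos Up.
rewrite -/(gram (g p) x y).
have [g0|g0] := eqVneq (gram (g p) x y) 0.
  rewrite g0 mulr0; have [->|x0] := eqVneq x 0.
    exact: (scalar_form0 (curv_scalar HR y y 0)).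
  rewrite (gram_eq0 (gsym Up) (gpos Up) x0 g0) (curvZ2 HR).
  by have := curvC12 HR x x (bil (g p) x y / bil (g p) x x *: x) x; nra.
pose P : 'M[R]_(2, 2 * n) := \matrix_(i < 2) (if i == 0 then x else y).
have P0 : row 0 P = x by rewrite rowK.
have P1 : row 1 P = y by rewrite rowK.
have rP : \rank P = 2%N.
  by apply: (rank2_of_gram (gsym Up)); rewrite P0 P1.
have xJx z : bil (g p) z (z *m J p) = 0.
  by have := bilJ Jsq Jiso z z Up; rewrite (gsym Up (z *m J p)); lra.
have aP : antiholomorphic (g p) (J p) P.
  move=> u v /submxP[c ->] /submxP[d ->]; rewrite !mul_row2 P0 P1.
  rewrite mulmxDl -!scalemxAl !(bilDl, bilDr, bilZl, bilZr) !xJx.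
  have -> : bil (g p) x (y *m J p) = 0.
    by have := bilJ Jsq Jiso x y Up; lra.
  by rewrite (gsym Up y (x *m J p)) xy; ring.
have [x' ax' px'] := Up.
have := Hnu aA ax' rP; rewrite px' => /(_ aP); rewrite -px' (cmapK ax') px'.
rewrite /plane_curv P0 P1 sectionalE // => <-.
by rewrite divfK.
Qed.

Let m8 : (8 <= 2 * n)%N. Proof. by rewrite (leq_mul2l 2 4 n). Qed.

Let rigid p (Up : U p) := local_rigidity oU sg gsym gpos sJ Jsq Jiso kform_closed
  Riem_antiholomorphic m8 Up.

Lemma chart_Kahler V X : mx_smooth_on U X -> forall p, U p -> nabla_acs g J V X p = 0.
Proof.
move=> sX p Up; rewrite (nabla_acsE oU g sJ V sX Up).
by have [-> _ _] := rigid Up; rewrite mulmx0.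
Qed.

(** A holomorphic plane is spanned by [u] and [u *m J]; the second basis vector
    [v] satisfies [u *m J = d u + b v], and [b ^+ 2] is the ratio between numerator
    and denominator of the sectional curvature in the two bases. *)
Lemma chart_holomorphic x (P : 'M[R]_(2, 2 * n)) : cdom a x -> \rank P = 2%N ->
  holomorphic (J (cmap a x)) P -> plane_curv g (cmap a x) P = 4 * nu x.
Proof.
move=> ax rP; set p := cmap a x; have Up : U p by exists x.
move=> /andP[/submxP[c cP] _].
have [u0 g0] := gram_of_rank2 (gsym Up) (gpos Up) rP.
have HR := Riem_curvature_like oU sg gsym gpos Up.
rewrite /plane_curv sectionalE //.
set u := row 0 P in u0 g0 *; set v := row 1 P in g0 *.
have uJ : u *m J p = c 0 0 *: u + c 0 1 *: v.
  by rewrite /u -row_mul cP row_mul mul_row2 !mxE.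
move: uJ; set d := c 0 0; set b := c 0 1 => uJ.
have uJu : bil (g p) u (u *m J p) = 0.
  by have := bilJ Jsq Jiso u u Up; rewrite (gsym Up (u *m J p)); lra.
have uu := gpos Up u0; have [_ _ hol] := rigid Up.
have bv : b *: v = u *m J p - d *: u by rewrite uJ addrC addKr.
have b0 : b != 0.
  apply/eqP => e; have := uJu; rewrite uJ e scale0r addr0 bilZr => /eqP.
  rewrite mulf_eq0 (gt_eqF uu) orbF => /eqP d0.
  have := Jiso Up u u; rewrite uJ e d0 !scale0r addr0.
  by rewrite (scalar_form0 (bil_scalar _ _)) => h; rewrite -h ltxx in uu.
have R0 y z w : Riem g p y y z w = 0 by have := curvC12 HR y y z w; lra.
have R0' y z w : Riem g p z w y y = 0 by have := curvC34 HR z w y y; lra.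
have eR : b ^+ 2 * Riem g p u v v u = 4 * nu x * bil (g p) u u ^+ 2.
  have -> : b ^+ 2 * Riem g p u v v u = Riem g p u (b *: v) (b *: v) u.
    by rewrite (curvZ2 HR) (curvZ3 HR) mulrA expr2.
  rewrite bv -scaleNr !(curvD2 HR, curvD3 HR, curvZ2 HR, curvZ3 HR) !R0 !R0' hol.
  by rewrite /p cmapK //; ring.
have eg : b ^+ 2 * gram (g p) u v = bil (g p) u u ^+ 2.
  have -> : b ^+ 2 * gram (g p) u v = bil (g p) u u * bil (g p) (b *: v) (b *: v) - bil (g p) u (b *: v) ^+ 2.
    by rewrite /gram !(bilZl, bilZr); ring.
  rewrite bv -scaleNr !(bilDl, bilDr, bilZl, bilZr) (Jiso Up) (gsym Up (u *m J p) u) uJu.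
  by ring.
have b2 : b ^+ 2 != 0 by rewrite sqrf_eq0.
by apply: (mulIf g0); rewrite divfK //; apply: (mulfI b2); rewrite eR -eg; ring.
Qed.

Lemma nu_locally_constant x : cdom a x -> \forall y \near x, nu y = nu x.
Proof.
move=> ax; have Up : U (cmap a x) by exists x.
have [e e0 He] := open_normP oU Up.
have cst_nu q : `|q - cmap a x| < e -> nu (cinv a q) = nu x.
  move=> qe; rewrite -[in RHS](cmapK ax).
  apply: (derivative0_ball (f := nu \o cinv a) _ qe) => q' v q'e.
  by have [_ + _] := rigid (He _ q'e); apply.
have n1 : \forall y \near x, cdom a y.
  by apply: open_nbhs_nbhs; split => //; exact: cdom_open.
have n2 : \forall y \near x, `|cmap a y - cmap a x| < e.
  have := cmap_cts ax; rewrite /prop_for /continuous_at.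
  move/(@cvgrPdist_lt _ _ _ (nbhs x) _) => /(_ e e0).
  by apply: filterS => y; rewrite distrC.
by apply: filterS2 n1 n2 => y ay ye; rewrite -(cst_nu _ ye) (cmapK ay).
Qed.

End Chart.

Theorem theorem1 (R : realType) (n : nat) (hn : (4 <= n)%N)
    (M : smoothManifold R (2 * n)) (H : almostHermitian M)
    (Mconn : connected [set: M]%classic) :
  almost_Kahler H -> pointwise_constant_antiholomorphic_curvature H ->
  complex_space_form H.
Proof.
move=> AK [nu Hnu]; split.
  by move=> a aA V X sV sX p Up; exact: (chart_Kahler hn AK Hnu aA V sX Up).
have [[x0 _]|no] := pselect (exists x : M, True); last first.
  by exists 0 => a aA x ax; exfalso; apply: no; exists x.
have lc x : \forall y \near x, nu y = nu x.
  by have [a aA ax] := atlas_cover x; exact: (nu_locally_constant hn AK Hnu aA ax).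
pose B : set M := [set x | nu x = nu x0].
have oB : open B.
  by rewrite openE => x /= Bx; apply: filterS (lc x) => y yx; rewrite /B /= yx.
have cB : closed B.
  rewrite -openC openE => x /= Bx; apply: filterS (lc x) => y /= yx By.
  by apply: Bx; rewrite /B /= -yx.
have BT : B = [set: M].
  apply: Mconn; first by exists x0.
  - by exists B => //; rewrite setTI.
  - by exists B => //; rewrite setTI.
exists (4 * nu x0) => a aA x ax P rP hP.
have <- : nu x = nu x0 by have : B x by rewrite BT.
exact: (chart_holomorphic hn AK Hnu aA ax rP hP).
Qed.
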